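(* Let $\mathbb K$ be an algebraically closed field, $n\ge2$, $r,s\in\mathbb K$ nonzero, $r\ne s$, and $\widetilde U=U_{r,s}(\mathfrak{gl}_n)$. Let $M$ and $M'$ be modules in the category $\mathcal O$ of $\widetilde U$-modules. Then the map $$\Theta\circ\widetilde f\circ P:\ M'\otimes M\to M\otimes M'$$ is an isomorphism of $\widetilde U$-modules.
   Context: Let $\epsilon_1,\dots,\epsilon_n$ be an orthonormal basis of $\mathbb R^n$ with inner product $\langle\,,\rangle$, $\alpha_j=\epsilon_j-\epsilon_{j+1}$ for $1\le j<n$, $\alpha_n=\epsilon_n$, $\Lambda=\bigoplus_{i=1}^n\mathbb Z\epsilon_i=\bigoplus_{i=1}^n\mathbb Z\alpha_i$, $Q^+=\sum_{i=1}^{n-1}\mathbb Z_{\ge0}\alpha_i$. $\widetilde U=U_{r,s}(\mathfrak{gl}_n)$ is the unital associative $\mathbb K$-algebra generated by $e_j,f_j$ ($1\le j<n$), $a_i^{\pm1},b_i^{\pm1}$ ($1\le i\le n$) with relations: (R1) the $a_i^{\pm1},b_j^{\pm1}$ all commute and $a_ia_i^{-1}=b_jb_j^{-1}=1$; (R2) $a_ie_j=r^{\langle\epsilon_i,\alpha_j\rangle}e_ja_i$, $a_if_j=r^{-\langle\epsilon_i,\alpha_j\rangle}f_ja_i$; (R3) $b_ie_j=s^{\langle\epsilon_i,\alpha_j\rangle}e_jb_i$, $b_if_j=s^{-\langle\epsilon_i,\alpha_j\rangle}f_jb_i$; (R4) $[e_i,f_j]=\frac{\delta_{i,j}}{r-s}(a_ib_{i+1}-a_{i+1}b_i)$;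 (R5) $[e_i,e_j]=[f_i,f_j]=0$ if $|i-j|>1$; (R6) $e_i^2e_{i+1}-(r+s)e_ie_{i+1}e_i+rs\,e_{i+1}e_i^2=0$, $e_ie_{i+1}^2-(r+s)e_{i+1}e_ie_{i+1}+rs\,e_{i+1}^2e_i=0$; (R7) $f_i^2f_{i+1}-(r^{-1}+s^{-1})f_if_{i+1}f_i+r^{-1}s^{-1}f_{i+1}f_i^2=0$, $f_if_{i+1}^2-(r^{-1}+s^{-1})f_{i+1}f_if_{i+1}+r^{-1}s^{-1}f_{i+1}^2f_i=0$. With $\omega_j=a_jb_{j+1}$, $\omega_j'=a_{j+1}b_j$, it is a Hopf algebra with $a_i^{\pm1},b_i^{\pm1}$ group-like, $\Delta(e_i)=e_i\otimes1+\omega_i\otimes e_i$, $\Delta(f_i)=1\otimes f_i+f_i\otimes\omega_i'$, $\varepsilon(e_i)=\varepsilon(f_i)=0$; tensor products of modules are formed via $\Delta$. Pairing: $\widetilde B$ is the Hopf subalgebra generated by all $e_j,\omega_j^{\pm1}$ and $a_n^{\pm1}$; $\widetilde B'$ is the subalgebra generated by all $f_j,(\omega_j')^{\pm1}$ and $b_n^{\pm1}$, with the coproduct opposite to that of $\widetilde U$. The bilinear form $(\,,)$ on $\widetilde B'\times\widetilde B$ is the Hopf pairing (i.e. $(1,h)=\varepsilon(h)$, $(h',1)=\varepsilon(h')$, $(h',hk)=\sum(h'_{(1)},h)(h'_{(2)},k)$, $(h'k',h)=\sum(h',h_{(1)})(k',h_{(2)})$, using these coproducts) determined by $(f_i,e_j)=\frac{\delta_{i,j}}{s-r}$,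 $(\omega_i',\omega_j)=r^{\langle\epsilon_j,\alpha_i\rangle}s^{\langle\epsilon_{j+1},\alpha_i\rangle}$, $(b_n,a_n)=1$, $(b_n,\omega_j)=s^{-\langle\epsilon_n,\alpha_j\rangle}$, $(\omega_i',a_n)=r^{\langle\epsilon_n,\alpha_i\rangle}$, inverses of group-like generators giving inverse values, and $0$ on all other pairs of generators. $U^+$ (resp. $U^-$) is the subalgebra generated by $1$ and the $e_i$ (resp. $f_i$), $1\le i<n$; for $\zeta\in Q^+$, $U^+_\zeta$ (resp. $U^-_{-\zeta}$) is the span of monomials $e_{i_1}\cdots e_{i_\ell}$ (resp. $f_{i_1}\cdots f_{i_\ell}$) with $\alpha_{i_1}+\cdots+\alpha_{i_\ell}=\zeta$. The spaces $U^+_\zeta$ and $U^-_{-\zeta}$ are nondegenerately paired by $(\,,)$. Let $\{u_k^\zeta\}$ be a basis of $U^+_\zeta$ and $\{v_k^\zeta\}$ the dual basis of $U^-_{-\zeta}$, $(v_k^\zeta,u_l^\zeta)=\delta_{k,l}$. Put $\Theta_\zeta=\sum_kv_k^\zeta\otimes u_k^\zeta$ and $\Theta=\sum_{\zeta\in Q^+}\Theta_\zeta$. Category $\mathcal O$: $\widetilde U$-modules $M$ such that $M=\bigoplus_{\lambda\in\mathrm{wt}(M)}M_\lambda$ with the set of weights $\mathrm{wt}(M)\subseteq\Lambda$, where $M_\lambda=\{m: a_i m=r^{\langle\epsilon_i,\lambda\rangle}m,\ b_i m=s^{\langle\epsilon_i,\lambda\rangle}m\ \forall i\}$; $\dim M_\lambda<\infty$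 for all $\lambda\in\mathrm{wt}(M)$; and $\mathrm{wt}(M)\subseteq\bigcup_{\mu\in F}(\mu-Q^+)$ for some finite $F\subset\Lambda$. Morphisms are $\widetilde U$-module maps. On $M\otimes M'$ with $M,M'\in\mathcal O$, the sum $\Theta$ acts as a well-defined linear map since only finitely many $\Theta_\zeta$ act nontrivially on a given vector. For $\lambda=\sum_{i=1}^n\lambda_i\alpha_i\in\Lambda$ put $\omega_\lambda=\omega_1^{\lambda_1}\cdots\omega_{n-1}^{\lambda_{n-1}}a_n^{\lambda_n}$, $\omega'_\lambda=(\omega_1')^{\lambda_1}\cdots(\omega_{n-1}')^{\lambda_{n-1}}b_n^{\lambda_n}$, and $f(\lambda,\mu)=(\omega'_\mu,\omega_\lambda)^{-1}$ for $\lambda,\mu\in\Lambda$. The map $\widetilde f:M\otimes M'\to M\otimes M'$ is $\widetilde f(m\otimes m')=f(\lambda,\mu)\,m\otimes m'$ for $m\in M_\lambda$, $m'\in M'_\mu$, and $P:M'\otimes M\to M\otimes M'$ is the flip $P(m'\otimes m)=m\otimes m'$. *)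

(* Defs.v *)
From HB Require Import structures.
From mathcomp Require Import all_boot all_order all_algebra.
From mathcomp Require Import zify ring.
From mathcomp Require Import boolp classical_sets functions cardinality fsbigop.

Set Implicit Arguments.
Unset Strict Implicit.
Unset Printing Implicit Defensive.

Import GRing.Theory.
Local Open Scope ring_scope.
Local Open Scope quotient_scope.
Local Open Scope classical_set_scope.

Section Tensor.
Variables (K : fieldType) (V W : lmodType K).

(* A sequence of pairs [:: (v1, w1); ...; (vk, wk)] stands for
   v1 (x) w1 + ... + vk (x) wk. *)
Inductive tcong : seq (V * W) -> seq (V * W) -> Prop :=
| tcong_refl s : tcong s s
| tcong_sym s t : tcong s t -> tcong t s
| tcong_trans s t u : tcong s t -> tcong t u -> tcong s u
| tcong_cat s s' t t' : tcong s s' -> tcong t t' -> tcong (s ++ t) (s' ++ t')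
| tcong_comm s t : tcong (s ++ t) (t ++ s)
| tcong_addl v v' w : tcong [:: (v + v', w)] [:: (v, w); (v', w)]
| tcong_addr v w w' : tcong [:: (v, w + w')] [:: (v, w); (v, w')]
| tcong_scale c v w : tcong [:: (c *: v, w)] [:: (v, c *: w)]
| tcong_0 w : tcong [:: (0, w)] [::].

Definition tcongb s t : bool := `[< tcong s t >].

Lemma tcongb_refl : reflexive tcongb.
Proof. by move=> s; apply/asboolP; exact: tcong_refl. Qed.

Lemma tcongb_sym : symmetric tcongb.
Proof. by move=> s t; apply/asboolP/asboolP; exact: tcong_sym. Qed.

Lemma tcongb_trans : transitive tcongb.
Proof.
by move=> t s u /asboolP st /asboolP tu; apply/asboolP; exact: tcong_trans tu.
Qed.

Canonical tcong_equiv := EquivRel tcongb tcongb_refl tcongb_sym tcongb_trans.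

Definition tensor := {eq_quot tcong_equiv}.

HB.instance Definition _ : EqQuotient _ tcong_equiv tensor := EqQuotient.on tensor.
HB.instance Definition _ := Choice.on tensor.

Lemma tpiP s t : tcong s t <-> \pi_tensor s = \pi_tensor t.
Proof.
split=> [st|/eqquotP /= /asboolP //].
by apply/eqquotP => /=; apply/asboolP.
Qed.

Definition tadd (x y : tensor) : tensor := \pi_tensor (repr x ++ repr y).
Definition tscale (c : K) (x : tensor) : tensor :=
  \pi_tensor [seq (c *: p.1, p.2) | p <- repr x].

Lemma tadd_pi s t : tadd (\pi_tensor s) (\pi_tensor t) = \pi_tensor (s ++ t).
Proof. by apply/tpiP/tcong_cat; apply/tpiP; rewrite reprK. Qed.

Lemma tcong_map c s t : tcong s t ->
  tcong [seq (c *: p.1, p.2) | p <- s] [seq (c *: p.1, p.2) | p <- t].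
Proof.
elim=> {s t} /=.
- by move=> s; exact: tcong_refl.
- by move=> s t _; exact: tcong_sym.
- by move=> s t u _ + _; exact: tcong_trans.
- by move=> s s' t t' _ st _ tt'; rewrite !map_cat; exact: tcong_cat.
- by move=> s t; rewrite !map_cat; exact: tcong_comm.
- by move=> v v' w; rewrite scalerDr; exact: tcong_addl.
- by move=> v w w'; exact: tcong_addr.
- by move=> d v w; rewrite scalerA mulrC -scalerA; exact: tcong_scale.
- by move=> w; rewrite scaler0; exact: tcong_0.
Qed.

Lemma tscale_pi c s : tscale c (\pi_tensor s) = \pi_tensor [seq (c *: p.1, p.2) | p <- s].
Proof. by apply/tpiP/tcong_map; apply/tpiP; rewrite reprK. Qed.

Lemma tensorW (P : tensor -> Prop) : (forall s, P (\pi_tensor s)) -> forall x, P x.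
Proof. by move=> Ps x; rewrite -[x]reprK. Qed.

Lemma taddA : associative tadd.
Proof.
by elim/tensorW=> s; elim/tensorW=> t; elim/tensorW=> u; rewrite !tadd_pi catA.
Qed.

Lemma taddC : commutative tadd.
Proof.
by elim/tensorW=> s; elim/tensorW=> t; rewrite !tadd_pi; apply/tpiP/tcong_comm.
Qed.

Lemma tadd0 : left_id (\pi_tensor [::]) tadd.
Proof. by elim/tensorW=> s; rewrite tadd_pi. Qed.

Lemma taddN : left_inverse (\pi_tensor [::]) (tscale (-1)) tadd.
Proof.
elim/tensorW=> s; rewrite tscale_pi tadd_pi; apply/tpiP.
elim: s => [|[v w] s IHs] /=; first exact: tcong_refl.
set m := map _ _ in IHs *.
have cons_cat (x y : V * W) : tcong (x :: m ++ y :: s) ([:: x; y] ++ (m ++ s)).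
  rewrite -[x :: _]cat1s -[[:: x; y]]/([:: x] ++ [:: y]) -catA.
  apply: tcong_cat; first exact: tcong_refl.
  rewrite -[y :: s]cat1s !catA; apply: tcong_cat; last exact: tcong_refl.
  exact: tcong_comm.
apply: tcong_trans (cons_cat _ _) _; rewrite -[[::]]/([::] ++ [::]).
apply: tcong_cat IHs; apply: tcong_trans (tcong_0 w).
by rewrite -[X in tcong _ [:: (X, _)]](addNr v) -scaleN1r;
  apply/tcong_sym/tcong_addl.
Qed.

HB.instance Definition _ := GRing.isZmodule.Build tensor taddA taddC tadd0 taddN.

Lemma tpiD s t : \pi_tensor s + \pi_tensor t = \pi_tensor (s ++ t).
Proof. exact: tadd_pi. Qed.

Lemma tscaleA c d x : tscale c (tscale d x) = tscale (c * d) x.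
Proof.
elim/tensorW: x => s; rewrite !tscale_pi -map_comp; congr (\pi_tensor _).
by apply: eq_map => p /=; rewrite scalerA.
Qed.

Lemma tscale1 : left_id 1 tscale.
Proof.
elim/tensorW=> s; rewrite tscale_pi; congr (\pi_tensor _).
by rewrite -[RHS]map_id; apply: eq_map => -[v w] /=; rewrite scale1r.
Qed.

Lemma tscaleDr : right_distributive tscale +%R.
Proof.
move=> c; elim/tensorW=> s; elim/tensorW=> t.
by rewrite !(tpiD, tscale_pi) map_cat.
Qed.

Lemma tscaleDl x : {morph tscale^~ x : c d / c + d}.
Proof.
elim/tensorW: x => s c d; rewrite !tscale_pi.
elim: s => [|[v w] s IHs]; first by rewrite tpiD.
rewrite /= -[(_, w) :: map _ _]cat1s -tpiD IHs scalerDl.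
have -> : \pi_tensor [:: (c *: v + d *: v, w)]
    = \pi_tensor [:: (c *: v, w)] + \pi_tensor [:: (d *: v, w)].
  by rewrite tpiD; apply/tpiP/tcong_addl.
rewrite -[(_, w) :: [seq (c *: _, _) | _ <- _]]cat1s.
rewrite -[(_, w) :: [seq (d *: _, _) | _ <- _]]cat1s.
by rewrite -![in RHS]tpiD; exact: addrACA.
Qed.

HB.instance Definition _ :=
  GRing.Zmodule_isLmodule.Build K tensor tscaleA tscale1 tscaleDr tscaleDl.

Lemma tpiZ c s :
  c *: \pi_tensor s = \pi_tensor [seq (c *: p.1, p.2) | p <- s].
Proof. exact: tscale_pi. Qed.

Definition tpure (v : V) (w : W) : tensor := \pi_tensor [:: (v, w)].

Lemma tpi_sum s : \pi_tensor s = \sum_(p <- s) tpure p.1 p.2.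
Proof.
elim: s => [|[v w] s IHs]; first by rewrite big_nil.
by rewrite big_cons -IHs tpiD.
Qed.

Lemma tensorE (x : tensor) : exists s : seq (V * W), x = \sum_(p <- s) tpure p.1 p.2.
Proof. by exists (repr x); rewrite -tpi_sum reprK. Qed.

Lemma tpureDl v v' w : tpure (v + v') w = tpure v w + tpure v' w.
Proof. by rewrite tpiD; apply/tpiP/tcong_addl. Qed.

Lemma tpureDr v w w' : tpure v (w + w') = tpure v w + tpure v w'.
Proof. by rewrite tpiD; apply/tpiP/tcong_addr. Qed.

Lemma tpureZl c v w : tpure (c *: v) w = c *: tpure v w.
Proof. by rewrite tpiZ. Qed.

Lemma tpureZr c v w : tpure v (c *: w) = c *: tpure v w.
Proof. by rewrite -tpureZl; apply/tpiP/tcong_sym/tcong_scale. Qed.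

Section Lift.
Variable X : lmodType K.

Record bilin (f : V -> W -> X) : Prop := Bilin {
  bilinl : forall w, linear (f^~ w);
  bilinr : forall v, linear (f v)
}.

(* Meaningful for bilinear f only. *)
Definition tlift (f : V -> W -> X) (x : tensor) : X :=
  \sum_(p <- repr x) f p.1 p.2.

Lemma bilinDl f : bilin f -> forall v v' w, f (v + v') w = f v w + f v' w.
Proof. by move=> [fl _] v v' w; rewrite -{1}[v]scale1r fl scale1r. Qed.

Lemma bilinDr f : bilin f -> forall v w w', f v (w + w') = f v w + f v w'.
Proof. by move=> [_ fr] v w w'; rewrite -{1}[w]scale1r fr scale1r. Qed.

Lemma bilin0l f : bilin f -> forall w, f 0 w = 0.
Proof. by move=> bf w; apply: (addrI (f 0 w)); rewrite -bilinDl // !addr0. Qed.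

Lemma bilin0r f : bilin f -> forall v, f v 0 = 0.
Proof. by move=> bf v; apply: (addrI (f v 0)); rewrite -bilinDr // !addr0. Qed.

Lemma bilinZl f : bilin f -> forall c v w, f (c *: v) w = c *: f v w.
Proof.
by move=> bf c v w; rewrite -{1}[c *: v]addr0 (bilinl bf) bilin0l // addr0.
Qed.

Lemma bilinZr f : bilin f -> forall c v w, f v (c *: w) = c *: f v w.
Proof.
by move=> bf c v w; rewrite -{1}[c *: w]addr0 (bilinr bf) bilin0r // addr0.
Qed.

Lemma tlift_pi f : bilin f -> forall s, tlift f (\pi_tensor s) = \sum_(p <- s) f p.1 p.2.
Proof.
move=> bf s; rewrite /tlift.
suff fE t u : tcong t u -> \sum_(p <- t) f p.1 p.2 = \sum_(p <- u) f p.1 p.2.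
  by apply: fE; apply/tpiP; rewrite reprK.
elim=> //= {t u}.
- by move=> t u v _ -> _ ->.
- by move=> t t' u u' _ tt' _ uu'; rewrite !big_cat /= tt' uu'.
- by move=> t u; rewrite !big_cat /= addrC.
- by move=> v v' w; rewrite !big_cons !big_nil /= !addr0 bilinDl.
- by move=> v w w'; rewrite !big_cons !big_nil /= !addr0 bilinDr.
- by move=> c v w; rewrite !big_cons !big_nil /= bilinZl // bilinZr.
- by move=> w; rewrite !big_cons !big_nil /= bilin0l // addr0.
Qed.

Lemma tlift_pure f : bilin f -> forall v w, tlift f (tpure v w) = f v w.
Proof. by move=> bf v w; rewrite tlift_pi // big_cons big_nil addr0. Qed.

Lemma tlift_linear f : bilin f -> linear (tlift f).
Proof.
move=> bf c; elim/tensorW=> s; elim/tensorW=> t.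
rewrite tpiZ tpiD !tlift_pi // big_cat big_map /=.
rewrite scaler_sumr; congr (_ + _); apply: eq_bigr => p _.
by rewrite bilinZl.
Qed.

End Lift.
End Tensor.

Notation "v ⊗ w" := (tpure v w) (at level 40, left associativity) : ring_scope.

Lemma tensor_ind (K : fieldType) (V W : lmodType K) (P : tensor V W -> Prop) :
    P 0 -> (forall x y, P x -> P y -> P (x + y)) -> (forall v w, P (v ⊗ w)) ->
  forall x, P x.
Proof.
move=> P0 PD Pp x; have [s ->] := tensorE x.
by apply: (big_ind P) => // p _; exact: Pp.
Qed.

(* (v ⊗ w) (v' ⊗ w') |-> b v v' ⊗ g w w', for bilinear b and g. *)
Section Tmap2.
Variables (K : fieldType) (V1 V2 V3 W1 W2 W3 : lmodType K).
Variables (b : V1 -> V2 -> V3) (g : W1 -> W2 -> W3).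

Definition tmap2 (x : tensor V1 W1) (y : tensor V2 W2) : tensor V3 W3 :=
  tlift (fun v w => tlift (fun v' w' => b v v' ⊗ g w w') y) x.

Hypotheses (bb : bilin b) (bg : bilin g).

Let inner v w : bilin (fun v' w' => b v v' ⊗ g w w').
Proof.
split=> [w' c v1 v2|v' c w1 w2].
  by rewrite (bilinr bb) tpureDl tpureZl.
by rewrite (bilinr bg) tpureDr tpureZr.
Qed.

Let outer (y : tensor V2 W2) :
  bilin (fun v w => tlift (fun v' w' => b v v' ⊗ g w w') y).
Proof.
split=> [w c v1 v2|v c w1 w2]; elim/tensorW: y => s;
  rewrite !tlift_pi // scaler_sumr -big_split; apply: eq_bigr => p _ /=.
  by rewrite (bilinl bb) tpureDl tpureZl.
by rewrite (bilinl bg) tpureDr tpureZr.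
Qed.

Lemma tmap2_pure v w v' w' : tmap2 (v ⊗ w) (v' ⊗ w') = b v v' ⊗ g w w'.
Proof. by rewrite /tmap2 !tlift_pure. Qed.

Lemma tmap2_bilin : bilin tmap2.
Proof.
split=> [y|x]; first by apply: tlift_linear; exact: outer.
elim/tensorW: x => s c y y'; rewrite /tmap2 !tlift_pi // scaler_sumr -big_split.
by apply: eq_bigr => p _ /=; rewrite tlift_linear.
Qed.

End Tmap2.

Section Presented.
Variables (K : fieldType) (X : Type).

Inductive aterm :=
| Agen of X
| Ascal of K
| Aadd of aterm & aterm
| Amul of aterm & aterm.

HB.instance Definition _ := gen_eqMixin aterm.
HB.instance Definition _ := gen_choiceMixin aterm.

Variable R : aterm -> aterm -> Prop.

(* The least congruence containing R whose quotient is a K-algebra. *)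
Inductive acong : aterm -> aterm -> Prop :=
| acong_rel x y : R x y -> acong x y
| acong_refl x : acong x x
| acong_sym x y : acong x y -> acong y x
| acong_trans x y z : acong x y -> acong y z -> acong x z
| acong_add x x' y y' :
    acong x x' -> acong y y' -> acong (Aadd x y) (Aadd x' y')
| acong_mul x x' y y' :
    acong x x' -> acong y y' -> acong (Amul x y) (Amul x' y')
| acong_addA x y z : acong (Aadd x (Aadd y z)) (Aadd (Aadd x y) z)
| acong_addC x y : acong (Aadd x y) (Aadd y x)
| acong_add0 x : acong (Aadd (Ascal 0) x) x
| acong_addN x : acong (Aadd (Amul (Ascal (-1)) x) x) (Ascal 0)
| acong_mulA x y z : acong (Amul x (Amul y z)) (Amul (Amul x y) z)
| acong_mul1 x : acong (Amul (Ascal 1) x) x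
| acong_mulDl x y z : acong (Amul (Aadd x y) z) (Aadd (Amul x z) (Amul y z))
| acong_mulDr x y z : acong (Amul x (Aadd y z)) (Aadd (Amul x y) (Amul x z))
| acong_scalD c d : acong (Ascal (c + d)) (Aadd (Ascal c) (Ascal d))
| acong_scalM c d : acong (Ascal (c * d)) (Amul (Ascal c) (Ascal d))
| acong_scalC c x : acong (Amul (Ascal c) x) (Amul x (Ascal c)).

Definition acongb x y : bool := `[< acong x y >].

Lemma acongb_refl : reflexive acongb.
Proof. by move=> x; apply/asboolP; exact: acong_refl. Qed.

Lemma acongb_sym : symmetric acongb.
Proof. by move=> x y; apply/asboolP/asboolP; exact: acong_sym. Qed.

Lemma acongb_trans : transitive acongb.
Proof.
by move=> y x z /asboolP xy /asboolP yz; apply/asboolP; exact: acong_trans yz.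
Qed.

Canonical acong_equiv := EquivRel acongb acongb_refl acongb_sym acongb_trans.

Definition presented := {eq_quot acong_equiv}.

HB.instance Definition _ : EqQuotient _ acong_equiv presented :=
  EqQuotient.on presented.
HB.instance Definition _ := Choice.on presented.

Lemma apiP x y : acong x y <-> \pi_presented x = \pi_presented y.
Proof.
split=> [xy|/eqquotP /= /asboolP //].
by apply/eqquotP => /=; apply/asboolP.
Qed.

Definition padd (x y : presented) : presented :=
  \pi_presented (Aadd (repr x) (repr y)).
Definition pmul (x y : presented) : presented :=
  \pi_presented (Amul (repr x) (repr y)).
Definition pscal (c : K) : presented := \pi_presented (Ascal c).

Lemma padd_pi x y :
  padd (\pi_presented x) (\pi_presented y) = \pi_presented (Aadd x y).
Proof. by apply/apiP/acong_add; apply/apiP; rewrite reprK. Qed.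

Lemma pmul_pi x y :
  pmul (\pi_presented x) (\pi_presented y) = \pi_presented (Amul x y).
Proof. by apply/apiP/acong_mul; apply/apiP; rewrite reprK. Qed.

Lemma presentedW (P : presented -> Prop) :
  (forall x, P (\pi_presented x)) -> forall x, P x.
Proof. by move=> Ps x; rewrite -[x]reprK. Qed.

Lemma paddA : associative padd.
Proof.
elim/presentedW=> x; elim/presentedW=> y; elim/presentedW=> z.
by rewrite !padd_pi; apply/apiP/acong_addA.
Qed.

Lemma paddC : commutative padd.
Proof.
elim/presentedW=> x; elim/presentedW=> y.
by rewrite !padd_pi; apply/apiP/acong_addC.
Qed.

Lemma padd0 : left_id (pscal 0) padd.
Proof. by elim/presentedW=> x; rewrite padd_pi; apply/apiP/acong_add0. Qed.

Lemma paddN : left_inverse (pscal 0) (pmul (pscal (-1))) padd.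
Proof.
by elim/presentedW=> x; rewrite pmul_pi padd_pi; apply/apiP/acong_addN.
Qed.

HB.instance Definition _ :=
  GRing.isZmodule.Build presented paddA paddC padd0 paddN.

Lemma piD x y : \pi_presented x + \pi_presented y = \pi_presented (Aadd x y).
Proof. exact: padd_pi. Qed.

Lemma pmulA : associative pmul.
Proof.
elim/presentedW=> x; elim/presentedW=> y; elim/presentedW=> z.
by rewrite !pmul_pi; apply/apiP/acong_mulA.
Qed.

Lemma pmul1 : left_id (pscal 1) pmul.
Proof. by elim/presentedW=> x; rewrite pmul_pi; apply/apiP/acong_mul1. Qed.

Lemma pmulr1 : right_id (pscal 1) pmul.
Proof.
elim/presentedW=> x; rewrite pmul_pi; apply/apiP.
by apply: acong_trans (acong_mul1 x); apply/acong_sym/acong_scalC.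
Qed.

Lemma pmulDl : left_distributive pmul +%R.
Proof.
elim/presentedW=> x; elim/presentedW=> y; elim/presentedW=> z.
by rewrite piD !pmul_pi piD; apply/apiP/acong_mulDl.
Qed.

Lemma pmulDr : right_distributive pmul +%R.
Proof.
elim/presentedW=> x; elim/presentedW=> y; elim/presentedW=> z.
by rewrite piD !pmul_pi piD; apply/apiP/acong_mulDr.
Qed.

HB.instance Definition _ :=
  GRing.Zmodule_isPzRing.Build presented pmulA pmul1 pmulr1 pmulDl pmulDr.

Lemma piM x y : \pi_presented x * \pi_presented y = \pi_presented (Amul x y).
Proof. exact: pmul_pi. Qed.

Definition pscale c (x : presented) : presented := pscal c * x.

Lemma pscaleA c d x : pscale c (pscale d x) = pscale (c * d) x.
Proof.
rewrite /pscale mulrA; congr (_ * _).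
by rewrite piM; apply/apiP/acong_sym/acong_scalM.
Qed.

Lemma pscale1 : left_id 1 pscale.
Proof. exact: mul1r. Qed.

Lemma pscaleDr : right_distributive pscale +%R.
Proof. by move=> c x y; exact: mulrDr. Qed.

Lemma pscaleDl x : {morph pscale^~ x : c d / c + d}.
Proof.
move=> c d; rewrite /pscale -mulrDl; congr (_ * _).
by rewrite piD; apply/apiP/acong_scalD.
Qed.

HB.instance Definition _ := GRing.Zmodule_isLmodule.Build K presented
  pscaleA pscale1 pscaleDr pscaleDl.

Lemma pscaleE c (x : presented) : c *: x = pscal c * x.
Proof. by []. Qed.

Lemma pscalC c (x : presented) : pscal c * x = x * pscal c.
Proof. by elim/presentedW: x => x; rewrite !piM; apply/apiP/acong_scalC. Qed.

Lemma pscalAl c (x y : presented) : c *: (x * y) = (c *: x) * y.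
Proof. by rewrite !pscaleE mulrA. Qed.

Lemma pscalAr c (x y : presented) : c *: (x * y) = x * (c *: y).
Proof. by rewrite !pscaleE mulrA pscalC mulrA. Qed.

Definition pgen (x : X) : presented := \pi_presented (Agen x).

Fixpoint aeval (A : algType K) (h : X -> A) (t : aterm) : A :=
  match t with
  | Agen x => h x
  | Ascal c => c%:A
  | Aadd t u => aeval h t + aeval h u
  | Amul t u => aeval h t * aeval h u
  end.

(* A morphism of algebras only when h respects R; see Eval below. *)
Definition peval (A : algType K) (h : X -> A) (x : presented) : A :=
  aeval h (repr x).

Section Eval.
Variables (A : algType K) (h : X -> A).
Hypothesis hR : forall x y, R x y -> aeval h x = aeval h y.

Lemma aeval_cong x y : acong x y -> aeval h x = aeval h y.
Proof.
elim=> //= {x y}.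
- by move=> x y z _ -> _ ->.
- by move=> x x' y y' _ -> _ ->.
- by move=> x x' y y' _ -> _ ->.
- by move=> x y z; rewrite addrA.
- by move=> x y; rewrite addrC.
- by move=> x; rewrite scale0r add0r.
- by move=> x; rewrite scaleN1r mulN1r addNr scale0r.
- by move=> x y z; rewrite mulrA.
- by move=> x; rewrite scale1r mul1r.
- by move=> x y z; rewrite mulrDl.
- by move=> x y z; rewrite mulrDr.
- by move=> c d; rewrite scalerDl.
- by move=> c d; rewrite mulr_algl scalerA.
- by move=> c x; rewrite mulr_algl mulr_algr.
Qed.

Lemma peval_pi t : peval h (\pi_presented t) = aeval h t.
Proof. by apply: aeval_cong; apply/apiP; rewrite reprK. Qed.

Lemma peval_gen x : peval h (pgen x) = h x.
Proof. exact: peval_pi. Qed.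

Lemma pevalD : {morph peval h : x y / x + y}.
Proof.
by elim/presentedW=> x; elim/presentedW=> y; rewrite piD !peval_pi.
Qed.

Lemma pevalM : {morph peval h : x y / x * y}.
Proof.
by elim/presentedW=> x; elim/presentedW=> y; rewrite piM !peval_pi.
Qed.

Lemma peval1 : peval h 1 = 1.
Proof. by rewrite [LHS]peval_pi /= scale1r. Qed.

Lemma pevalZ c x : peval h (c *: x) = c *: peval h x.
Proof. by rewrite pscaleE pevalM peval_pi /= mulr_algl. Qed.

End Eval.

Lemma presented_ind (P : presented -> Prop) :
    (forall x, P (pgen x)) -> (forall c, P (pscal c)) ->
    (forall x y, P x -> P y -> P (x + y)) ->
    (forall x y, P x -> P y -> P (x * y)) ->
  forall x, P x.
Proof.
move=> Pg Ps PD PM; elim/presentedW; elim=> [x|c|x Px y Py|x Px y Py].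
- exact: Pg.
- exact: Ps.
- by rewrite -piD; exact: PD.
- by rewrite -piM; exact: PM.
Qed.

End Presented.

Section AlgebraTensor.
Variables (K : fieldType) (A B : algType K).

Lemma mul_bilin (C : algType K) : bilin (@GRing.mul C).
Proof.
by split=> x c y z /=; [rewrite mulrDl scalerAl|rewrite mulrDr scalerAr].
Qed.

Definition tmul : tensor A B -> tensor A B -> tensor A B := tmap2 *%R *%R.

Lemma tmul_bilin : bilin tmul.
Proof. by apply: tmap2_bilin; exact: mul_bilin. Qed.

Lemma tmul_pure x y x' y' : tmul (x ⊗ y) (x' ⊗ y') = (x * x') ⊗ (y * y').
Proof. by apply: tmap2_pure; exact: mul_bilin. Qed.

Let tD := (bilinDl tmul_bilin, bilinDr tmul_bilin,
           bilin0l tmul_bilin, bilin0r tmul_bilin).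

Lemma tmulA : associative tmul.
Proof.
elim/tensor_ind=> [y z|x x' IH IH' y z|x x' ]; [by rewrite !tD|by rewrite !tD IH IH'|].
elim/tensor_ind=> [z|y y' IH IH' z|y y']; [by rewrite !tD|by rewrite !tD IH IH'|].
elim/tensor_ind=> [|z z' IH IH'|z z']; [by rewrite !tD|by rewrite !tD IH IH'|].
by rewrite !tmul_pure !mulrA.
Qed.

Lemma tmul1 : left_id (1 ⊗ 1) tmul.
Proof.
elim/tensor_ind=> [|x y IH IH'|x y]; [by rewrite !tD|by rewrite !tD IH IH'|].
by rewrite tmul_pure !mul1r.
Qed.

Lemma tmulr1 : right_id (1 ⊗ 1) tmul.
Proof.
elim/tensor_ind=> [|x y IH IH'|x y]; [by rewrite !tD|by rewrite !tD IH IH'|].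
by rewrite tmul_pure !mulr1.
Qed.

Lemma tmulDl : left_distributive tmul +%R.
Proof. by move=> x y z; rewrite tD. Qed.

Lemma tmulDr : right_distributive tmul +%R.
Proof. by move=> x y z; rewrite tD. Qed.

HB.instance Definition _ := GRing.Zmodule_isPzRing.Build (tensor A B)
  tmulA tmul1 tmulr1 tmulDl tmulDr.

Lemma tpureM x y x' y' :
  (x ⊗ y : tensor A B) * (x' ⊗ y') = (x * x') ⊗ (y * y').
Proof. exact: tmul_pure. Qed.

Lemma tscalAl c (x y : tensor A B) : c *: (x * y) = (c *: x) * y.
Proof. by rewrite [RHS](bilinZl tmul_bilin). Qed.

Lemma tscalAr c (x y : tensor A B) : c *: (x * y) = x * (c *: y).
Proof. by rewrite [RHS](bilinZr tmul_bilin). Qed.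

End AlgebraTensor.

Section Weights.
Variable l : nat.

(* The lattice Lambda of gl_(l+1), in the basis eps. *)
Definition Lam : Type := 'rV[int]_l.+1.
HB.instance Definition _ := GRing.Zmodule.on Lam.

Definition dot (x y : Lam) : int := \sum_i x 0 i * y 0 i.

Definition eps (i : 'I_l.+1) : Lam := delta_mx 0 i.

(* With 0-based indices, j : 'I_l is the simple root alpha_(j+1), and lo j, hi j
   are the positions of eps_(j+1), eps_(j+2). *)
Definition lo (j : 'I_l) : 'I_l.+1 := widen_ord (leqnSn l) j.
Definition hi (j : 'I_l) : 'I_l.+1 := lift ord0 j.

Definition alpha (j : 'I_l) : Lam := eps (lo j) - eps (hi j).
Definition alpha_last : Lam := eps ord_max.

Definition Qplus : set Lam :=
  [set x | exists c : 'I_l -> nat, x = \sum_j alpha j *+ c j].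

(* The coefficients of x in the basis alpha_1, ..., alpha_n: see acoordE. *)
Definition acoord (x : Lam) (i : 'I_l.+1) : int :=
  \sum_(k < l.+1 | (k <= i)%N) x 0 k.

Lemma acoordE (x : Lam) :
  x = \sum_(j < l) alpha j *~ acoord x (lo j)
      + alpha_last *~ acoord x ord_max.
Proof.
have acS (j : 'I_l) : acoord x (hi j) = acoord x (lo j) + x 0 (hi j).
  rewrite /acoord (bigD1 (hi j)) //= addrC; congr (_ + _).
  apply: eq_bigl => k; rewrite -val_eqE /= /bump /= add1n.
  by rewrite andbC -ltn_neqAle ltnS.
transitivity (\sum_(i < l.+1) eps i *~ x 0 i).
  rewrite {1}[x]row_sum_delta; apply: eq_bigr => i _.
  by rewrite -{1}[x 0 i]intz scaler_int.
have -> : \sum_(j < l) alpha j *~ acoord x (lo j)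
   = \sum_(j < l) eps (lo j) *~ acoord x (lo j) - \sum_(j < l) eps (hi j) *~ acoord x (lo j).
  by rewrite -sumrB; apply: eq_bigr => j _; rewrite mulrzBl.
rewrite addrAC -[X in X - _]/(_ + eps ord_max *~ _).
have -> : \sum_(j < l) eps (lo j) *~ acoord x (lo j) + eps ord_max *~ acoord x ord_max
  = \sum_(i < l.+1) eps i *~ acoord x i by rewrite big_ord_recr.
rewrite !big_ord_recl -addrA -sumrB; congr (_ + _).
  congr (_ *~ _); rewrite /acoord (bigD1 ord0) //= big1 ?addr0 // => k.
  by rewrite -val_eqE /= leqn0 => /andP[/eqP ->].
apply: eq_bigr => j _.
by rewrite -/(hi j) -mulrzBr acS addrC addKr.
Qed.

Lemma dot_eps (i j : 'I_l.+1) : dot (eps i) (eps j) = (i == j)%:R.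
Proof.
rewrite /dot (bigD1 i) //= big1 ?addr0 => [|k /negPf ki].
  by rewrite !mxE !eqxx mul1r /= .
by rewrite !mxE ki andbF mul0r.
Qed.

Lemma dotBr x y z : dot x (y - z) = dot x y - dot x z.
Proof.
by rewrite /dot -sumrB; apply: eq_bigr => i _; rewrite !mxE mulrBr.
Qed.

Lemma dot_alpha i j : dot (eps i) (alpha j) = (i == lo j)%:R - (i == hi j)%:R.
Proof. by rewrite dotBr !dot_eps. Qed.

End Weights.

Record qparam (K : fieldType) := QParam {
  qr : K;
  qs : K;
  qr_neq0 : qr != 0;
  qs_neq0 : qs != 0;
  qr_neq_qs : qr != qs
}.

Inductive glgen (l : nat) :=
| GE of 'I_l
| GF of 'I_l
| GA of 'I_l.+1
| GAV of 'I_l.+1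
| GB of 'I_l.+1
| GBV of 'I_l.+1.

Definition is_torus l (x : glgen l) : bool :=
  match x with GE _ | GF _ => false | _ => true end.

Declare Scope aterm_scope.
Delimit Scope aterm_scope with A.
Bind Scope aterm_scope with aterm.

Section Relations.
Variables (K : fieldType) (l : nat) (q : qparam K).
Local Notation r := (qr q).
Local Notation s := (qs q).

Local Notation term := (aterm K (glgen l)).
Local Notation "x + y" := (Aadd x y) : aterm_scope.
Local Notation "x * y" := (Amul x y) : aterm_scope.
Local Notation "c *: x" := (Amul (Ascal _ c%R) x) : aterm_scope.
Local Notation "x - y" := (Aadd x (Amul (Ascal _ (-1)%R) y)) : aterm_scope.
Local Notation "0" := (Ascal _ 0%R) : aterm_scope.
Local Notation "1" := (Ascal _ 1%R) : aterm_scope.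
Local Notation G x := (@Agen K (glgen l) x).
Local Notation e j := (G (GE j)).
Local Notation f j := (G (GF j)).
Local Notation a i := (G (GA i)).
Local Notation b i := (G (GB i)).

Inductive glrel : term -> term -> Prop :=
| R1_comm x y : is_torus x -> is_torus y -> glrel (G x * G y) (G y * G x)
| R1_a i : glrel (a i * G (GAV i)) 1
| R1_b i : glrel (b i * G (GBV i)) 1
| R2_e i j : glrel (a i * e j) (r ^ dot (eps i) (alpha j) *: (e j * a i))
| R2_f i j : glrel (a i * f j) (r ^ (- dot (eps i) (alpha j)) *: (f j * a i))
| R3_e i j : glrel (b i * e j) (s ^ dot (eps i) (alpha j) *: (e j * b i))
| R3_f i j : glrel (b i * f j) (s ^ (- dot (eps i) (alpha j)) *: (f j * b i))
| R4 i j : glrel (e i * f j - f j * e i)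
    (((i == j)%:R / (r - s)) *: (a (lo i) * b (hi i) - a (hi i) * b (lo i)))
| R5_e (i j : 'I_l) : ((i.+1 < j) || (j.+1 < i))%N ->
    glrel (e i * e j - e j * e i) 0
| R5_f (i j : 'I_l) : ((i.+1 < j) || (j.+1 < i))%N ->
    glrel (f i * f j - f j * f i) 0
| R6_l (i j : 'I_l) : j = i.+1 :> nat ->
    glrel (e i * e i * e j - (r + s) *: (e i * e j * e i)
           + (r * s) *: (e j * e i * e i)) 0
| R6_r (i j : 'I_l) : j = i.+1 :> nat ->
    glrel (e i * e j * e j - (r + s) *: (e j * e i * e j)
           + (r * s) *: (e j * e j * e i)) 0
| R7_l (i j : 'I_l) : j = i.+1 :> nat ->
    glrel (f i * f i * f j - (r^-1 + s^-1) *: (f i * f j * f i)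
           + (r^-1 * s^-1) *: (f j * f i * f i)) 0
| R7_r (i j : 'I_l) : j = i.+1 :> nat ->
    glrel (f i * f j * f j - (r^-1 + s^-1) *: (f j * f i * f j)
           + (r^-1 * s^-1) *: (f j * f j * f i)) 0.

(* U_{r,s}(gl_n) with n = l + 1 and q = (r, s). *)
Definition Ugl := presented glrel.
HB.instance Definition _ := GRing.PzRing.on Ugl.
HB.instance Definition _ := GRing.Lmodule.on Ugl.

End Relations.

Section Counit.
Variables (K : fieldType) (l : nat) (q : qparam K).

Definition counit_gen (x : glgen l) : K^o := (is_torus x)%:R.

Definition counit : Ugl l q -> K := peval counit_gen.

Lemma counit_rel x y : glrel q x y -> aeval counit_gen x = aeval counit_gen y.
Proof.
have sc c : c%:A = c :> K^o by rewrite -[LHS]/(c * 1) mulr1.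
case=> {x y} [x y tx ty|i|i|i j|i j|i j|i j|i j|i j ij|i j ij|i j ij|i j ij|i j ij|i j ij];
  rewrite /= /counit_gen /= ?sc ?(mulr0, mul0r, mulr1, mul1r, addr0) ?tx ?ty //.
by rewrite subrr mulr0.
Qed.

Lemma Ugl_neq0 : (1 : Ugl l q) != 0.
Proof.
apply/eqP => /(congr1 counit).
rewrite /counit (peval1 counit_rel) => /eqP.
suff -> : peval counit_gen (0 : Ugl l q) = 0 :> K^o by rewrite oner_eq0.
by rewrite -[0 in LHS](scale0r 0) (pevalZ counit_rel) scale0r.
Qed.

End Counit.

HB.instance Definition _ (K : fieldType) (l : nat) (q : qparam K) :=
  GRing.PzSemiRing_isNonZero.Build (Ugl l q) (Ugl_neq0 l q).
HB.instance Definition _ (K : fieldType) (l : nat) (q : qparam K) :=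
  GRing.LSemiModule_isLSemiAlgebra.Build K (Ugl l q) (@pscalAl _ _ _).
HB.instance Definition _ (K : fieldType) (l : nat) (q : qparam K) :=
  GRing.LSemiAlgebra_isSemiAlgebra.Build K (Ugl l q) (@pscalAr _ _ _).

Section Serre.
Variables (K : fieldType) (A : algType K) (R S : K).
Hypotheses (R0 : R != 0) (S0 : S != 0).

Let comb (u v w : A) : A := u - (R + S) *: v + (R * S) *: w.

Let combD u v w u' v' w' :
  comb (u + u') (v + v') (w + w') = comb u v w + comb u' v' w'.
Proof. by rewrite /comb !scalerDr opprD [u + u' + _]addrACA [LHS]addrACA. Qed.

Let comb1 (x : A) (c d e : K) u v w :
    u = c *: x -> v = d *: x -> w = e *: x ->
    c - (R + S) * d + R * S * e = 0 ->
  comb u v w = 0.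
Proof.
by move=> -> -> -> h; rewrite /comb !scalerA -scalerBl -scalerDl h scale0r.
Qed.

Let comb2 (x y : A) (c d e c' d' e' : K) u v w :
    u = c *: x + c' *: y -> v = d *: x + d' *: y -> w = e *: x + e' *: y ->
    c - (R + S) * d + R * S * e = 0 -> c' - (R + S) * d' + R * S * e' = 0 ->
  comb u v w = 0.
Proof.
move=> -> -> -> h h'.
by rewrite combD (@comb1 x c d e) // (@comb1 y c' d' e') ?addr0.
Qed.

Lemma serre_addl (E F G H : A) :
    F * E = (R / S) *: (E * F) -> F * G = S *: (G * F) ->
    H * E = R^-1 *: (E * H) ->
    E * E * G - (R + S) *: (E * G * E) + (R * S) *: (G * E * E) = 0 ->
    F * F * H - (R + S) *: (F * H * F) + (R * S) *: (H * F * F) = 0 ->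
  let X := E + F in let Y := G + H in
  X * X * Y - (R + S) *: (X * Y * X) + (R * S) *: (Y * X * X) = 0.
Proof.
move=> FE FG HE EEG FFH X Y; rewrite -/(comb _ _ _).
pose L x y z := comb (x * y * z) (x * z * y) (z * x * y).
have LDl x x' y z : L (x + x') y z = L x y z + L x' y z.
  by rewrite /L -combD !(mulrDl, mulrDr).
have LDm x y y' z : L x (y + y') z = L x y z + L x y' z.
  by rewrite /L -combD !(mulrDl, mulrDr).
have LDr x y z z' : L x y (z + z') = L x y z + L x y z'.
  by rewrite /L -combD !(mulrDl, mulrDr).
rewrite -[comb _ _ _]/(L X X Y) /X /Y LDr !(LDl, LDm).
have -> : L E E G = 0 by [].
have -> : L F F H = 0 by [].
have -> : L E E H = 0.
  apply: (@comb1 (E * E * H) 1 R^-1 (R^-1 * R^-1)); last by field.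
  - by rewrite scale1r.
  - by rewrite -[in LHS]mulrA HE -scalerAr mulrA.
  - by rewrite HE -scalerAl -[in LHS]mulrA HE -scalerAr scalerA [X in _ *: X = _]mulrA.
have -> : L F F G = 0.
  apply: (@comb1 (G * F * F) (S * S) S 1); last by field.
  - by rewrite -[in LHS]mulrA FG -scalerAr mulrA FG -scalerAl scalerA.
  - by rewrite FG -scalerAl.
  - by rewrite scale1r.
have EFG : L E F G + L F E G = 0.
  rewrite /L -combD.
  apply: (@comb2 (E * G * F) (G * E * F) (S + R) 1 0 0 R (1 + R / S)); try by field.
  - rewrite scale0r addr0 scalerDl -[in LHS]mulrA FG -scalerAr mulrA; congr (_ + _).
    rewrite FE -scalerAl -[in LHS]mulrA FG -scalerAr scalerA [X in _ *: X = _]mulrA.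
    by congr (_ *: _); field.
  - rewrite scale1r; congr (_ + _).
    rewrite FG -scalerAl -[in LHS]mulrA FE -scalerAr scalerA [X in _ *: X = _]mulrA.
    by congr (_ *: _); field.
  - by rewrite scale0r add0r scalerDl scale1r -[G * F * E]mulrA FE -scalerAr mulrA.
have EFH : L E F H + L F E H = 0.
  rewrite /L -combD.
  apply: (@comb2 (E * F * H) (E * H * F) (1 + R / S) S^-1 0 0 1 (R^-1 + S^-1));
    try by field; rewrite ?R0 ?S0.
  - by rewrite scale0r addr0 scalerDl scale1r FE -scalerAl.
  - rewrite scale1r addrC; congr (_ + _).
    rewrite -[in LHS]mulrA HE -scalerAr mulrA FE -scalerAl scalerA.
    by congr (_ *: _); field; rewrite ?R0 ?S0.
  - rewrite scale0r add0r scalerDl HE -scalerAl; congr (_ + _).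
    rewrite -[in LHS]mulrA FE -scalerAr mulrA HE -scalerAl scalerA.
    by congr (_ *: _); field; rewrite ?R0 ?S0.
by rewrite !(addr0, add0r) EFG add0r EFH.
Qed.

Lemma serre_addr (E F G H : A) :
    H * G = (R / S) *: (G * H) -> F * G = S *: (G * F) ->
    H * E = R^-1 *: (E * H) ->
    E * G * G - (R + S) *: (G * E * G) + (R * S) *: (G * G * E) = 0 ->
    F * H * H - (R + S) *: (H * F * H) + (R * S) *: (H * H * F) = 0 ->
  let X := E + F in let Y := G + H in
  X * Y * Y - (R + S) *: (Y * X * Y) + (R * S) *: (Y * Y * X) = 0.
Proof.
move=> HG FG HE EGG FHH X Y; rewrite -/(comb _ _ _).
pose L x y z := comb (x * y * z) (y * x * z) (y * z * x).
have LDl x x' y z : L (x + x') y z = L x y z + L x' y z.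
  by rewrite /L -combD !(mulrDl, mulrDr).
have LDm x y y' z : L x (y + y') z = L x y z + L x y' z.
  by rewrite /L -combD !(mulrDl, mulrDr).
have LDr x y z z' : L x y (z + z') = L x y z + L x y z'.
  by rewrite /L -combD !(mulrDl, mulrDr).
rewrite -[comb _ _ _]/(L X Y Y) /X /Y LDl !(LDm, LDr).
have -> : L E G G = 0 by [].
have -> : L F H H = 0 by [].
have -> : L E H H = 0.
  apply: (@comb1 (E * H * H) 1 R^-1 (R^-1 * R^-1)); last by field.
  - by rewrite scale1r.
  - by rewrite HE -scalerAl.
  - by rewrite -[in LHS]mulrA HE -scalerAr mulrA HE -scalerAl scalerA.
have -> : L F G G = 0.
  apply: (@comb1 (G * G * F) (S * S) S 1); last by field.
  - by rewrite FG -scalerAl -[in LHS]mulrA FG -scalerAr scalerA [X in _ *: X = _]mulrA.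
  - by rewrite -[in LHS]mulrA FG -scalerAr mulrA.
  - by rewrite scale1r.
have EGH : L E G H + L E H G = 0.
  rewrite /L -combD.
  apply: (@comb2 (E * G * H) (G * E * H) (1 + R / S) S^-1 0 0 1 (R^-1 + S^-1));
    try by field; rewrite ?R0 ?S0.
  - by rewrite scale0r addr0 scalerDl scale1r -[E * H * G]mulrA HG -scalerAr mulrA.
  - rewrite scale1r addrC; congr (_ + _).
    rewrite HE -scalerAl -[in LHS]mulrA HG -scalerAr scalerA [X in _ *: X = _]mulrA.
    by congr (_ *: _); field; rewrite ?R0 ?S0.
  - rewrite scale0r add0r scalerDl -[in LHS]mulrA HE -scalerAr mulrA; congr (_ + _).
    rewrite HG -scalerAl -[in LHS]mulrA HE -scalerAr scalerA [X in _ *: X = _]mulrA.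
    by congr (_ *: _); field; rewrite ?R0 ?S0.
have FGH : L F G H + L F H G = 0.
  rewrite /L -combD.
  apply: (@comb2 (G * F * H) (G * H * F) (S + R) 1 0 0 R (1 + R / S)); try by field.
  - rewrite scale0r addr0 scalerDl FG -scalerAl; congr (_ + _).
    rewrite -[in LHS]mulrA HG -scalerAr mulrA FG -scalerAl scalerA.
    by congr (_ *: _); field.
  - rewrite scale1r; congr (_ + _).
    rewrite -[in LHS]mulrA FG -scalerAr mulrA HG -scalerAl scalerA.
    by congr (_ *: _); field.
  - by rewrite scale0r add0r scalerDl scale1r HG -scalerAl.
rewrite !(addr0, add0r) [X in X + _ = _]EGH.
by rewrite ?(addr0, add0r) FGH.
Qed.

End Serre.

Section Coproduct.
Variables (K : fieldType) (l : nat) (q : qparam K).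
Local Notation r := (qr q).
Local Notation s := (qs q).
Local Notation U := (Ugl l q).

Definition ugen (x : glgen l) : U := pgen (glrel q) x.
Definition Ue j : U := ugen (GE j).
Definition Uf j : U := ugen (GF j).
Definition Ua i : U := ugen (GA i).
Definition UaV i : U := ugen (GAV i).
Definition Ub i : U := ugen (GB i).
Definition UbV i : U := ugen (GBV i).

Definition omega j : U := Ua (lo j) * Ub (hi j).
Definition omegaV j : U := UaV (lo j) * UbV (hi j).
Definition omega' j : U := Ua (hi j) * Ub (lo j).
Definition omega'V j : U := UaV (hi j) * UbV (lo j).

Lemma aeval_ugen t : aeval ugen t = \pi_(presented (glrel q)) t.
Proof.
elim: t => [x|c|x IHx y IHy|x IHx y IHy] //=.
- by rewrite [LHS]pscaleE mulr1.
- by rewrite IHx IHy -piD.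
- by rewrite IHx IHy -piM.
Qed.

Lemma Urel x y : glrel q x y -> aeval ugen x = aeval ugen y.
Proof. by move=> xy; rewrite !aeval_ugen; apply/apiP/acong_rel. Qed.

Let alg c (x : U) : c%:A * x = c *: x. Proof. exact: mulr_algl. Qed.
Let a0 : 0%:A = 0 :> U. Proof. exact: scale0r. Qed.
Let a1 : 1%:A = 1 :> U. Proof. exact: scale1r. Qed.
Let aN (x : U) : (-1)%:A * x = - x. Proof. by rewrite alg scaleN1r. Qed.
Let simpU := (alg, aN, a0, a1).

Lemma UtorusC x y : is_torus x -> is_torus y -> ugen x * ugen y = ugen y * ugen x.
Proof. by move=> tx ty; exact: (Urel (R1_comm _ tx ty)). Qed.

Lemma UaK i : Ua i * UaV i = 1.
Proof. by rewrite [LHS](Urel (R1_a _ i)) /= a1. Qed.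

Lemma UbK i : Ub i * UbV i = 1.
Proof. by rewrite [LHS](Urel (R1_b _ i)) /= a1. Qed.

Lemma Ua_e i j : Ua i * Ue j = r ^ dot (eps i) (alpha j) *: (Ue j * Ua i).
Proof. by rewrite [LHS](Urel (R2_e _ i j)) /= alg. Qed.

Lemma Ua_f i j : Ua i * Uf j = r ^ (- dot (eps i) (alpha j)) *: (Uf j * Ua i).
Proof. by rewrite [LHS](Urel (R2_f _ i j)) /= alg. Qed.

Lemma Ub_e i j : Ub i * Ue j = s ^ dot (eps i) (alpha j) *: (Ue j * Ub i).
Proof. by rewrite [LHS](Urel (R3_e _ i j)) /= alg. Qed.

Lemma Ub_f i j : Ub i * Uf j = s ^ (- dot (eps i) (alpha j)) *: (Uf j * Ub i).
Proof. by rewrite [LHS](Urel (R3_f _ i j)) /= alg. Qed.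

Lemma Uef i j : Ue i * Uf j - Uf j * Ue i =
  ((i == j)%:R / (r - s)) *: (omega i - omega' i).
Proof. by have /= := Urel (R4 _ i j); rewrite !simpU. Qed.

Lemma UeC (i j : 'I_l) : ((i.+1 < j) || (j.+1 < i))%N -> Ue i * Ue j = Ue j * Ue i.
Proof.
move=> ij; apply/eqP; rewrite -subr_eq0; apply/eqP.
by have /= := Urel (R5_e _ ij); rewrite !simpU.
Qed.

Lemma UfC (i j : 'I_l) : ((i.+1 < j) || (j.+1 < i))%N -> Uf i * Uf j = Uf j * Uf i.
Proof.
move=> ij; apply/eqP; rewrite -subr_eq0; apply/eqP.
by have /= := Urel (R5_f _ ij); rewrite !simpU.
Qed.

Lemma serre_e_l (i j : 'I_l) : j = i.+1 :> nat ->
  Ue i * Ue i * Ue j - (r + s) *: (Ue i * Ue j * Ue i)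
    + (r * s) *: (Ue j * Ue i * Ue i) = 0.
Proof. by move=> ij; have /= := Urel (R6_l _ ij); rewrite !simpU. Qed.

Lemma serre_e_r (i j : 'I_l) : j = i.+1 :> nat ->
  Ue i * Ue j * Ue j - (r + s) *: (Ue j * Ue i * Ue j)
    + (r * s) *: (Ue j * Ue j * Ue i) = 0.
Proof. by move=> ij; have /= := Urel (R6_r _ ij); rewrite !simpU. Qed.

Lemma serre_f_l (i j : 'I_l) : j = i.+1 :> nat ->
  Uf i * Uf i * Uf j - (r^-1 + s^-1) *: (Uf i * Uf j * Uf i)
    + (r^-1 * s^-1) *: (Uf j * Uf i * Uf i) = 0.
Proof. by move=> ij; have /= := Urel (R7_l _ ij); rewrite !simpU. Qed.

Lemma serre_f_r (i j : 'I_l) : j = i.+1 :> nat ->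
  Uf i * Uf j * Uf j - (r^-1 + s^-1) *: (Uf j * Uf i * Uf j)
    + (r^-1 * s^-1) *: (Uf j * Uf j * Uf i) = 0.
Proof. by move=> ij; have /= := Urel (R7_r _ ij); rewrite !simpU. Qed.

(* omega_i e_j = wt i j e_j omega_i and omega'_i e_j = wt' i j e_j omega'_i *)
Definition wt (i j : 'I_l) : K :=
  r ^ dot (eps (lo i)) (alpha j) * s ^ dot (eps (hi i)) (alpha j).
Definition wt' (i j : 'I_l) : K :=
  r ^ dot (eps (hi i)) (alpha j) * s ^ dot (eps (lo i)) (alpha j).

Lemma omega_e i j : omega i * Ue j = wt i j *: (Ue j * omega i).
Proof.
rewrite /omega -[in LHS]mulrA Ub_e -scalerAr [in LHS]mulrA Ua_e -scalerAl scalerA -[in LHS]mulrA.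
by rewrite [s ^ _ * _]mulrC.
Qed.

Lemma omega'_e i j : omega' i * Ue j = wt' i j *: (Ue j * omega' i).
Proof.
rewrite /omega' -[in LHS]mulrA Ub_e -scalerAr [in LHS]mulrA Ua_e -scalerAl scalerA -[in LHS]mulrA.
by rewrite [s ^ _ * _]mulrC.
Qed.

Lemma omega_f i j : omega i * Uf j = (wt i j)^-1 *: (Uf j * omega i).
Proof.
rewrite /omega -[in LHS]mulrA Ub_f -scalerAr [in LHS]mulrA Ua_f -scalerAl scalerA -[in LHS]mulrA.
by rewrite invfM !invr_expz mulrC.
Qed.

Lemma omega'_f i j : omega' i * Uf j = (wt' i j)^-1 *: (Uf j * omega' i).
Proof.
rewrite /omega' -[in LHS]mulrA Ub_f -scalerAr [in LHS]mulrA Ua_f -scalerAl scalerA -[in LHS]mulrA.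
by rewrite invfM !invr_expz mulrC.
Qed.

Lemma lo_lo (i j : 'I_l) : (lo i == lo j) = (i == j :> nat). Proof. by []. Qed.
Lemma hi_hi (i j : 'I_l) : (hi i == hi j) = (i == j :> nat). Proof. by []. Qed.
Lemma lo_hi (i j : 'I_l) : (lo i == hi j) = (i == j.+1 :> nat). Proof. by []. Qed.
Lemma hi_lo (i j : 'I_l) : (hi i == lo j) = (j == i.+1 :> nat).
Proof. by rewrite eq_sym lo_hi. Qed.

Let dotE := (dot_alpha, lo_lo, hi_hi, lo_hi, hi_lo).
Let r0 : r != 0 := qr_neq0 q.
Let s0 : s != 0 := qs_neq0 q.

Lemma wt_diag i : wt i i = r / s.
Proof. by rewrite /wt !dotE eqxx ltn_eqF. Qed.

Lemma wt_next (i j : 'I_l) : j = i.+1 :> nat -> wt i j = s.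
Proof.
move=> ij; rewrite /wt !dotE ij eqxx.
have -> : (i == i.+2 :> nat) = false by apply/negbTE; lia.
have -> : (i == i.+1 :> nat) = false by apply/negbTE; lia.
by rewrite mul1r.
Qed.

Lemma wt_prev (i j : 'I_l) : j = i.+1 :> nat -> wt j i = r^-1.
Proof.
move=> ij; rewrite /wt !dotE ij eqxx.
have -> : (i == i.+2 :> nat) = false by apply/negbTE; lia.
have -> : (i.+1 == i :> nat) = false by apply/negbTE; lia.
by rewrite mulr1.
Qed.

Lemma wt_far (i j : 'I_l) : ((i.+1 < j) || (j.+1 < i))%N -> wt i j = 1.
Proof.
move=> ij; rewrite /wt !dotE.
have -> : (i == j :> nat) = false by apply/negbTE; lia.
have -> : (i == j.+1 :> nat) = false by apply/negbTE; lia.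
have -> : (j == i.+1 :> nat) = false by apply/negbTE; lia.
by rewrite mulr1.
Qed.

Lemma wtV (i j : 'I_l) : wt' i j = (wt j i)^-1.
Proof.
rewrite /wt' /wt invfM !invr_expz !dotE !opprB.
by rewrite [(j == i :> nat)]eq_sym.
Qed.

Lemma omega_comm x i : is_torus x -> GRing.comm (ugen x) (omega i).
Proof. by move=> tx; apply: commrM; exact: UtorusC. Qed.

Lemma omega'_comm x i : is_torus x -> GRing.comm (ugen x) (omega' i).
Proof. by move=> tx; apply: commrM; exact: UtorusC. Qed.

Lemma omegaC i j : omega i * omega j = omega j * omega i.
Proof. by apply/commr_sym/commrM; apply/commr_sym/omega_comm. Qed.

Lemma omega'C i j : omega' i * omega' j = omega' j * omega' i.
Proof. by apply/commr_sym/commrM; apply/commr_sym/omega'_comm. Qed.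

Lemma omega_omega'C i j : omega i * omega' j = omega' j * omega i.
Proof. by apply/commr_sym/commrM; apply/commr_sym/omega'_comm. Qed.

Lemma one_tensor_neq0 : (1 : tensor U U) != 0.
Proof.
have cr := @counit_rel K l q.
pose h (x y : U) : K^o := counit x * counit y.
have bh : bilin h.
  by split=> x c y z; rewrite /h /counit (pevalD cr) (pevalZ cr);
    [rewrite mulrDl scalerAl|rewrite mulrDr scalerAr].
apply/eqP => /(congr1 (tlift h)) /eqP.
rewrite [X in X == _](tlift_pure bh) /h /counit (peval1 cr) mulr1.
suff -> : tlift h 0 = 0 by rewrite oner_eq0.
by apply: (addrI (tlift h 0)); rewrite -{1}[tlift h 0]scale1r -tlift_linear //
  scaler0 !addr0.
Qed.

End Coproduct.

HB.instance Definition _ (K : fieldType) (l : nat) (q : qparam K) :=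
  GRing.PzSemiRing_isNonZero.Build (tensor (Ugl l q) (Ugl l q))
    (one_tensor_neq0 l q).
HB.instance Definition _ (K : fieldType) (l : nat) (q : qparam K) :=
  GRing.LSemiModule_isLSemiAlgebra.Build K (tensor (Ugl l q) (Ugl l q))
    (@tscalAl _ _ _).
HB.instance Definition _ (K : fieldType) (l : nat) (q : qparam K) :=
  GRing.LSemiAlgebra_isSemiAlgebra.Build K (tensor (Ugl l q) (Ugl l q))
    (@tscalAr _ _ _).

Section Comul.
Variables (K : fieldType) (l : nat) (q : qparam K).
Local Notation r := (qr q).
Local Notation s := (qs q).
Local Notation U := (Ugl l q).
Local Notation T := (tensor U U).
Local Notation Ue := (@Ue K l q).
Local Notation Uf := (@Uf K l q).
Local Notation ugen := (@ugen K l q).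
Local Notation omega := (@omega K l q).
Local Notation omega' := (@omega' K l q).
Local Notation wt := (@wt K l q).

Definition comul_gen (x : glgen l) : T :=
  match x with
  | GE j => Ue j ⊗ 1 + omega j ⊗ Ue j
  | GF j => 1 ⊗ Uf j + Uf j ⊗ omega' j
  | _ => ugen x ⊗ ugen x
  end.

Definition comul : U -> T := peval comul_gen.

Let tM := @tpureM K U U.
Let alg c (x : T) : c%:A * x = c *: x. Proof. exact: mulr_algl. Qed.
Let a0 : 0%:A = 0 :> T. Proof. exact: scale0r. Qed.
Let a1 : 1%:A = 1 :> T. Proof. exact: scale1r. Qed.
Let aN (x : T) : (-1)%:A * x = - x. Proof. by rewrite alg scaleN1r. Qed.
Let simpT := (alg, aN, a0, a1).

Let comul_torus x : is_torus x -> comul_gen x = ugen x ⊗ ugen x.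
Proof. by case: x. Qed.

Let comul_torus_e x c j : is_torus x -> ugen x * Ue j = c *: (Ue j * ugen x) ->
  (ugen x ⊗ ugen x : T) * comul_gen (GE j)
  = c *: (comul_gen (GE j) * (ugen x ⊗ ugen x)).
Proof.
move=> tx xe; rewrite /= mulrDr mulrDl scalerDr !tM mulr1 mul1r xe.
by rewrite tpureZl tpureZr (omega_comm _ _ tx).
Qed.

Let comul_torus_f x c j : is_torus x -> ugen x * Uf j = c *: (Uf j * ugen x) ->
  (ugen x ⊗ ugen x : T) * comul_gen (GF j)
  = c *: (comul_gen (GF j) * (ugen x ⊗ ugen x)).
Proof.
move=> tx xf; rewrite /= mulrDr mulrDl scalerDr !tM mulr1 mul1r xf.
by rewrite tpureZl tpureZr (omega'_comm _ _ tx).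
Qed.

Let tpure0l (x : U) : 0 ⊗ x = 0 :> T.
Proof. by rewrite -[0 in LHS](scale0r 0) tpureZl scale0r. Qed.

Let tpure0r (x : U) : x ⊗ 0 = 0 :> T.
Proof. by rewrite -[0 in LHS](scale0r 0) tpureZr scale0r. Qed.

Let tpureNl (x y : U) : (- x) ⊗ y = - (x ⊗ y).
Proof. by rewrite -scaleN1r tpureZl scaleN1r. Qed.

Let tpureNr (x y : U) : x ⊗ (- y) = - (x ⊗ y).
Proof. by rewrite -scaleN1r tpureZr scaleN1r. Qed.

Let comul_ef i j :
  comul_gen (GE i) * comul_gen (GF j) - comul_gen (GF j) * comul_gen (GE i) =
  ((i == j)%:R / (r - s)) *: (omega i ⊗ omega i - omega' i ⊗ omega' i).
Proof.
rewrite /= !(mulrDl, mulrDr) !tM !(mul1r, mulr1).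
rewrite omega_f omega'_e wtV tpureZl tpureZr.
set c := (_ / _); set A := Ue i ⊗ Uf j; set Z := _ *: (_ ⊗ _).
have eH : (Ue i * Uf j) ⊗ omega' j - (Uf j * Ue i) ⊗ omega' j
          = c *: ((omega i - omega' i) ⊗ omega' j).
  by rewrite -tpureNl -tpureDl Uef tpureZl.
have eG : omega i ⊗ (Ue i * Uf j) - omega i ⊗ (Uf j * Ue i)
          = c *: (omega i ⊗ (omega i - omega' i)).
  by rewrite -tpureNr -tpureDr Uef tpureZr.
transitivity (c *: ((omega i - omega' i) ⊗ omega' j)
              + c *: (omega i ⊗ (omega i - omega' i))).
  rewrite -eH -eG; set X1 := _ ⊗ omega' j; set X2 := _ ⊗ omega' j.
  set Y1 := omega i ⊗ _; set Y2 := omega i ⊗ _.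
  move: A X1 X2 Y1 Y2 Z => /= A X1 X2 Y1 Y2 Z.
  by rewrite [A + Y2 + _]addrACA opprD addrACA !opprD !(addrACA _ _ (- _))
     !subrr add0r addr0.
rewrite -scalerDr /c; have [->|_] := eqVneq i j; last by rewrite mul0r !scale0r.
congr (_ *: _); rewrite tpureDl tpureDr tpureNl tpureNr.
by rewrite addrC addrA subrK.
Qed.

Lemma comul_rel x y : glrel q x y -> aeval comul_gen x = aeval comul_gen y.
Proof.
case=> {x y} [x y tx ty|i|i|i j|i j|i j|i j|i j|i j ij|i j ij|i j ij|i j ij|i j ij|i j ij].
- by rewrite [LHS]/= [RHS]/= !comul_torus // !tM UtorusC.
- by rewrite /= tM [ugen _ * _]UaK a1.
- by rewrite /= tM [ugen _ * _]UbK a1.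
- by rewrite [LHS]/= [RHS]/= alg; apply: comul_torus_e => //; exact: Ua_e.
- by rewrite [LHS]/= [RHS]/= alg; apply: comul_torus_f => //; exact: Ua_f.
- by rewrite [LHS]/= [RHS]/= alg; apply: comul_torus_e => //; exact: Ub_e.
- by rewrite [LHS]/= [RHS]/= alg; apply: comul_torus_f => //; exact: Ub_f.
- move: (comul_ef i j); rewrite [aeval _ _]/= [aeval _ (Amul _ _)]/= !simpT => ->.
  by rewrite !tM.
- rewrite /= !simpT; apply/eqP; rewrite subr_eq0; apply/eqP.
  have ji : ((j.+1 < i) || (i.+1 < j))%N by rewrite orbC.
  rewrite !(mulrDl, mulrDr) !tM !(mul1r, mulr1) !omega_e !wt_far // !scale1r.
  by rewrite (UeC _ ij) omegaC; exact: addrACA.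
- rewrite /= !simpT; apply/eqP; rewrite subr_eq0; apply/eqP.
  have ji : ((j.+1 < i) || (i.+1 < j))%N by rewrite orbC.
  rewrite !(mulrDl, mulrDr) !tM !(mul1r, mulr1) !omega'_f !wtV !wt_far // !invr1.
  rewrite !scale1r (UfC _ ij) omega'C; exact: addrACA.
- rewrite /= !simpT; apply: serre_addl; rewrite ?qr_neq0 ?qs_neq0 //.
  + by rewrite !tM !(mul1r, mulr1) omega_e wt_diag tpureZl.
  + by rewrite !tM !(mul1r, mulr1) omega_e wt_next // tpureZl.
  + by rewrite !tM !(mul1r, mulr1) omega_e (wt_prev _ ij) tpureZl.
  + by rewrite !tM !mulr1 -!tpureZl -tpureNl -!tpureDl serre_e_l // tpure0l.
  + have w1 : omega i * omega j * omega i = omega i * omega i * omega j.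
      by rewrite -[LHS]mulrA (omegaC _ j) [LHS]mulrA.
    have w2 : omega j * omega i * omega i = omega i * omega i * omega j.
      by rewrite (omegaC _ j) w1.
    by rewrite !tM w1 w2 -!tpureZr -tpureNr -!tpureDr serre_e_l // tpure0r.
- rewrite /= !simpT; apply: serre_addr; rewrite ?qr_neq0 ?qs_neq0 //.
  + by rewrite !tM !(mul1r, mulr1) omega_e wt_diag tpureZl.
  + by rewrite !tM !(mul1r, mulr1) omega_e wt_next // tpureZl.
  + by rewrite !tM !(mul1r, mulr1) omega_e (wt_prev _ ij) tpureZl.
  + by rewrite !tM !mulr1 -!tpureZl -tpureNl -!tpureDl serre_e_r // tpure0l.
  + have w1 : omega j * omega i * omega j = omega i * omega j * omega j.
      by rewrite (omegaC _ j).
    have w2 : omega j * omega j * omega i = omega i * omega j * omega j.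
      by rewrite -[LHS]mulrA (omegaC _ j i) mulrA w1.
    by rewrite !tM w1 w2 -!tpureZr -tpureNr -!tpureDr serre_e_r // tpure0r.
- rewrite /= !simpT [r^-1 + _]addrC [r^-1 * _]mulrC.
  apply: serre_addl; rewrite ?invr_eq0 ?qr_neq0 ?qs_neq0 //.
  + rewrite !tM !(mul1r, mulr1) omega'_f wtV invrK wt_diag tpureZr.
    by rewrite invrK [r / s]mulrC.
  + by rewrite !tM !(mul1r, mulr1) omega'_f wtV invrK (wt_prev _ ij) tpureZr.
  + by rewrite !tM !(mul1r, mulr1) omega'_f wtV !invrK wt_next // tpureZr.
  + rewrite !tM !mulr1 -!tpureZr -tpureNr -!tpureDr.
    by rewrite [s^-1 + _]addrC [s^-1 * _]mulrC serre_f_l // tpure0r.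
  + have w1 : omega' i * omega' j * omega' i = omega' i * omega' i * omega' j.
      by rewrite -[LHS]mulrA (omega'C _ j) [LHS]mulrA.
    have w2 : omega' j * omega' i * omega' i = omega' i * omega' i * omega' j.
      by rewrite (omega'C _ j) w1.
    rewrite !tM w1 w2 -!tpureZl -tpureNl -!tpureDl.
    by rewrite [s^-1 + _]addrC [s^-1 * _]mulrC serre_f_l // tpure0l.
- rewrite /= !simpT [r^-1 + _]addrC [r^-1 * _]mulrC.
  apply: serre_addr; rewrite ?invr_eq0 ?qr_neq0 ?qs_neq0 //.
  + rewrite !tM !(mul1r, mulr1) omega'_f wtV invrK wt_diag tpureZr.
    by rewrite invrK [r / s]mulrC.
  + by rewrite !tM !(mul1r, mulr1) omega'_f wtV invrK (wt_prev _ ij) tpureZr.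
  + by rewrite !tM !(mul1r, mulr1) omega'_f wtV !invrK wt_next // tpureZr.
  + rewrite !tM !mulr1 -!tpureZr -tpureNr -!tpureDr.
    by rewrite [s^-1 + _]addrC [s^-1 * _]mulrC serre_f_r // tpure0r.
  + have w1 : omega' j * omega' i * omega' j = omega' i * omega' j * omega' j.
      by rewrite (omega'C _ j).
    have w2 : omega' j * omega' j * omega' i = omega' i * omega' j * omega' j.
      by rewrite -[LHS]mulrA (omega'C _ j i) mulrA w1.
    rewrite !tM w1 w2 -!tpureZl -tpureNl -!tpureDl.
    by rewrite [s^-1 + _]addrC [s^-1 * _]mulrC serre_f_r // tpure0l.
Qed.

Lemma comul_gen_eq x : comul (ugen x) = comul_gen x.
Proof. exact: (peval_gen comul_rel). Qed.

Lemma comulD : {morph comul : x y / x + y}.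
Proof. exact: (pevalD comul_rel). Qed.

Lemma comulM : {morph comul : x y / x * y}.
Proof. exact: (pevalM comul_rel). Qed.

Lemma comul1 : comul 1 = 1.
Proof. exact: (peval1 comul_rel). Qed.

Lemma comulZ c x : comul (c *: x) = c *: comul x.
Proof. exact: (pevalZ comul_rel). Qed.

End Comul.

(* Restriction of scalars along c |-> c%:A. *)
Section Restriction.
Variables (K : fieldType) (A : algType K) (M : lmodType A).

Definition resK : Type := M.
HB.instance Definition _ := GRing.Zmodule.on resK.

Definition rscale (c : K) (m : resK) : resK := (c%:A : A) *: (m : M).

Lemma rscaleA c d m : rscale c (rscale d m) = rscale (c * d) m.
Proof. by rewrite /rscale scalerA mulr_algl scalerA. Qed.

Lemma rscale1 : left_id 1 rscale.
Proof. by move=> m; rewrite /rscale scale1r scale1r. Qed.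

Lemma rscaleDr : right_distributive rscale +%R.
Proof. by move=> c m n; rewrite /rscale scalerDr. Qed.

Lemma rscaleDl m : {morph rscale^~ m : c d / c + d}.
Proof. by move=> c d; rewrite /rscale !scalerDl. Qed.

HB.instance Definition _ :=
  GRing.Zmodule_isLmodule.Build K resK rscaleA rscale1 rscaleDr rscaleDl.

Definition ract (x : A) (m : resK) : resK := x *: (m : M).

Lemma ract_bilin : bilin ract.
Proof.
split=> [m c x y|x c m n]; rewrite /ract.
  by rewrite scalerDl -[c *: x]mulr_algl -scalerA.
rewrite scalerDr; congr (_ + _).
by rewrite [LHS]scalerA [RHS]scalerA mulr_algl mulr_algr.
Qed.

End Restriction.

(* (x ⊗ y) (m ⊗ n) = x m ⊗ y n *)
Definition tact (K : fieldType) (A B : algType K)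
    (M : lmodType A) (N : lmodType B) :
    tensor A B -> tensor (resK M) (resK N) -> tensor (resK M) (resK N) :=
  tmap2 (@ract K A M) (@ract K B N).

Section TensorModule.
Variables (K : fieldType) (l : nat) (q : qparam K).
Local Notation U := (Ugl l q).
Variables (M N : lmodType U).

Definition tensU : Type := tensor (resK M) (resK N).
HB.instance Definition _ := GRing.Zmodule.on tensU.

Definition uscale (x : U) (z : tensU) : tensU := tact (comul x) z.

Let bb : bilin (@tact K U U M N) := tmap2_bilin (ract_bilin M) (ract_bilin N).

Let tactM (x y : tensor U U) (z : tensor (resK M) (resK N)) :
  tact x (tact y z) = tact (x * y) z.
Proof.
elim/tensor_ind: x => [|x x' IH IH'|x x'].
- by rewrite mul0r !(bilin0l bb).
- by rewrite mulrDl !(bilinDl bb) IH IH'.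
elim/tensor_ind: y => [|y y' IH IH'|y y'].
- by rewrite mulr0 !(bilin0l bb) (bilin0r bb).
- by rewrite mulrDr !(bilinDl bb) (bilinDr bb) IH IH'.
elim/tensor_ind: z => [|z z' IH IH'|z z'].
- by rewrite !(bilin0r bb).
- by rewrite !(bilinDr bb) IH IH'.
rewrite tpureM /tact !tmap2_pure; try exact: ract_bilin.
by rewrite /ract !scalerA.
Qed.

Lemma uscaleA x y z : uscale x (uscale y z) = uscale (x * y) z.
Proof. by rewrite /uscale comulM tactM. Qed.

Lemma uscale1 : left_id 1 uscale.
Proof.
rewrite /uscale => z; rewrite comul1.
elim/tensor_ind: z => [|z z' IH IH'|z z'].
- exact: (bilin0r bb).
- by rewrite [LHS](bilinDr bb) IH IH'.
rewrite /tact tmap2_pure; try exact: ract_bilin.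
by rewrite /ract !scale1r.
Qed.

Lemma uscaleDr : right_distributive uscale +%R.
Proof. by move=> x y z; exact: (bilinDr bb). Qed.

Lemma uscaleDl z : {morph uscale^~ z : x y / x + y}.
Proof. by move=> x y; rewrite /uscale comulD; exact: (bilinDl bb). Qed.

HB.instance Definition _ :=
  GRing.Zmodule_isLmodule.Build U tensU uscaleA uscale1 uscaleDr uscaleDl.

End TensorModule.

Definition tflip (K : fieldType) (V W : lmodType K) : tensor V W -> tensor W V :=
  tlift (fun v w => w ⊗ v).

Section Linear.
Variables (K : fieldType) (V : lmodType K).

Definition lspan (S : set V) : set V := [set x |
  exists d (c : 'I_d -> K) (b : 'I_d -> V), (forall k, S (b k)) /\ x = \sum_k c k *: b k].

Definition is_basis (S : set V) d (b : 'I_d -> V) : Prop :=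
  (forall x, S x <-> exists c : 'I_d -> K, x = \sum_k c k *: b k) /\
  (forall c : 'I_d -> K, \sum_k c k *: b k = 0 -> forall k, c k = 0).

End Linear.

Inductive gen_subalg (K : fieldType) (A : algType K) (S : set A) : set A :=
| gs_gen x : S x -> gen_subalg S x
| gs_scal c : gen_subalg S c%:A
| gs_add x y : gen_subalg S x -> gen_subalg S y -> gen_subalg S (x + y)
| gs_mul x y : gen_subalg S x -> gen_subalg S y -> gen_subalg S (x * y).

Section Pairing.
Variables (K : fieldType) (l : nat) (q : qparam K).
Local Notation r := (qr q).
Local Notation s := (qs q).
Local Notation U := (Ugl l q).
Local Notation Ue := (@Ue K l q).
Local Notation Uf := (@Uf K l q).
Local Notation omega := (@omega K l q).
Local Notation omegaV := (@omegaV K l q).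
Local Notation omega' := (@omega' K l q).
Local Notation omega'V := (@omega'V K l q).
Local Notation a_n := (Ua q (@ord_max l)).
Local Notation a_nV := (UaV q (@ord_max l)).
Local Notation b_n := (Ub q (@ord_max l)).
Local Notation b_nV := (UbV q (@ord_max l)).
Local Notation eps_n := (eps (@ord_max l)).

Definition Btorus : set U := [set x |
  (exists j, x = omega j \/ x = omegaV j) \/ x = a_n \/ x = a_nV].

Definition B'torus : set U := [set x |
  (exists j, x = omega' j \/ x = omega'V j) \/ x = b_n \/ x = b_nV].

Definition Balg : set U := gen_subalg ([set x | exists j, x = Ue j] `|` Btorus).
Definition B'alg : set U := gen_subalg ([set x | exists j, x = Uf j] `|` B'torus).

Definition pair_unit (pr : U -> U -> K) (x xV y yV : U) (c : K) : Prop :=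
  [/\ pr x y = c, pr xV y = c^-1, pr x yV = c^-1 & pr xV yV = c].

(* Only the restriction of pr to B' x B is relevant. The coproduct of B' is
   opposite to comul, whence the order of the components in pair_mulr. *)
Record hopf_pairing (pr : U -> U -> K) : Prop := HopfPairing {
  pair_linl : forall c x x' y, B'alg x -> B'alg x' -> Balg y ->
    pr (c *: x + x') y = c * pr x y + pr x' y;
  pair_linr : forall c x y y', B'alg x -> Balg y -> Balg y' ->
    pr x (c *: y + y') = c * pr x y + pr x y';
  pair_1l : forall y, Balg y -> pr 1 y = counit y;
  pair_1r : forall x, B'alg x -> pr x 1 = counit x;
  pair_mulr : forall x y z (xs : seq (U * U)), B'alg x -> Balg y -> Balg z ->
    (forall p, p \in xs -> B'alg p.1 /\ B'alg p.2) ->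
    comul x = \sum_(p <- xs) p.1 ⊗ p.2 ->
    pr x (y * z) = \sum_(p <- xs) pr p.2 y * pr p.1 z;
  pair_mull : forall x y z (zs : seq (U * U)), B'alg x -> B'alg y -> Balg z ->
    (forall p, p \in zs -> Balg p.1 /\ Balg p.2) ->
    comul z = \sum_(p <- zs) p.1 ⊗ p.2 ->
    pr (x * y) z = \sum_(p <- zs) pr x p.1 * pr y p.2;
  pair_f_e : forall i j, pr (Uf i) (Ue j) = (i == j)%:R / (s - r);
  pair_omega : forall i j,
    pair_unit pr (omega' i) (omega'V i) (omega j) (omegaV j)
      (r ^ dot (eps (lo j)) (alpha i) * s ^ dot (eps (hi j)) (alpha i));
  pair_b_a : pair_unit pr b_n b_nV a_n a_nV 1;
  pair_b_omega : forall j, pair_unit pr b_n b_nV (omega j) (omegaV j)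
    (s ^ (- dot eps_n (alpha j)));
  pair_omega_a : forall i, pair_unit pr (omega' i) (omega'V i) a_n a_nV
    (r ^ dot eps_n (alpha i));
  pair_f_torus : forall i y, Btorus y -> pr (Uf i) y = 0;
  pair_torus_e : forall x j, B'torus x -> pr x (Ue j) = 0
}.

(* x ^ k, where xV is the inverse of x: U is not a unitRingType. *)
Definition zpow (x xV : U) (k : int) : U :=
  match k with Posz m => x ^+ m | Negz m => xV ^+ m.+1 end.

Definition omega_lat (x : Lam l) : U :=
  (\prod_(j < l) zpow (omega j) (omegaV j) (acoord x (lo j)))
  * zpow a_n a_nV (acoord x ord_max).

Definition omega'_lat (x : Lam l) : U :=
  (\prod_(j < l) zpow (omega' j) (omega'V j) (acoord x (lo j)))
  * zpow b_n b_nV (acoord x ord_max).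

Definition flat (pr : U -> U -> K) (x y : Lam l) : K :=
  (pr (omega'_lat y) (omega_lat x))^-1.

(* U^+_z and U^-_(-z) *)
Definition Uplus (z : Lam l) : set U := lspan [set x |
  exists2 w : seq 'I_l, \sum_(i <- w) alpha i = z & x = \prod_(i <- w) Ue i].

Definition Uminus (z : Lam l) : set U := lspan [set x |
  exists2 w : seq 'I_l, \sum_(i <- w) alpha i = z & x = \prod_(i <- w) Uf i].

Definition dual_bases (pr : U -> U -> K) (z : Lam l) d (u v : 'I_d -> U) : Prop :=
  [/\ is_basis (Uplus z) u, is_basis (Uminus z) v
    & forall k m, pr (v k) (u m) = (k == m)%:R].

Definition wtspace (M : lmodType U) (x : Lam l) : set (resK M) := [set m |
  forall i, ract (Ua q i) m = r ^ dot (eps i) x *: m /\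
            ract (Ub q i) m = s ^ dot (eps i) x *: m].

Definition wt_of (M : lmodType U) : set (Lam l) :=
  [set x | exists2 m : resK M, wtspace x m & m != 0].

Record category_O (M : lmodType U) : Prop := CategoryO {
  O_span : forall m : resK M, exists (xs : seq (Lam l)) (c : Lam l -> resK M),
    (forall x, x \in xs -> wt_of M x /\ wtspace x (c x)) /\
    m = \sum_(x <- xs) c x;
  O_direct : forall (xs : seq (Lam l)) (c : Lam l -> resK M), uniq xs ->
    (forall x, x \in xs -> wt_of M x /\ wtspace x (c x)) ->
    \sum_(x <- xs) c x = 0 -> forall x, x \in xs -> c x = 0;
  O_findim : forall x, wt_of M x ->
    exists d (b : 'I_d -> resK M), is_basis (@wtspace M x) b;
  O_bounded : exists F : seq (Lam l), forall x, wt_of M x ->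
    exists2 y, y \in F & Qplus (y - x)
}.

Variables (M M' : lmodType U).

Definition is_ftilde (pr : U -> U -> K)
    (g : tensor (resK M) (resK M') -> tensor (resK M) (resK M')) : Prop :=
  linear g /\
  forall x y m m', wtspace x m -> wtspace y m' ->
    g (m ⊗ m') = flat pr x y *: (m ⊗ m').

(* is_ftilde determines the map when M and M' are sums of their weight spaces;
   it exists when these sums are direct. *)
Definition ftilde (pr : U -> U -> K) : tensU M M' -> tensU M M' :=
  if pselect (exists g, is_ftilde pr g) is left ex_g then projT1 (cid ex_g)
  else idfun.

Definition Theta_at d (u v : 'I_d -> U) : tensor U U := \sum_k v k ⊗ u k.

(* The sum over Q^+ of those terms that are nonzero at z; as a \sum_(_ \in _)
   it is 0 by convention if there are infinitely many of them. *)
Definition Theta (d : Lam l -> nat) (u v : forall z, 'I_(d z) -> U)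
    (z : tensU M M') : tensU M M' :=
  \sum_(x \in @Qplus l) (tact (Theta_at (u x) (v x)) z : tensU M M').

End Pairing.

Definition is_iso (A : nzRingType) (M N : lmodType A) (g : M -> N) : Prop :=
  linear g /\ bijective g.

(* Main.v *)
(* Write Theta_z for the canonical element of U^-_(-z) (x) U^+_z. On monomials the
   pairing is computed letter by letter: removing the letter f_j on the left
   amounts to applying to the other argument a skew derivation, which deletes the
   occurrences of e_j one at a time, with weights. Similar skew derivations express
   [e_i, y] for y in U^- and [f_i, x] for x in U^+, so that these commutators are
   adjoint to multiplication by e_i and f_i; in terms of dual bases this says
     (e_i (x) 1) Theta_z - Theta_z (e_i (x) 1)
       = Theta_(z - alpha_i) (omega'_i (x) e_i) - (omega_i (x) e_i) Theta_(z - alpha_i)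
   and similarly for f_i. Since f(lambda, mu) changes by an eigenvalue of omega'_i
   or omega_i when mu or lambda is shifted by alpha_i, summing over z gives the
   equivariance. The map f~ is diagonal with nonzero eigenvalues, and Theta - 1 is
   locally nilpotent on M (x) M' because every vector of M' is annihilated by all
   sufficiently long monomials in the e_i; hence both are invertible. *)
Require Import Defs.
From mathcomp Require Import all_boot all_order all_algebra.
From mathcomp Require Import ring.
From mathcomp Require Import boolp classical_sets functions cardinality fsbigop.
Set Implicit Arguments.
Unset Strict Implicit.
Unset Printing Implicit Defensive.
Import GRing.Theory.
Local Open Scope ring_scope.

(** Since U^+ and U^- are quotients by the Serre relations, an operator given on them letter by
    letter would first have to be shown compatible with these relations. The skew derivations are
    therefore operators [skewd] on vector-valued functions of words; the same operator serves for
    elements of U and for the scalars of the pairing. For elements of U^- and U^+ only the existence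
    of suitable derivatives is stated ([commutator_e], [commutator_f]), a property stable under
    linear combinations. Two coincidences make commutators adjoint to multiplications. The constant
    (s - r)^-1 is both (f_i, e_i) and, up to the order of omega and omega', the factor in
    [e_i, f_i]. The matrix [wt] gives both (omega'_j, omega_k) = wt k j and the scalars with which
    omega_i and omega'_i pass the generators, because [wt'] is the entrywise inverse of its
    transpose ([wtV]). A shift by alpha_i does not preserve Q^+; extending Theta_z by 0 to the whole
    lattice turns the shift into a bijective reindexing of the sum. *)

(** * Subspaces and maps that are linear on them *)

Section Subspaces.
Variables (K : fieldType) (V W : lmodType K).
Implicit Types (S : V -> Prop) (h : V -> W).

Definition subspace S :=
  S 0 /\ forall c x y, S x -> S y -> S (c *: x + y).

(** Relative to a subspace, because a Hopf pairing is assumed bilinear only on [B'alg] and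
    [Balg]. *)
Definition linear_on S h :=
  forall c x y, S x -> S y -> h (c *: x + y) = c *: h x + h y.

Lemma subspaceZ S c x : subspace S -> S x -> S (c *: x).
Proof. by move=> [S0 SZ] Sx; rewrite -[_ *: _]addr0; exact: SZ. Qed.

Lemma subspaceD S x y : subspace S -> S x -> S y -> S (x + y).
Proof. by move=> [S0 SZ] Sx Sy; rewrite -[x]scale1r; exact: SZ. Qed.

Lemma subspace_sum S (I : Type) (s : seq I) (f : I -> V) :
  subspace S -> (forall i, S (f i)) -> S (\sum_(i <- s) f i).
Proof.
by move=> sS Sf; apply: big_ind => //; [case: sS|move=> x y; exact: subspaceD].
Qed.

Lemma linear_on0 S h : subspace S -> linear_on S h -> h 0 = 0.
Proof.
move=> [S0 _] hS; apply: (addrI (h 0)).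
by rewrite -{1}[h 0]scale1r -hS // scaler0 !addr0.
Qed.

Lemma linear_onZ S h c x : subspace S -> linear_on S h -> S x ->
  h (c *: x) = c *: h x.
Proof.
move=> sS hS Sx; rewrite -[c *: x]addr0 hS //; last by case: sS.
by rewrite (linear_on0 sS hS) addr0.
Qed.

Lemma linear_on_sum S h (I : Type) (s : seq I) (f : I -> V) :
    subspace S -> linear_on S h -> (forall i, S (f i)) ->
  h (\sum_(i <- s) f i) = \sum_(i <- s) h (f i).
Proof.
move=> sS hS Sf; elim: s => [|i s IHs].
  by rewrite !big_nil (linear_on0 sS hS).
rewrite !big_cons -[f i]scale1r hS ?scale1r ?IHs //; exact: subspace_sum.
Qed.

End Subspaces.

Lemma subspaceT (K : fieldType) (V : lmodType K) : subspace (fun _ : V => True).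
Proof. by []. Qed.

Lemma lspan_subspace (K : fieldType) (V : lmodType K) (S : set V) : subspace (lspan S).
Proof.
split; first by exists 0%N, (fun=> 0), (fun=> 0); rewrite big_ord0; split=> // -[].
move=> c _ _ [d [a [x [Sx ->]]]] [d' [a' [x' [Sx' ->]]]].
exists (d + d')%N, (fun k => match fintype.split k with inl k => c * a k | inr k => a' k end),
  (fun k => match fintype.split k with inl k => x k | inr k => x' k end).
split=> [k|]; first by case: (fintype.split k).
rewrite big_split_ord scaler_sumr; congr (_ + _); apply: eq_bigr => k _.
  by rewrite (unsplitK (inl k)) scalerA.
by rewrite (unsplitK (inr k)).
Qed.

Lemma lspan_sub (K : fieldType) (V : lmodType K) (S : set V) (T : V -> Prop) :
  subspace T -> (forall x, S x -> T x) -> forall x, lspan S x -> T x.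
Proof.
move=> sT ST x [d [a [b [Sb ->]]]]; apply: subspace_sum => // k.
by apply: subspaceZ => //; apply: ST.
Qed.

Lemma lspan_gen (K : fieldType) (V : lmodType K) (S : set V) x : S x -> lspan S x.
Proof.
move=> Sx; exists 1%N, (fun=> 1), (fun=> x); split=> //.
by rewrite big_ord1 scale1r.
Qed.

Lemma scalerAC (K : fieldType) (V : lmodType K) (c d : K) (x : V) :
  c *: (d *: x) = d *: (c *: x).
Proof. by rewrite !scalerA mulrC. Qed.

Lemma linear_map0 (K : fieldType) (V W : lmodType K) (h : V -> W) :
  linear h -> h 0 = 0.
Proof. by move=> lh; apply: (linear_on0 (subspaceT V)) => c x y _ _; exact: lh. Qed.

Lemma linear_mapZ (K : fieldType) (V W : lmodType K) (h : V -> W) (c : K) (x : V) :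
  linear h -> h (c *: x) = c *: h x.
Proof. by move=> lh; rewrite -[c *: x]addr0 lh linear_map0 // addr0. Qed.

(** * Skew derivations on functions of words *)

Section SkewDerivation.
Variables (K : fieldType) (I : eqType).
Implicit Types (a b : I -> K) (w : seq I).

(* The sum, over the occurrences [w = w1 ++ i :: w2] of [i] in [w], of
   [a(w1) b(w2) g (w1 ++ w2)], where [a] and [b] are extended to words
   multiplicatively. *)
Fixpoint skewd (V : lmodType K) a b i (g : seq I -> V) w : V :=
  if w is k :: w' then
    ((i == k)%:R * \prod_(h <- w') b h) *: g w'
      + a k *: skewd a b i (fun v => g (k :: v)) w'
  else 0.

Lemma eq_skewd (V : lmodType K) a b i (g g' : seq I -> V) :
  g =1 g' -> skewd a b i g =1 skewd a b i g'.
Proof. by move=> /funext ->. Qed.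

Lemma skewd_closed (V : lmodType K) (S : V -> Prop) a b i g w : subspace S ->
    (forall w1 w2, w = w1 ++ i :: w2 -> S (g (w1 ++ w2))) ->
  S (skewd a b i g w).
Proof.
move=> sS; elim: w g => [|k w IHw] g Sg /=; first by case: sS.
have Sw : S (a k *: skewd a b i (fun v => g (k :: v)) w).
  by apply: subspaceZ => //; apply: IHw => v1 v2 wE; apply: (Sg (k :: v1)); rewrite wE.
have [ik|_] := eqVneq i k; last by rewrite mul0r scale0r add0r.
by apply: (proj2 sS) => //; apply: (Sg [::]); rewrite ik.
Qed.

Lemma skewd_lin (V W : lmodType K) (S : V -> Prop) (h : V -> W) a b i g w :
    subspace S -> linear_on S h -> (forall v, S (g v)) ->
  h (skewd a b i g w) = skewd a b i (h \o g) w.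
Proof.
move=> sS hS; elim: w g => [|k w IHw] g Sg /=; first exact: (linear_on0 sS hS).
have Sk : S (skewd a b i (fun v => g (k :: v)) w) by exact: skewd_closed.
by rewrite hS ?(linear_onZ _ sS hS) ?IHw //; exact: subspaceZ.
Qed.

Section Linearity.
Variables (V : lmodType K) (a b : I -> K) (i : I).
Implicit Types (g : seq I -> V).

Lemma skewdP g g' c w :
  skewd a b i (fun v => c *: g v + g' v) w = c *: skewd a b i g w + skewd a b i g' w.
Proof.
elim: w g g' => [|k w IHw] g g' /=; first by rewrite scaler0 addr0.
rewrite IHw !scalerDr !scalerA addrACA; congr (_ + _); congr (_ *: _ + _ *: _);
  by rewrite mulrC ?mulrA.
Qed.

Lemma skewd0 w : skewd a b i (fun=> 0) w = 0 :> V.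
Proof. by elim: w => //= k w ->; rewrite !scaler0 addr0. Qed.

Lemma skewdZ g c w : skewd a b i (fun v => c *: g v) w = c *: skewd a b i g w.
Proof.
rewrite -[RHS]addr0 -[X in _ + X](skewd0 w) -skewdP.
by apply: eq_skewd => v; rewrite addr0.
Qed.

(** The two operators delete letters from different words, so both sides are the same double sum
    over the occurrences of i in w and of j in x. *)
Lemma skewd_exch a' b' j (G : seq I -> seq I -> V) w x :
  skewd a b i (fun w => skewd a' b' j (G w) x) w
  = skewd a' b' j (fun x => skewd a b i (G^~ x) w) x.
Proof.
elim: w G => [|k w IHw] G /=; last rewrite IHw.
  by elim: x => //= k x <-; rewrite !scaler0 addr0.
elim: x G {IHw} => [|h x IHx] G /=; first by rewrite !scaler0 addr0.
rewrite -(IHx (fun w x => G w (h :: x))).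
by rewrite !scalerDr !scalerA addrACA; congr (_ + _); congr (_ *: _ + _ *: _);
  rewrite mulrC ?mulrA.
Qed.

(** Each term omits exactly one letter i, so the weight of the full word is c i times the weight of
    the shortened word. *)
Lemma skewd_twist (c : I -> K) g w :
  c i *: skewd a b i (fun v => \prod_(h <- v) c h *: g v) w
  = \prod_(h <- w) c h *: skewd a b i g w.
Proof.
elim: w g => [|k w IHw] g /=; first by rewrite !scaler0.
rewrite !scalerDr !scalerA big_cons; congr (_ + _).
  have [->|_] := eqVneq i k; last by rewrite !mul0r !mulr0 mul0r !scale0r.
  by congr (_ *: _); ring.
have -> : skewd a b i (fun v => \prod_(h <- k :: v) c h *: g (k :: v)) w
    = c k *: skewd a b i (fun v => \prod_(h <- v) c h *: g (k :: v)) w.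
  by rewrite -skewdZ; apply: eq_skewd => v; rewrite big_cons scalerA.
rewrite scalerA -mulrA [c i * _]mulrC.
rewrite -[LHS]scalerA (IHw (fun v => g (k :: v))) !scalerA.
by congr (_ *: _); ring.
Qed.

End Linearity.

(** The definition unfolds at the first letter. Without suffix weights it also unfolds at the last
    letter, whose deletion carries the weight of everything before it. *)
Lemma skewd_rcons (V : lmodType K) a i (g : seq I -> V) w k :
  skewd a (fun=> 1) i g (rcons w k)
  = skewd a (fun=> 1) i (fun v => g (rcons v k)) w
    + ((i == k)%:R * \prod_(h <- w) a h) *: g w.
Proof.
elim: w g => [|h w IHw] g /=.
  by rewrite !big_nil scaler0 addr0 add0r.
rewrite IHw scalerDr addrA scalerA big_cons !big1_eq; congr (_ + _ *: _).
by rewrite mulrCA mulrA.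
Qed.

(** Both sides sum over pairs of deleted letters i and j. If i stands after j, neither deletion
    affects the weight of the other. If i stands before j, the left side has the extra factor a i,
    since i still belongs to the prefix of j, and the right side the extra factor b j, since j still
    belongs to the suffix of i. *)
Lemma skewd_comm (V : lmodType K) a b i j (g : seq I -> V) w : a i = b j ->
  skewd a (fun=> 1) j (skewd (fun=> 1) b i g) w
  = skewd (fun=> 1) b i (skewd a (fun=> 1) j g) w.
Proof.
move=> ab; elim: w g => [|k w IHw] g //=.
rewrite !big1_eq !mulr1 !scale1r.
have -> : skewd a (fun=> 1) j (fun v => ((i == k)%:R * \prod_(h <- v) b h) *: g v
      + 1 *: skewd (fun=> 1) b i (fun v => g (k :: v)) v) w
    = (i == k)%:R *: skewd a (fun=> 1) j (fun v => \prod_(h <- v) b h *: g v) w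
      + skewd (fun=> 1) b i (skewd a (fun=> 1) j (fun v => g (k :: v))) w.
  by rewrite -IHw -skewdP; apply: eq_skewd => v; rewrite scale1r scalerA.
have -> : skewd (fun=> 1) b i (fun v => ((j == k)%:R * \prod_(h <- v) 1) *: g v
      + a k *: skewd a (fun=> 1) j (fun v => g (k :: v)) v) w
    = (j == k)%:R *: skewd (fun=> 1) b i g w
      + a k *: skewd (fun=> 1) b i (skewd a (fun=> 1) j (fun v => g (k :: v))) w.
  by rewrite -[X in _ + X]skewdZ -skewdP; apply: eq_skewd => v; rewrite big1_eq mulr1.
rewrite scalerDr addrA [RHS]addrCA addrA; congr (_ + _ + _).
have [<-|_] := eqVneq i k; last by rewrite !mul0r !scale0r scaler0.
by rewrite scale1r mul1r ab skewd_twist.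
Qed.

End SkewDerivation.

(** * Degrees of words and heights in the weight lattice *)

Section Lattice.
Variable l : nat.
Implicit Types (x y z : Lam l) (w : seq 'I_l).

Lemma dotDr x y z : dot x (y + z) = dot x y + dot x z.
Proof. by rewrite /dot -big_split; apply: eq_bigr => i _; rewrite !mxE mulrDr. Qed.

Lemma dot0r x : dot x 0 = 0.
Proof. by rewrite /dot big1 // => i _; rewrite mxE mulr0. Qed.

Definition degree w : Lam l := \sum_(i <- w) alpha i.

Lemma degree_cons i w : degree (i :: w) = alpha i + degree w.
Proof. exact: big_cons. Qed.

Lemma degree_rcons w i : degree (rcons w i) = alpha i + degree w.
Proof. by rewrite /degree -cats1 big_cat big_seq1 addrC. Qed.

Lemma degree_remove w1 w2 i :
  degree (w1 ++ w2) = degree (w1 ++ i :: w2) - alpha i.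
Proof. by rewrite /degree !big_cat big_cons /= addrCA addrAC subrr add0r. Qed.

Lemma Qplus_addalpha z i : Qplus z -> Qplus (alpha i + z).
Proof.
move=> [a ->]; exists (fun j => (j == i) + a j)%N.
under [RHS]eq_bigr => j _ do rewrite mulrnDr.
rewrite big_split; congr (_ + _).
by rewrite (bigD1 i) //= eqxx big1 ?addr0 // => j /negPf ->.
Qed.

Lemma degree_Qplus w : Qplus (degree w).
Proof.
elim: w => [|i w IHw]; last by rewrite degree_cons; exact: Qplus_addalpha.
by exists (fun=> 0%N); rewrite /degree big_nil big1 // => j _; rewrite mulr0n.
Qed.

(** The functional with value 1 on every simple root, so that the degree of a word determines its
    length. The sign compensates for the index growing by one from the positive to the negative term
    of alpha_j. *)
Definition height (z : Lam l) : int := - \sum_(i < l.+1) (i : nat)%:Z * z 0 i.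

Lemma heightD y z : height (y + z) = height y + height z.
Proof.
rewrite /height -opprD -big_split; congr (- _); apply: eq_bigr => i _.
by rewrite mxE mulrDr.
Qed.

Lemma height_alpha j : height (alpha j) = 1.
Proof.
rewrite /height; suff -> : \sum_(i < l.+1) (i : nat)%:Z * (alpha j) 0 i = -1 by rewrite opprK.
have E (h : 'I_l.+1) : \sum_(i < l.+1) (i : nat)%:Z * (eps h) 0 i = h%:Z.
  rewrite (bigD1 h) //= big1 => [|k /negPf kh]; last by rewrite mxE kh andbF mulr0.
  by rewrite mxE !eqxx mulr1 addr0.
under eq_bigr => i _ do rewrite !mxE mulrBr -[X in X - _]/(_ * _).
transitivity (j%:Z - (bump 0 j)%:Z).
  rewrite -[X in X - _](E (lo j)) -[X in _ - X](E (hi j)) -sumrB.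
  by apply: eq_bigr => i _; rewrite !mxE.
by rewrite /bump leq0n PoszD opprD addrCA subrr addr0.
Qed.

Lemma height_degree w : height (degree w) = size w.
Proof.
elim: w => [|j w IHw].
  by rewrite /degree big_nil /height big1 ?oppr0 // => i _; rewrite mxE mulr0.
by rewrite degree_cons heightD height_alpha IHw.
Qed.

Lemma height0 : height 0 = 0.
Proof. by rewrite /height big1 ?oppr0 // => i _; rewrite mxE mulr0. Qed.

Lemma height_Qplus z : Qplus z -> exists k : nat, height z = k.
Proof.
move=> [a ->]; elim/big_rec: _ => [|j x _ [k xk]]; first by exists 0%N; exact: height0.
exists (a j + k)%N; rewrite heightD xk PoszD; congr (_ + _).
elim: (a j) => [|m IHm]; first exact: height0.
by rewrite mulrS heightD height_alpha IHm.
Qed.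

End Lattice.

(** * Words in the e_i and f_i, and their coproducts *)

Section Words.
Variables (K : fieldType) (l : nat) (q : qparam K).
Local Notation r := (qr q).
Local Notation s := (qs q).
Local Notation U := (Ugl l q).
Local Notation Ue := (@Ue K l q).
Local Notation Uf := (@Uf K l q).
Local Notation omega := (@omega K l q).
Local Notation omega' := (@omega' K l q).
Local Notation wt := (@wt K l q).

Definition eword (w : seq 'I_l) : U := \prod_(i <- w) Ue i.
Definition fword (w : seq 'I_l) : U := \prod_(i <- w) Uf i.

Lemma gen_subalg_subspace (S : set U) : subspace (gen_subalg S).
Proof.
split; first by rewrite -(scale0r (1 : U)); exact: gs_scal.
move=> c x y Sx Sy; apply: gs_add => //.
by rewrite -mulr_algl; apply: gs_mul => //; exact: gs_scal.
Qed.

Lemma gen_subalg1 (S : set U) : gen_subalg S 1.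
Proof. by rewrite -(scale1r (1 : U)); exact: gs_scal. Qed.

Lemma Balg_e j : Balg (Ue j).
Proof. by apply: gs_gen; left; exists j. Qed.

Lemma Balg_omega j : Balg (omega j).
Proof. by apply: gs_gen; right; left; exists j; left. Qed.

Lemma B'alg_f j : B'alg (Uf j).
Proof. by apply: gs_gen; left; exists j. Qed.

Lemma B'alg_omega' j : B'alg (omega' j).
Proof. by apply: gs_gen; right; left; exists j; left. Qed.

Lemma Balg_eword w : Balg (eword w).
Proof.
by apply: big_ind => [|x y|i _]; [exact: gen_subalg1|exact: gs_mul|exact: Balg_e].
Qed.

Lemma B'alg_fword w : B'alg (fword w).
Proof.
by apply: big_ind => [|x y|i _]; [exact: gen_subalg1|exact: gs_mul|exact: B'alg_f].
Qed.

Lemma eword_nil : eword [::] = 1. Proof. exact: big_nil. Qed.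

Lemma fword_nil : fword [::] = 1. Proof. exact: big_nil. Qed.

Lemma eword_cons i w : eword (i :: w) = Ue i * eword w.
Proof. exact: big_cons. Qed.

Lemma fword_cons i w : fword (i :: w) = Uf i * fword w.
Proof. exact: big_cons. Qed.

Lemma eword_rcons w i : eword (rcons w i) = eword w * Ue i.
Proof. by rewrite /eword -cats1 big_cat big_seq1. Qed.

Lemma fword_rcons w i : fword (rcons w i) = fword w * Uf i.
Proof. by rewrite /fword -cats1 big_cat big_seq1. Qed.

Lemma counitM (x y : U) : counit (x * y) = counit x * counit y.
Proof. exact: (pevalM (@counit_rel K l q)). Qed.

Lemma counit1 : counit (1 : U) = 1.
Proof. exact: (peval1 (@counit_rel K l q)). Qed.

Lemma counit_e j : counit (Ue j) = 0.
Proof. exact: (peval_gen (@counit_rel K l q)). Qed.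

Lemma counit_torus (x : glgen l) : is_torus x -> counit (ugen q x) = 1.
Proof. by move=> tx; rewrite /counit (peval_gen (@counit_rel K l q)) /counit_gen tx. Qed.

Lemma counit_omega j : counit (omega j) = 1.
Proof. by rewrite counitM !counit_torus // mulr1. Qed.

(** The axioms of [hopf_pairing] take a coproduct as a list of pairs with entries in the subalgebra;
    this list multiplies out the factors e_k ⊗ 1 + omega_k ⊗ e_k. *)
Fixpoint eword_comul (w : seq 'I_l) : seq (U * U) :=
  if w is k :: w' then
    [seq (Ue k * p.1, p.2) | p <- eword_comul w']
      ++ [seq (omega k * p.1, Ue k * p.2) | p <- eword_comul w']
  else [:: (1, 1)].

Lemma comul_e j : comul (Ue j) = Ue j ⊗ 1 + omega j ⊗ Ue j.
Proof. exact: comul_gen_eq. Qed.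

Lemma comul_f j : comul (Uf j) = 1 ⊗ Uf j + Uf j ⊗ omega' j.
Proof. exact: comul_gen_eq. Qed.

Lemma comul_torus (x : glgen l) : is_torus x -> comul (ugen q x) = ugen q x ⊗ ugen q x.
Proof. by case: x => // x _; exact: comul_gen_eq. Qed.

Lemma comul_eword w : comul (eword w) = \sum_(p <- eword_comul w) p.1 ⊗ p.2.
Proof.
elim: w => [|k w IHw]; first by rewrite /eword big_nil comul1 big_seq1.
rewrite eword_cons comulM IHw comul_e mulrDl big_cat !big_map !mulr_sumr.
by congr (_ + _); apply: eq_bigr => p _; rewrite [LHS]tpureM ?mul1r.
Qed.

Lemma eword_comul_Balg w p : p \in eword_comul w -> Balg p.1 /\ Balg p.2.
Proof.
elim: w p => [|k w IHw] p.
  by rewrite inE => /eqP ->; split; exact: gen_subalg1.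
rewrite mem_cat => /orP[] /mapP[p' /IHw[B1 B2] ->]; split=> //; apply: gs_mul => //.
- exact: Balg_e.
- exact: Balg_omega.
- exact: Balg_e.
Qed.

(** The counit kills every e_k, so the only pair that survives is the one in which each factor
    contributes omega_k ⊗ e_k. *)
Lemma counit_eword_comul w (g : U -> K) :
  \sum_(p <- eword_comul w) counit p.1 * g p.2 = g (eword w).
Proof.
elim: w g => [|k w IHw] g; first by rewrite big_seq1 counit1 mul1r /eword big_nil.
rewrite big_cat !big_map /= [X in X + _]big1 => [|p _].
  rewrite add0r eword_cons -(IHw (fun x => g (Ue k * x))).
  by apply: eq_bigr => p _; rewrite counitM counit_omega mul1r.
by rewrite counitM counit_e !mul0r.
Qed.

(** * The pairing of two words *)

Section Pairing.
Variables (pr : U -> U -> K) (hpr : hopf_pairing pr).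

Lemma pairing_linl y : Balg y -> linear_on (@B'alg K l q) (pr^~ y : U -> K^o).
Proof. by move=> By c x x' Bx Bx'; exact: (pair_linl hpr). Qed.

Lemma pairing_linr x : B'alg x -> linear_on (@Balg K l q) (pr x : U -> K^o).
Proof. by move=> Bx c y y' By By'; exact: (pair_linr hpr). Qed.

(** Pairing with f_j is a skew derivation, because the opposite coproduct of f_j is f_j ⊗ 1 +
    omega'_j ⊗ f_j. *)
Lemma pair_fM j y z : Balg y -> Balg z ->
  pr (Uf j) (y * z) = pr (Uf j) y * counit z + pr (omega' j) y * pr (Uf j) z.
Proof.
move=> By Bz; rewrite (pair_mulr hpr (xs := [:: (1, Uf j); (Uf j, omega' j)])) //.
- by rewrite big_cons big_seq1 /= (pair_1l hpr).
- exact: B'alg_f.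
- move=> p; rewrite !inE => /orP[] /eqP -> /=; split;
    by [exact: gen_subalg1|exact: B'alg_f|exact: B'alg_omega'].
- by rewrite big_cons big_seq1 comul_f.
Qed.

Local Notation c := ((s - r)^-1).

(** Only the pairs whose left leg received e_j from one position and omega_k from all others
    contribute. The omega_k before that position give (omega'_j, omega_k) = wt k j, those after it
    give their counit 1, and the right leg is the word without that letter. *)
Lemma pair_f_eword_comul j w (g : U -> K) :
  \sum_(p <- eword_comul w) pr (Uf j) p.1 * g p.2
  = c * skewd (wt^~ j) (fun=> 1) j (fun v => g (eword v) : K^o) w.
Proof.
elim: w g => [|k w IHw] g.
  by rewrite big_seq1 (pair_1r hpr) ?[counit _](peval_gen (@counit_rel K l q)) ?mul0r ?mulr0 //;
    exact: B'alg_f.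
rewrite big_cat !big_map /= mulrDr; congr (_ + _).
  rewrite big1_eq mulr1 -(counit_eword_comul w g) mulrA mulr_sumr.
  rewrite !big_seq; apply: eq_bigr => p /eword_comul_Balg[B1 B2].
  rewrite pair_fM //; last exact: Balg_e.
  rewrite (pair_f_e hpr) (pair_torus_e hpr) ?mul0r ?addr0; last by left; exists j; left.
  by rewrite mulrA [c * _]mulrC.
rewrite mulrCA; under [in RHS]eq_skewd => v do rewrite eword_cons.
rewrite -(IHw (fun x => g (Ue k * x))) mulr_sumr.
rewrite !big_seq; apply: eq_bigr => p /eword_comul_Balg[B1 B2].
rewrite pair_fM //; last exact: Balg_omega.
rewrite (pair_f_torus hpr) ?mul0r ?add0r; last by left; exists k; left.
have [-> _ _ _] := pair_omega hpr j k.
by rewrite mulrA.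
Qed.

Definition wpair (w x : seq 'I_l) : K^o := pr (fword w) (eword x).

Lemma wpair_cons j w x :
  wpair (j :: w) x = c *: skewd (wt^~ j) (fun=> 1) j (wpair w) x.
Proof.
rewrite /wpair fword_cons (pair_mull hpr (zs := eword_comul x)) ?pair_f_eword_comul //.
- exact: B'alg_f.
- exact: B'alg_fword.
- exact: Balg_eword.
- exact: eword_comul_Balg.
- exact: comul_eword.
Qed.

Lemma wpair_nil x : wpair [::] x = (x == [::])%:R.
Proof.
rewrite /wpair /fword big_nil (pair_1l hpr); last exact: Balg_eword.
case: x => [|k x]; first by rewrite /eword big_nil counit1.
by rewrite eword_cons counitM counit_e mul0r.
Qed.

(* Both sides vanish unless [w] and [x] have the same degree. *)
Lemma wpair_twist (a : 'I_l -> K) w x :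
  \prod_(h <- x) a h *: wpair w x = \prod_(h <- w) a h *: wpair w x.
Proof.
elim: w x => [|j w IHw] x.
  by rewrite wpair_nil; case: x => [|k x] //; rewrite !scaler0.
rewrite wpair_cons big_cons scalerAC [RHS]scalerAC; congr (_ *: _).
rewrite -skewd_twist.
under eq_skewd => v do rewrite IHw.
by rewrite skewdZ scalerA.
Qed.

(** Left multiplication by e_i is adjoint to a skew derivation of f-words. In the induction the
    first letter j of w either meets this e_i or is matched inside x; in the second case two
    derivations act on different words, and [skewd_exch] applies. *)
Lemma wpair_consr i w x :
  wpair w (i :: x) = c *: skewd (wt i) (fun=> 1) i (wpair^~ x) w.
Proof.
elim: w x => [|j w IHw] x; first by rewrite wpair_nil [_ == _]/= mulr0n [RHS]mulr0.
rewrite wpair_cons /= !big1_eq !mulr1 eq_sym; congr (_ *: (_ + _ *: _)).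
under eq_skewd => v do rewrite IHw.
under [in RHS]eq_skewd => v do rewrite wpair_cons.
by rewrite !skewdZ skewd_exch.
Qed.

(** As for [wpair_consr], except that when j meets the final e_i the left side carries the weight of
    x and the right side the same weight of w; [wpair_twist] identifies them. *)
Lemma wpair_rconsr i w x :
  wpair w (rcons x i) = c *: skewd (fun=> 1) (wt^~ i) i (wpair^~ x) w.
Proof.
elim: w x => [|j w IHw] x; first by rewrite wpair_nil [RHS]scaler0; case: x.
rewrite wpair_cons skewd_rcons /=; congr (_ *: _).
rewrite addrC scale1r [j == i]eq_sym; congr (_ + _).
  have [->|_] := eqVneq i j; last by rewrite !mul0r !scale0r.
  by rewrite !mul1r; exact: wpair_twist.
under eq_skewd => v do rewrite IHw.
under [in RHS]eq_skewd => v do rewrite wpair_cons.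
by rewrite !skewdZ skewd_exch.
Qed.

(** Here both derivations act on x, one with prefix weights wt h j and one with suffix weights wt i
    h. The condition of [skewd_comm] holds because both critical weights are wt i j. *)
Lemma wpair_rconsl i w x :
  wpair (rcons w i) x = c *: skewd (fun=> 1) (wt i) i (wpair w) x.
Proof.
elim: w x => [|j w IHw] x; last first.
  rewrite rcons_cons !wpair_cons.
  under eq_skewd => v do rewrite IHw.
  under [in RHS]eq_skewd => v do rewrite wpair_cons.
  by rewrite !skewdZ skewd_comm.
rewrite wpair_cons; congr (_ *: _).
case: x => [|k x] //=.
have Z a b : skewd a b i (fun v => wpair [::] (k :: v)) x = 0.
  by under eq_skewd => v do rewrite wpair_nil; exact: skewd0.
by rewrite !Z !scaler0 wpair_nil; case: x {Z} => [|h x]; rewrite ?big_nil ?scaler0.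
Qed.

End Pairing.

(** * Graded pieces of U^+ and U^-, and commutators of words with generators *)

Implicit Types (z : Lam l) (w : seq 'I_l) (x y : U).

Lemma Uplus_eword w : Uplus (degree w) (eword w).
Proof. by apply: lspan_gen; exists w. Qed.

Lemma Uminus_fword w : Uminus (degree w) (fword w).
Proof. by apply: lspan_gen; exists w. Qed.

Lemma Uplus_ind z (T : U -> Prop) : subspace T ->
  (forall w, degree w = z -> T (eword w)) -> forall x, Uplus z x -> T x.
Proof. by move=> sT Tw; apply: lspan_sub => // _ [w wz ->]; exact: Tw. Qed.

Lemma Uminus_ind z (T : U -> Prop) : subspace T ->
  (forall w, degree w = z -> T (fword w)) -> forall x, Uminus z x -> T x.
Proof. by move=> sT Tw; apply: lspan_sub => // _ [w wz ->]; exact: Tw. Qed.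

Lemma Uplus_Balg z x : Uplus z x -> Balg x.
Proof.
by apply: Uplus_ind x => [|w _]; [exact: gen_subalg_subspace|exact: Balg_eword].
Qed.

Lemma Uminus_B'alg z x : Uminus z x -> B'alg x.
Proof.
by apply: Uminus_ind x => [|w _]; [exact: gen_subalg_subspace|exact: B'alg_fword].
Qed.

Lemma wt_neq0 i j : wt i j != 0.
Proof. by rewrite mulf_neq0 // expfz_neq0 // ?qr_neq0 ?qs_neq0. Qed.

Lemma omega'_fword i w :
  omega' i * fword w = \prod_(h <- w) wt h i *: (fword w * omega' i).
Proof.
elim: w => [|j w IHw]; first by rewrite /fword !big_nil mulr1 mul1r scale1r.
rewrite fword_cons big_cons mulrA omega'_f wtV invrK -scalerAl -[in LHS]mulrA IHw.
by rewrite -scalerAr scalerA mulrA.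
Qed.

Lemma omega_eword i w :
  omega i * eword w = \prod_(h <- w) wt i h *: (eword w * omega i).
Proof.
elim: w => [|j w IHw]; first by rewrite /eword !big_nil mulr1 mul1r scale1r.
rewrite eword_cons big_cons mulrA omega_e -scalerAl -[in LHS]mulrA IHw.
by rewrite -scalerAr scalerA mulrA.
Qed.

Lemma skewd_mull (x : U) a b i (g : seq 'I_l -> U) w :
  skewd a b i (fun v => x * g v) w = x * skewd a b i g w.
Proof.
rewrite (skewd_lin (S := fun=> True) (h := *%R x)) //.
by move=> c y z _ _; rewrite mulrDr scalerAr.
Qed.

(** By the Leibniz rule each letter f_i is replaced in turn by (omega'_i - omega_i) / (s - r).
    Moving omega'_i to the far right past f_h produces wt h i, and moving omega_i to the far left
    past f_h produces wt i h; these are the weights of the two derivations. *)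
Lemma commutator_e_fword i w :
  Ue i * fword w - fword w * Ue i
  = (s - r)^-1 *: (skewd (fun=> 1) (wt^~ i) i fword w * omega' i
                   - omega i * skewd (wt i) (fun=> 1) i fword w).
Proof.
elim: w => [|j w IHw].
  by rewrite /fword big_nil mul1r mulr1 subrr mul0r mulr0 subrr scaler0.
rewrite fword_cons /= big1_eq mulr1 scale1r.
under eq_skewd => v do rewrite fword_cons.
under [X in omega i * (_ + _ *: X)]eq_skewd => v do rewrite fword_cons.
rewrite !skewd_mull.
move: IHw; set A := skewd (wt i) _ _ _ _; set B := skewd _ _ _ _ _ => IHw.
have -> : Ue i * (Uf j * fword w) - Uf j * fword w * Ue i
    = (Ue i * Uf j - Uf j * Ue i) * fword w + Uf j * (Ue i * fword w - fword w * Ue i).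
  by rewrite mulrBl mulrBr !mulrA addrA subrK.
rewrite IHw Uef [in RHS]mulrDl [in RHS]mulrDr opprD addrACA [RHS]scalerDr; congr (_ + _).
  rewrite -[r - s]opprB invrN mulrN -scalerAl mulrBl omega'_fword.
  rewrite -[in RHS]scalerAl -[in RHS]scalerAr scaleNr -scalerN opprB !scalerBr !scalerA.
  by congr (_ *: _ - _ *: _); ring.

rewrite -[LHS]scalerAr mulrBr; congr (_ *: (_ - _)); first exact: mulrA.
rewrite -[RHS]scalerAr [X in _ = _ *: X]mulrA omega_f -[in RHS]scalerAl scalerA.
by rewrite divff ?wt_neq0 // scale1r mulrA.
Qed.

(** The mirror image: omega_i now moves to the right with suffix weights wt i h, and omega'_i to the
    left with prefix weights wt h i. *)
Lemma commutator_f_eword i w :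
  Uf i * eword w - eword w * Uf i
  = (s - r)^-1 *: (skewd (fun=> 1) (wt i) i eword w * omega i
                   - omega' i * skewd (wt^~ i) (fun=> 1) i eword w).
Proof.
elim: w => [|j w IHw].
  by rewrite /eword big_nil mul1r mulr1 subrr mul0r mulr0 subrr scaler0.
rewrite eword_cons /= big1_eq mulr1 scale1r.
under eq_skewd => v do rewrite eword_cons.
under [X in omega' i * (_ + _ *: X)]eq_skewd => v do rewrite eword_cons.
rewrite !skewd_mull.
move: IHw; set A := skewd _ (wt i) _ _ _; set B := skewd _ _ _ _ _ => IHw.
have -> : Uf i * (Ue j * eword w) - Ue j * eword w * Uf i
    = (Uf i * Ue j - Ue j * Uf i) * eword w + Ue j * (Uf i * eword w - eword w * Uf i).
  by rewrite mulrBl mulrBr !mulrA addrA subrK.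
rewrite IHw -[X in X * eword w]opprB Uef [in RHS]mulrDl [in RHS]mulrDr opprD addrACA.
rewrite [RHS]scalerDr; congr (_ + _).
  rewrite -[r - s]opprB invrN mulrN scaleNr opprK eq_sym -scalerAl mulrBl omega_eword.
  rewrite -[in RHS]scalerAl -[in RHS]scalerAr !scalerBr !scalerA.
  by have [<-|_] := eqVneq i j; rewrite ?(mulr0n, mul0r, mulr0, scale0r) //;
    congr (_ *: _ - _ *: _); ring.
rewrite -[LHS]scalerAr mulrBr; congr (_ *: (_ - _)); first exact: mulrA.
rewrite -[RHS]scalerAr [X in _ = _ *: X]mulrA omega'_e -[in RHS]scalerAl scalerA.
by rewrite wtV divff ?wt_neq0 // scale1r mulrA.
Qed.

End Words.

(** * Sums and signs in pure tensors *)

Section TensorTheory.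
Variables (K : fieldType) (V W : lmodType K).

Lemma tpure0l (w : W) : (0 : V) ⊗ w = 0.
Proof. by rewrite -(scale0r (0 : V)) tpureZl scale0r. Qed.

Lemma tpure0r (v : V) : v ⊗ (0 : W) = 0.
Proof. by rewrite -(scale0r (0 : W)) tpureZr scale0r. Qed.

Lemma tpureNl (v : V) (w : W) : (- v) ⊗ w = - (v ⊗ w).
Proof. by rewrite -scaleN1r tpureZl scaleN1r. Qed.

Lemma tpureNr (v : V) (w : W) : v ⊗ (- w) = - (v ⊗ w).
Proof. by rewrite -scaleN1r tpureZr scaleN1r. Qed.

Lemma tpure_suml I (s : seq I) (f : I -> V) (w : W) :
  (\sum_(i <- s) f i) ⊗ w = \sum_(i <- s) f i ⊗ w.
Proof.
by elim: s => [|i s IHs]; rewrite ?big_nil ?tpure0l // !big_cons tpureDl IHs.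
Qed.

Lemma tpure_sumr I (s : seq I) (v : V) (f : I -> W) :
  v ⊗ (\sum_(i <- s) f i) = \sum_(i <- s) v ⊗ f i.
Proof.
by elim: s => [|i s IHs]; rewrite ?big_nil ?tpure0r // !big_cons tpureDr IHs.
Qed.

End TensorTheory.

(** * Adjoints of multiplication by generators *)

Section CanonicalElement.
Variables (K : fieldType) (l : nat) (q : qparam K).
Local Notation r := (qr q).
Local Notation s := (qs q).
Local Notation U := (Ugl l q).
Local Notation T := (tensor U U).
Local Notation Ue := (@Ue K l q).
Local Notation Uf := (@Uf K l q).
Local Notation omega := (@omega K l q).
Local Notation omega' := (@omega' K l q).
Local Notation wt := (@wt K l q).
Local Notation eword := (@eword K l q).
Local Notation fword := (@fword K l q).
Variables (pr : U -> U -> K) (hpr : hopf_pairing pr).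
Implicit Types (x y : U) (z : Lam l) (w : seq 'I_l).
Local Notation c := ((s - r)^-1).

Lemma Uplus_subspace z : subspace (@Uplus K l q z).
Proof. exact: lspan_subspace. Qed.

Lemma Uminus_subspace z : subspace (@Uminus K l q z).
Proof. exact: lspan_subspace. Qed.

Lemma Balg_subspace : subspace (@Balg K l q).
Proof. exact: gen_subalg_subspace. Qed.

Lemma B'alg_subspace : subspace (@B'alg K l q).
Proof. exact: gen_subalg_subspace. Qed.

Let sP := Uplus_subspace.
Let sM := Uminus_subspace.
Let sB := Balg_subspace.
Let sB' := B'alg_subspace.

Lemma Uplus_mulel z i x : Uplus (z - alpha i) x -> Uplus z (Ue i * x).
Proof.
move: x; apply: Uplus_ind => [|w wz].
  split=> [|a x x' Ux Ux']; first by rewrite mulr0; case: (sP z).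
  by rewrite mulrDr -scalerAr; apply: (proj2 (sP _)).
suff <- : degree (i :: w) = z by rewrite -eword_cons; exact: Uplus_eword.
by rewrite degree_cons wz addrC subrK.
Qed.

Lemma Uplus_muler z i x : Uplus (z - alpha i) x -> Uplus z (x * Ue i).
Proof.
move: x; apply: Uplus_ind => [|w wz].
  split=> [|a x x' Ux Ux']; first by rewrite mul0r; case: (sP z).
  by rewrite mulrDl -scalerAl; apply: (proj2 (sP _)).
suff <- : degree (rcons w i) = z by rewrite -eword_rcons; exact: Uplus_eword.
by rewrite degree_rcons wz addrC subrK.
Qed.

Lemma Uminus_mulfl z i y : Uminus (z - alpha i) y -> Uminus z (Uf i * y).
Proof.
move: y; apply: Uminus_ind => [|w wz].
  split=> [|a x x' Ux Ux']; first by rewrite mulr0; case: (sM z).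
  by rewrite mulrDr -scalerAr; apply: (proj2 (sM _)).
suff <- : degree (i :: w) = z by rewrite -fword_cons; exact: Uminus_fword.
by rewrite degree_cons wz addrC subrK.
Qed.

Lemma Uminus_mulfr z i y : Uminus (z - alpha i) y -> Uminus z (y * Uf i).
Proof.
move: y; apply: Uminus_ind => [|w wz].
  split=> [|a x x' Ux Ux']; first by rewrite mul0r; case: (sM z).
  by rewrite mulrDl -scalerAl; apply: (proj2 (sM _)).
suff <- : degree (rcons w i) = z by rewrite -fword_rcons; exact: Uminus_fword.
by rewrite degree_rcons wz addrC subrK.
Qed.

Lemma pair_skewd_fword a b i w (x : seq 'I_l) :
  pr (c *: skewd a b i fword w) (eword x) = c *: skewd a b i ((wpair pr)^~ x) w.
Proof.
have lin := pairing_linl hpr (Balg_eword q x).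
rewrite [LHS](linear_onZ _ sB' lin); last first.
  by apply: skewd_closed => // w1 w2 _; exact: B'alg_fword.
by rewrite (skewd_lin _ _ _ _ sB' lin) // => v; exact: B'alg_fword.
Qed.

Lemma pair_skewd_eword a b i w (x : seq 'I_l) :
  pr (fword w) (c *: skewd a b i eword x) = c *: skewd a b i (wpair pr w) x.
Proof.
have lin := pairing_linr hpr (B'alg_fword q w).
rewrite [LHS](linear_onZ _ sB lin); last first.
  by apply: skewd_closed => // w1 w2 _; exact: Balg_eword.
by rewrite (skewd_lin _ _ _ _ sB lin) // => v; exact: Balg_eword.
Qed.

Let BalgZ a x x' : Balg x -> Balg x' -> Balg (a *: x + x').
Proof. exact: (proj2 (gen_subalg_subspace _)). Qed.

Let B'algZ a y y' : B'alg y -> B'alg y' -> B'alg (a *: y + y').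
Proof. exact: (proj2 (gen_subalg_subspace _)). Qed.

Lemma pair_ext_Uplus y y' (phi : U -> U) :
    B'alg y -> B'alg y' -> linear_on (fun=> True) phi ->
    (forall w, Balg (phi (eword w))) ->
    (forall w, pr y (eword w) = pr y' (phi (eword w))) ->
  forall z x, Uplus z x -> pr y x = pr y' (phi x).
Proof.
move=> By By' linphi Bphi eqw z x.
(* The memberships are carried through the induction because the pairing is linear only inside
   [Balg]. *)
suff: Uplus z x -> [/\ Balg x, Balg (phi x) & pr y x = pr y' (phi x)] by move=> xP /xP[].
move: x; apply: Uplus_ind => [|w _]; last by split=> //; exact: Balg_eword.
have B0 : Balg (0 : U) by case: sB.
split=> [|a x x' [Bx Bpx xE] [Bx' Bpx' x'E]].
  rewrite (linear_on0 (subspaceT _) linphi); split=> //.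
  by rewrite !(linear_on0 sB (pairing_linr hpr _)).
rewrite linphi // !(pair_linr hpr) // xE x'E.
by split=> //; exact: BalgZ.
Qed.

Lemma pair_ext_Uminus x x' (phi : U -> U) :
    Balg x -> Balg x' -> linear_on (fun=> True) phi ->
    (forall w, B'alg (phi (fword w))) ->
    (forall w, pr (fword w) x = pr (phi (fword w)) x') ->
  forall z y, Uminus z y -> pr y x = pr (phi y) x'.
Proof.
move=> Bx Bx' linphi Bphi eqw z y.
suff: Uminus z y -> [/\ B'alg y, B'alg (phi y) & pr y x = pr (phi y) x'] by move=> yP /yP[].
move: y; apply: Uminus_ind => [|w _]; last by split=> //; exact: B'alg_fword.
have B0 : B'alg (0 : U) by case: sB'.
split=> [|a y y' [By Bpy yE] [By' Bpy' y'E]].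
  rewrite (linear_on0 (subspaceT _) linphi); split=> //.
  rewrite [LHS](linear_on0 sB' (pairing_linl hpr Bx)).
  by rewrite [RHS](linear_on0 sB' (pairing_linl hpr Bx')).
rewrite linphi // !(pair_linl hpr) // yE y'E.
by split=> //; exact: B'algZ.
Qed.

Let mulr_lin x : linear_on (fun=> True) (fun y => y * x).
Proof. by move=> a y y' _ _; rewrite mulrDl scalerAl. Qed.

Let mull_lin x : linear_on (fun=> True) (fun y => x * y).
Proof. by move=> a y y' _ _; rewrite mulrDr scalerAr. Qed.

(** A and B are the two skew derivatives of y with the factor (s - r)^-1 absorbed. The whole list of
    properties passes to linear combinations, so it suffices to exhibit A and B for words. *)
Lemma commutator_e z i y : Uminus z y -> exists A B : U,
  [/\ Uminus (z - alpha i) A, Uminus (z - alpha i) B,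
      Ue i * y - y * Ue i = B * omega' i - omega i * A,
      forall z' x, Uplus z' x -> pr A x = pr y (Ue i * x)
    & forall z' x, Uplus z' x -> pr B x = pr y (x * Ue i)].
Proof.
move=> Uy.
(* With [B'alg y] included the claim is a subspace condition on y: linearity of the pairing needs
   this membership for both summands. *)
suff [] : B'alg y /\ exists A B : U,
  [/\ Uminus (z - alpha i) A, Uminus (z - alpha i) B,
      Ue i * y - y * Ue i = B * omega' i - omega i * A,
      forall z' x, Uplus z' x -> pr A x = pr y (Ue i * x)
    & forall z' x, Uplus z' x -> pr B x = pr y (x * Ue i)] by [].
move: y Uy; apply: Uminus_ind => [|w wz].
  split; first split.
  - by case: sB'.
  - exists 0, 0; split; try by case: (sM (z - alpha i)).
    + by rewrite mulr0 !mul0r mulr0.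
    + move=> z' x Ux; rewrite [LHS](linear_on0 sB' (pairing_linl hpr _));
        last exact: Uplus_Balg Ux.
      rewrite [RHS](linear_on0 sB' (pairing_linl hpr _)) //.
      by apply: gs_mul; [exact: Balg_e|exact: Uplus_Balg Ux].
    + move=> z' x Ux; rewrite [LHS](linear_on0 sB' (pairing_linl hpr _));
        last exact: Uplus_Balg Ux.
      rewrite [RHS](linear_on0 sB' (pairing_linl hpr _)) //.
      by apply: gs_mul; [exact: Uplus_Balg Ux|exact: Balg_e].
  move=> a y y' [By [A [B [UA UB eAB pA pB]]]] [By' [A' [B' [UA' UB' eAB' pA' pB']]]].
  split; first exact: B'algZ.
  exists (a *: A + A'), (a *: B + B'); split.
  - exact: (proj2 (sM _)).
  - exact: (proj2 (sM _)).
  - rewrite !mulrDl !mulrDr -!scalerAl -!scalerAr !opprD addrACA -scalerBr eAB eAB'.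
    by rewrite [RHS]addrACA scalerBr.
  - move=> z' x Ux; have Bx := Uplus_Balg Ux; have Bex := gs_mul (Balg_e q i) Bx.
    by rewrite !(pair_linl hpr) ?(pA z') ?(pA' z') //;
      exact: Uminus_B'alg UA || exact: Uminus_B'alg UA'.
  - move=> z' x Ux; have Bx := Uplus_Balg Ux; have Bex := gs_mul Bx (Balg_e q i).
    by rewrite !(pair_linl hpr) ?(pB z') ?(pB' z') //;
      exact: Uminus_B'alg UB || exact: Uminus_B'alg UB'.
have UA a b : Uminus (z - alpha i) (c *: skewd a b i fword w).
  apply: subspaceZ => //; apply: skewd_closed => // w1 w2 wE.
  by rewrite -wz wE -degree_remove; exact: Uminus_fword.
split; first exact: B'alg_fword.
(* The commutator and the adjointness formulas [wpair_consr], [wpair_rconsr] involve the same two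
   derivations with the same constant. *)
exists (c *: skewd (wt i) (fun=> 1) i fword w), (c *: skewd (fun=> 1) (wt^~ i) i fword w).
split=> //.
- by rewrite commutator_e_fword scalerBr -scalerAl -scalerAr.
- apply: (pair_ext_Uplus (phi := *%R (Ue i))) => //.
  + exact: Uminus_B'alg (UA _ _).
  + exact: B'alg_fword.
  + by move=> v; apply: gs_mul; [exact: Balg_e|exact: Balg_eword].
  + by move=> v; rewrite pair_skewd_fword -eword_cons -(wpair_consr hpr).
- apply: (pair_ext_Uplus (phi := fun x => x * Ue i)) => //.
  + exact: Uminus_B'alg (UA _ _).
  + exact: B'alg_fword.
  + by move=> v; apply: gs_mul; [exact: Balg_eword|exact: Balg_e].
  + by move=> v; rewrite pair_skewd_fword -eword_rcons -(wpair_rconsr hpr).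
Qed.

(** The counterpart of [commutator_e] for U^+. The term with the torus element on the right is now
    adjoint to right multiplication by f_i, the other one to left multiplication. *)
Lemma commutator_f z i x : Uplus z x -> exists A B : U,
  [/\ Uplus (z - alpha i) A, Uplus (z - alpha i) B,
      Uf i * x - x * Uf i = A * omega i - omega' i * B,
      forall z' y, Uminus z' y -> pr y A = pr (y * Uf i) x
    & forall z' y, Uminus z' y -> pr y B = pr (Uf i * y) x].
Proof.
move=> Ux.
suff [] : Balg x /\ exists A B : U,
  [/\ Uplus (z - alpha i) A, Uplus (z - alpha i) B,
      Uf i * x - x * Uf i = A * omega i - omega' i * B,
      forall z' y, Uminus z' y -> pr y A = pr (y * Uf i) x
    & forall z' y, Uminus z' y -> pr y B = pr (Uf i * y) x] by [].
move: x Ux; apply: Uplus_ind => [|w wz].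
  split; first split.
  - by case: sB.
  - exists 0, 0; split; try by case: (sP (z - alpha i)).
    + by rewrite mulr0 !mul0r mulr0.
    + move=> z' y Uy; rewrite [LHS](linear_on0 sB (pairing_linr hpr _));
        last exact: Uminus_B'alg Uy.
      rewrite [RHS](linear_on0 sB (pairing_linr hpr _)) //.
      by apply: gs_mul; [exact: Uminus_B'alg Uy|exact: B'alg_f].
    + move=> z' y Uy; rewrite [LHS](linear_on0 sB (pairing_linr hpr _));
        last exact: Uminus_B'alg Uy.
      rewrite [RHS](linear_on0 sB (pairing_linr hpr _)) //.
      by apply: gs_mul; [exact: B'alg_f|exact: Uminus_B'alg Uy].
  move=> a x x' [Bx [A [B [UA UB eAB pA pB]]]] [Bx' [A' [B' [UA' UB' eAB' pA' pB']]]].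
  split; first exact: BalgZ.
  exists (a *: A + A'), (a *: B + B'); split.
  - exact: (proj2 (sP _)).
  - exact: (proj2 (sP _)).
  - rewrite !mulrDl !mulrDr -!scalerAl -!scalerAr !opprD addrACA -scalerBr eAB eAB'.
    by rewrite [RHS]addrACA scalerBr.
  - move=> z' y Uy; have By := Uminus_B'alg Uy; have Byf := gs_mul By (B'alg_f q i).
    by rewrite !(pair_linr hpr) ?(pA z') ?(pA' z') //;
      exact: Uplus_Balg UA || exact: Uplus_Balg UA'.
  - move=> z' y Uy; have By := Uminus_B'alg Uy; have Byf := gs_mul (B'alg_f q i) By.
    by rewrite !(pair_linr hpr) ?(pB z') ?(pB' z') //;
      exact: Uplus_Balg UB || exact: Uplus_Balg UB'.
have UA a b : Uplus (z - alpha i) (c *: skewd a b i eword w).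
  apply: subspaceZ => //; apply: skewd_closed => // w1 w2 wE.
  by rewrite -wz wE -degree_remove; exact: Uplus_eword.
split; first exact: Balg_eword.
exists (c *: skewd (fun=> 1) (wt i) i eword w), (c *: skewd (wt^~ i) (fun=> 1) i eword w).
split=> //.
- by rewrite commutator_f_eword scalerBr -scalerAl -scalerAr.
- apply: (pair_ext_Uminus (phi := fun y => y * Uf i)) => //.
  + exact: Uplus_Balg (UA _ _).
  + exact: Balg_eword.
  + by move=> v; apply: gs_mul; [exact: B'alg_fword|exact: B'alg_f].
  + by move=> v; rewrite pair_skewd_eword -fword_rcons -(wpair_rconsl hpr).
- apply: (pair_ext_Uminus (phi := *%R (Uf i))) => //.
  + exact: Uplus_Balg (UA _ _).
  + exact: Balg_eword.
  + by move=> v; apply: gs_mul; [exact: B'alg_f|exact: B'alg_fword].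
  + by move=> v; rewrite pair_skewd_eword -fword_cons -(wpair_cons hpr).
Qed.

(** * The canonical elements and their commutation with the generators *)

Section DualBases.
Variables (d : Lam l -> nat) (u v : forall z, 'I_(d z) -> U).
Arguments u : clear implicits.
Arguments v : clear implicits.
Hypothesis huv : forall z, Qplus z -> dual_bases pr z (u z) (v z).

(** The value 0 off the cone makes the commutation relations hold for every z and lets sums run over
    the whole lattice. *)
Definition theta z : T := if `[< Qplus z >] then Theta_at (u z) (v z) else 0.

Lemma is_basis_mem (V : lmodType K) (S : set V) n (b : 'I_n -> V) k :
  is_basis S b -> S (b k).
Proof.
move=> [Sb _]; apply/Sb; exists (fun m => (m == k)%:R).
rewrite (bigD1 k) //= eqxx scale1r big1 ?addr0 // => m /negPf ->.
by rewrite scale0r.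
Qed.

Lemma dual_expand_Uminus z y : Qplus z -> Uminus z y ->
  y = \sum_k pr y (u z k) *: v z k.
Proof.
move=> Qz Uy; have [bu bv uv] := huv Qz.
have [a yE] := (proj1 bv y).1 Uy; rewrite {1}yE; apply: eq_bigr => k _; congr (_ *: _).
rewrite yE (linear_on_sum _ sB' (pairing_linl hpr _)).
- rewrite (bigD1 k) //= big1 ?addr0 => [|m /negPf mk].
    rewrite [RHS](linear_onZ _ sB' (pairing_linl hpr _)).
    + by rewrite uv eqxx [RHS]mulr1.
    + exact: Uplus_Balg (is_basis_mem _ bu).
    + exact: Uminus_B'alg (is_basis_mem _ bv).
  rewrite (linear_onZ _ sB' (pairing_linl hpr _)).
  + by rewrite uv mk [LHS]mulr0.
  + exact: Uplus_Balg (is_basis_mem _ bu).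
  + exact: Uminus_B'alg (is_basis_mem _ bv).
- exact: Uplus_Balg (is_basis_mem _ bu).
- by move=> m; apply: subspaceZ => //; exact: Uminus_B'alg (is_basis_mem _ bv).
Qed.

Lemma dual_expand_Uplus z x : Qplus z -> Uplus z x ->
  x = \sum_k pr (v z k) x *: u z k.
Proof.
move=> Qz Ux; have [bu bv uv] := huv Qz.
have [a xE] := (proj1 bu x).1 Ux; rewrite {1}xE; apply: eq_bigr => k _; congr (_ *: _).
rewrite xE (linear_on_sum _ sB (pairing_linr hpr _)).
- rewrite (bigD1 k) //= big1 ?addr0 => [|m /negPf mk].
    rewrite [RHS](linear_onZ _ sB (pairing_linr hpr _)).
    + by rewrite uv eqxx [RHS]mulr1.
    + exact: Uminus_B'alg (is_basis_mem _ bv).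
    + exact: Uplus_Balg (is_basis_mem _ bu).
  rewrite (linear_onZ _ sB (pairing_linr hpr _)).
  + by rewrite uv eq_sym mk [LHS]mulr0.
  + exact: Uminus_B'alg (is_basis_mem _ bv).
  + exact: Uplus_Balg (is_basis_mem _ bu).
- exact: Uminus_B'alg (is_basis_mem _ bv).
- by move=> m; apply: subspaceZ => //; exact: Uplus_Balg (is_basis_mem _ bu).
Qed.

Lemma Uplus_notin z x : ~ Qplus z -> Uplus z x -> x = 0.
Proof.
move=> nQz; move: x; apply: Uplus_ind => [|w wz].
  by split=> // a x y -> ->; rewrite scaler0 addr0.
by case: nQz; rewrite -wz; exact: degree_Qplus.
Qed.

Lemma Uminus_notin z x : ~ Qplus z -> Uminus z x -> x = 0.
Proof.
move=> nQz; move: x; apply: Uminus_ind => [|w wz].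
  by split=> // a x y -> ->; rewrite scaler0 addr0.
by case: nQz; rewrite -wz; exact: degree_Qplus.
Qed.

Lemma thetaE z : Qplus z -> theta z = \sum_k v z k ⊗ u z k.
Proof. by move=> Qz; rewrite /theta asboolT. Qed.

Lemma theta_notin z : ~ Qplus z -> theta z = 0.
Proof. by move=> nQz; rewrite /theta asboolF. Qed.

(** An adjoint may be moved across the canonical element. Expanding each A k in the basis v z', and
    each phi (u z' m) in the basis u z, produces the same matrix pr (v z k) (phi (u z' m)); [psi] is
    1 ⊗ [phi]. *)
Lemma theta_contract_e z z' (A : 'I_(d z) -> U) (phi : U -> U) (psi : T -> T) :
    linear_on (fun=> True) phi -> linear_on (fun=> True) psi ->
    (forall x y, psi (x ⊗ y) = x ⊗ phi y) ->
    (forall k, Uminus z' (A k)) ->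
    (forall x, Uplus z' x -> Uplus z (phi x)) ->
    (forall k x, Uplus z' x -> pr (A k) x = pr (v z k) (phi x)) ->
  Qplus z -> \sum_k A k ⊗ u z k = psi (theta z').
Proof.
move=> lphi lpsi psiE UA Uphi prA Qz.
have [Qz'|nQz'] := pselect (Qplus z'); last first.
  rewrite theta_notin // (linear_on0 (subspaceT _) lpsi) big1 // => k _.
  by rewrite (Uminus_notin nQz' (UA k)) tpure0l.
have bu m : Uplus z' (u z' m) by have [bu _ _] := huv Qz'; exact: is_basis_mem bu.
rewrite (thetaE Qz') (linear_on_sum _ (subspaceT _) lpsi) //.
transitivity (\sum_k \sum_m (pr (v z k) (phi (u z' m)) *: v z' m ⊗ u z k)).
  apply: eq_bigr => k _; rewrite {1}(dual_expand_Uminus Qz' (UA k)) tpure_suml.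
  by apply: eq_bigr => m _; rewrite prA.
rewrite exchange_big; apply: eq_bigr => m _.
rewrite psiE [in RHS](dual_expand_Uplus Qz (Uphi _ (bu m))) tpure_sumr.
by apply: eq_bigr => k _; rewrite tpureZl tpureZr.
Qed.

Lemma theta_contract_f z z' (A : 'I_(d z) -> U) (phi : U -> U) (psi : T -> T) :
    linear_on (fun=> True) phi -> linear_on (fun=> True) psi ->
    (forall x y, psi (x ⊗ y) = phi x ⊗ y) ->
    (forall k, Uplus z' (A k)) ->
    (forall y, Uminus z' y -> Uminus z (phi y)) ->
    (forall k y, Uminus z' y -> pr y (A k) = pr (phi y) (u z k)) ->
  Qplus z -> \sum_k v z k ⊗ A k = psi (theta z').
Proof.
move=> lphi lpsi psiE UA Uphi prA Qz.
have [Qz'|nQz'] := pselect (Qplus z'); last first.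
  rewrite theta_notin // (linear_on0 (subspaceT _) lpsi) big1 // => k _.
  by rewrite (Uplus_notin nQz' (UA k)) tpure0r.
have bv m : Uminus z' (v z' m) by have [_ bv _] := huv Qz'; exact: is_basis_mem bv.
rewrite (thetaE Qz') (linear_on_sum _ (subspaceT _) lpsi) //.
transitivity (\sum_k \sum_m (pr (phi (v z' m)) (u z k) *: v z k ⊗ u z' m)).
  apply: eq_bigr => k _; rewrite {1}(dual_expand_Uplus Qz' (UA k)) tpure_sumr.
  by apply: eq_bigr => m _; rewrite prA // tpureZr tpureZl.
rewrite exchange_big; apply: eq_bigr => m _.
by rewrite psiE [in RHS](dual_expand_Uminus Qz (Uphi _ (bv m))) tpure_suml.
Qed.

Let tmulr_lin (t : T) : linear_on (fun=> True) (fun t' : T => t' * t).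
Proof. by move=> a x y _ _; rewrite mulrDl scalerAl. Qed.

Let tmull_lin (t : T) : linear_on (fun=> True) (fun t' : T => t * t').
Proof. by move=> a x y _ _; rewrite mulrDr scalerAr. Qed.

Let Qplus_alpha z i : ~ Qplus z -> ~ Qplus (z - alpha i).
Proof.
by move=> nQ /(@Qplus_addalpha _ _ i); rewrite addrC subrK.
Qed.

(** The commutator differentiates the first factors v z k; by adjointness [theta_contract_e] turns
    these derivatives into left and right multiplication by e_i in the second factor. *)
Lemma theta_e z i :
  (Ue i ⊗ 1 : T) * theta z - theta z * (Ue i ⊗ 1)
  = theta (z - alpha i) * (omega' i ⊗ Ue i) - (omega i ⊗ Ue i) * theta (z - alpha i).
Proof.
have [Qz|nQz] := pselect (Qplus z); last first.
  by rewrite !theta_notin ?mulr0 ?mul0r ?subrr //; exact: Qplus_alpha.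
have bv k : Uminus z (v z k) by have [_ bv _] := huv Qz; exact: is_basis_mem bv.
have [A /choice [B AB]] := choice (fun k => commutator_e i (bv k)).
have EA : \sum_k A k ⊗ u z k = (1 ⊗ Ue i : T) * theta (z - alpha i).
  apply: (theta_contract_e (phi := *%R (Ue i))
    (psi := fun t : T => (1 ⊗ Ue i : T) * t)) => //.
  - by move=> x y; rewrite [LHS]tpureM mul1r.
  - by move=> k; have [] := AB k.
  - by move=> x; exact: Uplus_mulel.
  - by move=> k x; have [_ _ _ + _] := AB k; exact.
have EB : \sum_k B k ⊗ u z k = theta (z - alpha i) * (1 ⊗ Ue i : T).
  apply: (theta_contract_e (phi := fun x => x * Ue i)
    (psi := fun t : T => t * (1 ⊗ Ue i : T))) => //.
  - by move=> x y; rewrite [LHS]tpureM mulr1.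
  - by move=> k; have [] := AB k.
  - by move=> x; exact: Uplus_muler.
  - by move=> k x; have [_ _ _ _] := AB k; exact.
transitivity (\sum_k (Ue i * v z k - v z k * Ue i) ⊗ u z k).
  rewrite (thetaE Qz) mulr_sumr mulr_suml -sumrB; apply: eq_bigr => k _.
  by rewrite tpureDl tpureNl; congr (_ - _); rewrite [LHS]tpureM ?mul1r ?mulr1.
transitivity ((\sum_k B k ⊗ u z k) * (omega' i ⊗ 1 : T)
    - (omega i ⊗ 1 : T) * (\sum_k A k ⊗ u z k)).
  rewrite mulr_sumr mulr_suml -sumrB; apply: eq_bigr => k _.
  have [_ _ -> _ _] := AB k.
  by rewrite tpureDl tpureNl; congr (_ - _); rewrite [RHS]tpureM ?mul1r ?mulr1.
rewrite EA EB; congr (_ - _).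
  by rewrite -mulrA; congr (_ * _); rewrite [LHS]tpureM !mul1r !mulr1.
by rewrite mulrA; congr (_ * _); rewrite [LHS]tpureM ?mul1r ?mulr1.
Qed.

(** Now the second factors u z k are differentiated, and the multiplications by f_i appear in the
    first factor. *)
Lemma theta_f z i :
  (1 ⊗ Uf i : T) * theta z - theta z * (1 ⊗ Uf i)
  = theta (z - alpha i) * (Uf i ⊗ omega i) - (Uf i ⊗ omega' i) * theta (z - alpha i).
Proof.
have [Qz|nQz] := pselect (Qplus z); last first.
  by rewrite !theta_notin ?mulr0 ?mul0r ?subrr //; exact: Qplus_alpha.
have bu k : Uplus z (u z k) by have [bu _ _] := huv Qz; exact: is_basis_mem bu.
have [A /choice [B AB]] := choice (fun k => commutator_f i (bu k)).
have EA : \sum_k v z k ⊗ A k = theta (z - alpha i) * (Uf i ⊗ 1 : T).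
  apply: (theta_contract_f (phi := fun y => y * Uf i)
    (psi := fun t : T => t * (Uf i ⊗ 1 : T))) => //.
  - by move=> x y; rewrite [LHS]tpureM mulr1.
  - by move=> k; have [] := AB k.
  - by move=> x; exact: Uminus_mulfr.
  - by move=> k x; have [_ _ _ + _] := AB k; exact.
have EB : \sum_k v z k ⊗ B k = (Uf i ⊗ 1 : T) * theta (z - alpha i).
  apply: (theta_contract_f (phi := *%R (Uf i))
    (psi := fun t : T => (Uf i ⊗ 1 : T) * t)) => //.
  - by move=> x y; rewrite [LHS]tpureM mul1r.
  - by move=> k; have [] := AB k.
  - by move=> x; exact: Uminus_mulfl.
  - by move=> k x; have [_ _ _ _] := AB k; exact.
transitivity (\sum_k v z k ⊗ (Uf i * u z k - u z k * Uf i)).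
  rewrite (thetaE Qz) mulr_sumr mulr_suml -sumrB; apply: eq_bigr => k _.
  by rewrite tpureDr tpureNr; congr (_ - _); rewrite [LHS]tpureM ?mul1r ?mulr1.
transitivity ((\sum_k v z k ⊗ A k) * (1 ⊗ omega i : T)
    - (1 ⊗ omega' i : T) * (\sum_k v z k ⊗ B k)).
  rewrite mulr_sumr mulr_suml -sumrB; apply: eq_bigr => k _.
  have [_ _ -> _ _] := AB k.
  by rewrite tpureDr tpureNr; congr (_ - _); rewrite [RHS]tpureM ?mul1r ?mulr1.
rewrite EA EB; congr (_ - _).
  by rewrite -mulrA; congr (_ * _); rewrite [LHS]tpureM !mul1r !mulr1.
by rewrite mulrA; congr (_ * _); rewrite [LHS]tpureM ?mul1r ?mulr1.
Qed.

Lemma Uplus_torus (t : U) (p : K) i z x : p != 0 ->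
    (forall j, t * Ue j = p ^ dot (eps i) (alpha j) *: (Ue j * t)) ->
  Uplus z x -> t * x = p ^ dot (eps i) z *: (x * t).
Proof.
move=> p0 te; move: x; apply: Uplus_ind => [|w <-].
  split=> [|a x y tx ty]; first by rewrite mulr0 mul0r scaler0.
  by rewrite mulrDr mulrDl -scalerAr -scalerAl scalerDr tx ty scalerAC.
elim: w => [|j w IHw].
  by rewrite eword_nil /degree big_nil dot0r expr0z scale1r mul1r mulr1.
rewrite eword_cons degree_cons dotDr expfzDr // mulrA te -scalerAl.
by rewrite -[in LHS]mulrA IHw -scalerAr scalerA mulrA.
Qed.

Lemma Uminus_torus (t : U) (p : K) i z y : p != 0 ->
    (forall j, t * Uf j = p ^ (- dot (eps i) (alpha j)) *: (Uf j * t)) ->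
  Uminus z y -> t * y = p ^ (- dot (eps i) z) *: (y * t).
Proof.
move=> p0 tf; move: y; apply: Uminus_ind => [|w <-].
  split=> [|a x y tx ty]; first by rewrite mulr0 mul0r scaler0.
  by rewrite mulrDr mulrDl -scalerAr -scalerAl scalerDr tx ty scalerAC.
elim: w => [|j w IHw].
  by rewrite fword_nil /degree big_nil dot0r oppr0 expr0z scale1r mul1r mulr1.
rewrite fword_cons degree_cons dotDr opprD expfzDr // mulrA tf -scalerAl.
by rewrite -[in LHS]mulrA IHw -scalerAr scalerA mulrA.
Qed.

(** The two factors of each summand have weights -z and z, so the scalars picked up by t cancel. *)
Lemma theta_torus (t : U) (p : K) i z : p != 0 ->
    (forall j, t * Ue j = p ^ dot (eps i) (alpha j) *: (Ue j * t)) ->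
    (forall j, t * Uf j = p ^ (- dot (eps i) (alpha j)) *: (Uf j * t)) ->
  (t ⊗ t : T) * theta z = theta z * (t ⊗ t).
Proof.
move=> p0 te tf; have [Qz|nQz] := pselect (Qplus z); last first.
  by rewrite theta_notin // mulr0 mul0r.
have [bu bv _] := huv Qz.
rewrite thetaE // mulr_sumr mulr_suml; apply: eq_bigr => k _.
rewrite [LHS]tpureM [RHS]tpureM (Uplus_torus p0 te (is_basis_mem k bu)).
rewrite (Uminus_torus p0 tf (is_basis_mem k bv)) tpureZl tpureZr scalerA -expfzDr //.
by rewrite addNr scale1r.
Qed.

(** A word of degree 0 has height 0 and is empty, so each u 0 k is a scalar a k. Then pr 1 (u 0 k) =
    a k, and the canonical element is the dual expansion of 1, tensored with 1. *)
Lemma theta0 : theta 0 = 1.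
Proof.
have Q0 : Qplus (0 : Lam l) by have := degree_Qplus ([::] : seq 'I_l); rewrite /degree big_nil.
have Uplus0 x : Uplus 0 x -> exists a : K, x = a%:A.
  move: x; apply: Uplus_ind => [|w w0].
    split=> [|a _ _ [b ->] [b' ->]]; first by exists 0; rewrite scale0r.
    by exists (a * b + b'); rewrite scalerA scalerDl.
  have := height_degree w; rewrite w0; case: w {w0} => [_|k w].
    by exists 1; rewrite eword_nil scale1r.
  by rewrite /height big1 // => i _; rewrite mxE mulr0.
have [bu _ _] := huv Q0.
have [a ua] := choice (fun k => Uplus0 _ (is_basis_mem k bu)).
have U1 : Uminus 0 (1 : U).
  by have := Uminus_fword q ([::] : seq 'I_l); rewrite fword_nil /degree big_nil.
rewrite thetaE // -[RHS]/(1 ⊗ 1) [X in _ = X ⊗ _](dual_expand_Uminus Q0 U1).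
rewrite tpure_suml; apply: eq_bigr => k _; rewrite ua tpureZr tpureZl; congr (_ *: _).
have B1 := gen_subalg1 _ : Balg (1 : U).
have B'1 := gen_subalg1 _ : B'alg (1 : U).
by rewrite [RHS](linear_onZ _ sB (pairing_linr hpr B'1)) // (pair_1r hpr) // counit1 [RHS]mulr1.
Qed.

End DualBases.
End CanonicalElement.

(** * Characters of the lattice in the basis of the alpha_i *)

Section LatticeCharacters.
Variables (l : nat).
Implicit Types (x y : Lam l).

Lemma acoordD x y i : acoord (x + y) i = acoord x i + acoord y i.
Proof. by rewrite /acoord -big_split; apply: eq_bigr => k _; rewrite mxE. Qed.

Lemma acoord_eps (h i : 'I_l.+1) : acoord (eps h) i = (h <= i)%N%:R.
Proof.
rewrite /acoord; have [hi|ih] := boolP (h <= i)%N; last first.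
  rewrite big1 // => k ki; rewrite mxE eqxx; have [kh|//] := eqVneq k h.
  by rewrite kh (negPf ih) in ki.
rewrite (bigD1 h) //= big1 ?addr0 => [|k /andP[_ /negPf kh]]; first by rewrite mxE !eqxx.
by rewrite mxE kh andbF.
Qed.

Lemma acoord_alpha (j : 'I_l) (i : 'I_l.+1) : acoord (alpha j) i = (j == i :> nat)%:R.
Proof.
have -> : acoord (alpha j) i = acoord (eps (lo j)) i - acoord (eps (hi j)) i.
  by rewrite -[eps (lo j)](subrK (eps (hi j))) -/(alpha j) [acoord (_ + eps _) _]acoordD addrK.
rewrite !acoord_eps /= /bump add1n; case: ltngtP => // ->.
Qed.

Lemma acoord_alpha_lo (j k : 'I_l) : acoord (alpha j) (lo k) = (j == k)%:R.
Proof. exact: acoord_alpha. Qed.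

Lemma acoord_alpha_max (j : 'I_l) : acoord (alpha j) ord_max = 0.
Proof. by rewrite acoord_alpha ltn_eqF. Qed.

Lemma dot_mulrz x y (k : int) : dot x (y *~ k) = dot x y * k.
Proof.
rewrite /dot mulr_suml; apply: eq_bigr => i _; rewrite -mulrA; congr (_ * _).
by rewrite -scaler_int mxE mulrC intz.
Qed.

Lemma dot_sumr x I (s : seq I) (f : I -> Lam l) :
  dot x (\sum_(i <- s) f i) = \sum_(i <- s) dot x (f i).
Proof. by elim/big_rec2: _ => [|i y z _ <-]; [exact: dot0r|exact: dotDr]. Qed.

Variable K : fieldType.
Implicit Types (r s : K).

Lemma expfz_dot_acoord r i y : r != 0 ->
  r ^ dot (eps i) y = \prod_(j < l) (r ^ dot (eps i) (alpha j)) ^ acoord y (lo j)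
     * (r ^ dot (eps i) (eps ord_max)) ^ acoord y ord_max.
Proof.
move=> r0; rewrite {1}[y]acoordE dotDr expfzDr // dot_mulrz dot_sumr exprz_exp.
congr (_ * _); elim/big_rec2: _ => [|j x z _ <-]; first by rewrite expr0z.
by rewrite expfzDr // dot_mulrz exprz_exp.
Qed.

(** The eigenvalue of a_i b_k on weight y; the index pair (lo j, hi j) gives that of omega_j, and
    (hi j, lo j) that of omega'_j. *)
Definition bichar r s (i k : 'I_l.+1) y := r ^ dot (eps i) y * s ^ dot (eps k) y.

(** Eigenvalues are written through the eps_i, but the elements omega_lambda through coordinates in
    the alpha_i; multiplicativity translates between them. *)
Lemma bichar_acoord r s i k y : r != 0 -> s != 0 ->
  bichar r s i k y = \prod_(j < l) bichar r s i k (alpha j) ^ acoord y (lo j)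
     * bichar r s i k (eps ord_max) ^ acoord y ord_max.
Proof.
move=> r0 s0; rewrite /bichar !(@expfz_dot_acoord _ _ y) // mulrACA -big_split.
by rewrite -expfzMl; congr (_ * _); apply: eq_bigr => j _; rewrite expfzMl.
Qed.

End LatticeCharacters.

(** * The scalars f(lambda, mu) and their behaviour under shifts *)

Section Flat.
Variables (K : fieldType) (l : nat) (q : qparam K).
Local Notation r := (qr q).
Local Notation s := (qs q).
Local Notation U := (Ugl l q).
Local Notation T := (tensor U U).
Local Notation omega := (@omega K l q).
Local Notation omegaV := (@omegaV K l q).
Local Notation omega' := (@omega' K l q).
Local Notation omega'V := (@omega'V K l q).
Local Notation a_n := (Ua q (@ord_max l)).
Local Notation a_nV := (UaV q (@ord_max l)).
Local Notation b_n := (Ub q (@ord_max l)).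
Local Notation b_nV := (UbV q (@ord_max l)).
Variables (pr : U -> U -> K) (hpr : hopf_pairing pr).
Implicit Types (g h x y : U).

(** Against a group-like element the pairing is multiplicative in the other argument, which reduces
    omega_lambda and omega'_mu to generators. *)
Definition grouplike (B : set U) g :=
  [/\ B g, comul g = g ⊗ g & counit g = 1].

Lemma grouplikeM (S : set U) g h :
  grouplike (gen_subalg S) g -> grouplike (gen_subalg S) h -> grouplike (gen_subalg S) (g * h).
Proof.
move=> [Bg Dg eg] [Bh Dh eh]; split; first exact: gs_mul.
  by rewrite comulM Dg Dh tpureM.
by rewrite counitM eg eh mulr1.
Qed.

Lemma grouplike1 (S : set U) : grouplike (gen_subalg S) 1.
Proof. split; [exact: gen_subalg1|exact: comul1|exact: counit1]. Qed.

Lemma grouplike_zpow (S : set U) x xV k :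
    grouplike (gen_subalg S) x -> grouplike (gen_subalg S) xV ->
  grouplike (gen_subalg S) (zpow x xV k).
Proof.
have gX h n : grouplike (gen_subalg S) h -> grouplike (gen_subalg S) (h ^+ n).
  move=> gh; elim: n => [|n IHn]; first exact: grouplike1.
  by rewrite exprS; exact: grouplikeM.
by case: k => n gx gxV /=; exact: gX.
Qed.

Lemma torus_comul_counit (t : glgen l) : is_torus t ->
  comul (ugen q t) = ugen q t ⊗ ugen q t /\ counit (ugen q t) = 1.
Proof. by move=> tt; split; [exact: comul_torus|exact: counit_torus]. Qed.

Let gl_mul (S : set U) (t t' : glgen l) : is_torus t -> is_torus t' ->
  gen_subalg S (ugen q t * ugen q t') -> grouplike (gen_subalg S) (ugen q t * ugen q t').
Proof.
move=> /torus_comul_counit[D1 e1] /torus_comul_counit[D2 e2] B; split=> //.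
  by rewrite comulM D1 D2 tpureM.
by rewrite counitM e1 e2 mulr1.
Qed.

Lemma grouplike_Btorus x : Btorus x -> grouplike (@Balg K l q) x.
Proof.
move=> Bx; have B : Balg x by apply: gs_gen; right.
case: Bx B => [[j [->|->]]|[->|->]] B; first [exact: gl_mul
  |by have [] := @torus_comul_counit (GA ord_max) isT
  |by have [] := @torus_comul_counit (GAV ord_max) isT].
Qed.

Lemma grouplike_B'torus x : B'torus x -> grouplike (@B'alg K l q) x.
Proof.
move=> Bx; have B : B'alg x by apply: gs_gen; right.
case: Bx B => [[j [->|->]]|[->|->]] B; first [exact: gl_mul
  |by have [] := @torus_comul_counit (GB ord_max) isT
  |by have [] := @torus_comul_counit (GBV ord_max) isT].
Qed.

Lemma pair_grouplikeMr g x y : grouplike (@B'alg K l q) g -> Balg x -> Balg y ->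
  pr g (x * y) = pr g x * pr g y.
Proof.
move=> [Bg Dg _] Bx By; rewrite (pair_mulr hpr (xs := [:: (g, g)])) ?big_seq1 //.
by move=> p; rewrite inE => /eqP ->.
Qed.

Lemma pair_grouplikeMl g x y : grouplike (@Balg K l q) g -> B'alg x -> B'alg y ->
  pr (x * y) g = pr x g * pr y g.
Proof.
move=> [Bg Dg _] Bx By; rewrite (pair_mull hpr (zs := [:: (g, g)])) ?big_seq1 //.
by move=> p; rewrite inE => /eqP ->.
Qed.

Lemma pair_grouplike_zpowr g x xV k : grouplike (@B'alg K l q) g ->
  Balg x -> Balg xV -> x * xV = 1 -> pr g (zpow x xV k) = pr g x ^ k.
Proof.
move=> Gg Bx BxV xxV; have [Bg _ eg] := Gg.
have pX y n : Balg y -> pr g (y ^+ n) = pr g y ^+ n /\ Balg (y ^+ n).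
  move=> By; elim: n => [|n [IHn Bn]].
    by split; [rewrite (pair_1r hpr)|exact: gen_subalg1].
  by rewrite !exprS pair_grouplikeMr // IHn; split=> //; exact: gs_mul.
have V : (pr g x)^-1 = pr g xV.
  by apply: mulr1_eq; rewrite -pair_grouplikeMr // xxV (pair_1r hpr).
case: k => n /=; first by rewrite (pX x n _).1.
by rewrite (pX xV n.+1 _).1 // -V exprVn.
Qed.

Lemma pair_grouplike_zpowl g x xV k : grouplike (@Balg K l q) g ->
  B'alg x -> B'alg xV -> x * xV = 1 -> pr (zpow x xV k) g = pr x g ^ k.
Proof.
move=> Gg Bx BxV xxV; have [Bg _ eg] := Gg.
have pX y n : B'alg y -> pr (y ^+ n) g = pr y g ^+ n /\ B'alg (y ^+ n).
  move=> By; elim: n => [|n [IHn Bn]].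
    by split; [rewrite (pair_1l hpr)|exact: gen_subalg1].
  by rewrite !exprS pair_grouplikeMl // IHn; split=> //; exact: gs_mul.
have V : (pr x g)^-1 = pr xV g.
  by apply: mulr1_eq; rewrite -pair_grouplikeMl // xxV (pair_1l hpr).
case: k => n /=; first by rewrite (pX x n _).1.
by rewrite (pX xV n.+1 _).1 // -V exprVn.
Qed.

Let torusK (t t' u u' : glgen l) : is_torus t' -> is_torus u ->
    ugen q t * ugen q t' = 1 -> ugen q u * ugen q u' = 1 ->
  ugen q t * ugen q u * (ugen q t' * ugen q u') = 1.
Proof.
by move=> tt tu E1 E2; rewrite -mulrA [ugen q u * _]mulrA (UtorusC q tu tt) -mulrA E2 mulr1.
Qed.

Lemma omegaK j : omega j * omegaV j = 1.
Proof. by apply: torusK => //; [exact: UaK|exact: UbK]. Qed.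

Lemma omega'K j : omega' j * omega'V j = 1.
Proof. by apply: torusK => //; [exact: UaK|exact: UbK]. Qed.

Let Bt x : Btorus x -> Balg x. Proof. by move=> Bx; apply: gs_gen; right. Qed.
Let B't x : B'torus x -> B'alg x. Proof. by move=> Bx; apply: gs_gen; right. Qed.
Let Bw j : Btorus (omega j). Proof. by left; exists j; left. Qed.
Let BwV j : Btorus (omegaV j). Proof. by left; exists j; right. Qed.
Let Ba : Btorus a_n. Proof. by right; left. Qed.
Let BaV : Btorus a_nV. Proof. by right; right. Qed.
Let B'w j : B'torus (omega' j). Proof. by left; exists j; left. Qed.
Let B'wV j : B'torus (omega'V j). Proof. by left; exists j; right. Qed.
Let B'b : B'torus b_n. Proof. by right; left. Qed.
Let B'bV : B'torus b_nV. Proof. by right; right. Qed.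

Lemma grouplike_prod (S : set U) I (t : seq I) (f : I -> U) :
    (forall i, grouplike (gen_subalg S) (f i)) ->
  grouplike (gen_subalg S) (\prod_(i <- t) f i).
Proof.
by move=> gf; apply: big_ind => //; [exact: grouplike1|move=> x y; exact: grouplikeM].
Qed.

Let gl_zw (x : Lam l) j : grouplike (@Balg K l q) (zpow (omega j) (omegaV j) (acoord x (lo j))).
Proof. by apply: grouplike_zpow; apply: grouplike_Btorus. Qed.

Let gl_za (x : Lam l) : grouplike (@Balg K l q) (zpow a_n a_nV (acoord x ord_max)).
Proof. by apply: grouplike_zpow; apply: grouplike_Btorus. Qed.

Let gl_zw' (x : Lam l) j : grouplike (@B'alg K l q) (zpow (omega' j) (omega'V j) (acoord x (lo j))).
Proof. by apply: grouplike_zpow; apply: grouplike_B'torus. Qed.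

Let gl_zb (x : Lam l) : grouplike (@B'alg K l q) (zpow b_n b_nV (acoord x ord_max)).
Proof. by apply: grouplike_zpow; apply: grouplike_B'torus. Qed.

Lemma grouplike_omega_lat (x : Lam l) : grouplike (@Balg K l q) (omega_lat q x).
Proof. by apply: grouplikeM => //; apply: grouplike_prod. Qed.

Lemma grouplike_omega'_lat (x : Lam l) : grouplike (@B'alg K l q) (omega'_lat q x).
Proof. by apply: grouplikeM => //; apply: grouplike_prod. Qed.

Lemma pair_omega_latr g (x : Lam l) : grouplike (@B'alg K l q) g ->
  pr g (omega_lat q x)
  = \prod_(j < l) pr g (omega j) ^ acoord x (lo j) * pr g a_n ^ acoord x ord_max.
Proof.
move=> Gg; have [Bg _ eg] := Gg.
rewrite /omega_lat pair_grouplikeMr //; last by case: (gl_za x).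
  congr (_ * _); last by apply: pair_grouplike_zpowr; rewrite ?UaK //; exact: Bt.
  suff [] : pr g (\prod_(j < l) zpow (omega j) (omegaV j) (acoord x (lo j)))
      = \prod_(j < l) pr g (omega j) ^ acoord x (lo j)
      /\ Balg (\prod_(j < l) zpow (omega j) (omegaV j) (acoord x (lo j))) by [].
  elim/big_rec2: _ => [|j y z _ [IH Bz]].
    by split; [rewrite (pair_1r hpr)|exact: gen_subalg1].
  have [B _ _] := gl_zw x j; split; last exact: gs_mul.
  rewrite pair_grouplikeMr // IH pair_grouplike_zpowr ?omegaK //; exact: Bt.
by case: (grouplike_prod (S := _) (index_enum _) (gl_zw x)).
Qed.

Lemma pair_omega'_latl g (x : Lam l) : grouplike (@Balg K l q) g ->
  pr (omega'_lat q x) g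
  = \prod_(j < l) pr (omega' j) g ^ acoord x (lo j) * pr b_n g ^ acoord x ord_max.
Proof.
move=> Gg; have [Bg _ eg] := Gg.
rewrite /omega'_lat pair_grouplikeMl //; last by case: (gl_zb x).
  congr (_ * _); last by apply: pair_grouplike_zpowl; rewrite ?UbK //; exact: B't.
  suff [] : pr (\prod_(j < l) zpow (omega' j) (omega'V j) (acoord x (lo j))) g
      = \prod_(j < l) pr (omega' j) g ^ acoord x (lo j)
      /\ B'alg (\prod_(j < l) zpow (omega' j) (omega'V j) (acoord x (lo j))) by [].
  elim/big_rec2: _ => [|j y z _ [IH Bz]].
    by split; [rewrite (pair_1l hpr)|exact: gen_subalg1].
  have [B _ _] := gl_zw' x j; split; last exact: gs_mul.
  rewrite pair_grouplikeMl // IH pair_grouplike_zpowl ?omega'K //; exact: B't.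
by case: (grouplike_prod (S := _) (index_enum _) (gl_zw' x)).
Qed.

Let r0 : r != 0 := qr_neq0 q.
Let s0 : s != 0 := qs_neq0 q.

Lemma bichar_neq0 i k (x : Lam l) : bichar r s i k x != 0.
Proof. by rewrite mulf_neq0 // expfz_neq0. Qed.

Let lo_max (j : 'I_l) : (lo j == ord_max) = false.
Proof. by rewrite -val_eqE /= ltn_eqF. Qed.

(** The prescribed values of the pairing on torus generators are exactly the eigenvalues of omega_j
    on the weights alpha_1, ..., alpha_n. *)
Lemma pair_omega'_lat_omega j (y : Lam l) :
  pr (omega'_lat q y) (omega j) = bichar r s (lo j) (hi j) y.
Proof.
rewrite pair_omega'_latl; last exact: grouplike_Btorus.
rewrite (bichar_acoord _ _ y r0 s0); congr (_ * _ ^ _).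
  by apply: eq_bigr => i _; have [-> _ _ _] := pair_omega hpr i j.
(* At alpha_n = eps_n the r-part is trivial, as j < n in 1-based indices, and both sides are s or 1
   according to whether j + 1 = n. *)
have [-> _ _ _] := pair_b_omega hpr j.
by rewrite /bichar !dot_eps dot_alpha ![ord_max == _]eq_sym lo_max expr0z mul1r sub0r opprK.
Qed.

(** In the other argument the inverse eigenvalue of omega'_i appears, because (omega'_i, omega_j) =
    wt j i is the inverse of wt' i j. *)
Lemma pair_omega'_omega_lat i (x : Lam l) :
  pr (omega' i) (omega_lat q x) = (bichar r s (hi i) (lo i) x)^-1.
Proof.
rewrite pair_omega_latr; last exact: grouplike_B'torus.
rewrite (bichar_acoord _ _ x r0 s0) invfM -prodfV; congr (_ * _).
  apply: eq_bigr => j _; have [-> _ _ _] := pair_omega hpr i j.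
  rewrite invr_expz -exprz_inv; congr (_ ^ _).
  by rewrite -[RHS]/((wt' q i j)^-1) wtV invrK.
rewrite invr_expz -exprz_inv; congr (_ ^ _); have [-> _ _ _] := pair_omega_a hpr i.
rewrite /bichar !dot_eps dot_alpha ![ord_max == _]eq_sym lo_max expr0z mulr1 sub0r.
by rewrite invr_expz.
Qed.

Lemma pair_lat_neq0 (x y : Lam l) : pr (omega'_lat q y) (omega_lat q x) != 0.
Proof.
rewrite pair_omega'_latl; last exact: grouplike_omega_lat.
rewrite mulf_neq0 //.
  apply/prodf_neq0 => i _; rewrite expfz_neq0 // pair_omega'_omega_lat.
  by rewrite invr_eq0 bichar_neq0.
rewrite expfz_neq0 // pair_omega_latr; last exact: grouplike_B'torus.
have [-> _ _ _] := pair_b_a hpr; rewrite mulf_neq0 // ?expfz_neq0 ?oner_eq0 //.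
apply/prodf_neq0 => j _; have [-> _ _ _] := pair_b_omega hpr j.
by rewrite !expfz_neq0.
Qed.

Lemma flat_neq0 (x y : Lam l) : flat pr x y != 0.
Proof. by rewrite invr_eq0 pair_lat_neq0. Qed.

Let prod_expz_delta (f : 'I_l -> K) (x : Lam l) j : (forall i, f i != 0) ->
  \prod_(i < l) f i ^ acoord (x + alpha j) (lo i)
  = \prod_(i < l) f i ^ acoord x (lo i) * f j.
Proof.
move=> f0; under eq_bigr => i _ do rewrite acoordD acoord_alpha_lo expfzDr //.
rewrite big_split; congr (_ * _); rewrite (bigD1 j) //= eqxx expr1z big1 ?mulr1 //.
by move=> i /negPf ij; rewrite eq_sym ij expr0z.
Qed.

(** The new factor is the eigenvalue of omega'_i on M_x; in [flat_addalphal] it is the inverse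
    eigenvalue of omega_j on M'_y. This lets f~ create omega' in one tensor factor and remove omega
    in the other. *)
Lemma flat_addalphar (x y : Lam l) i :
  flat pr x (y + alpha i) = flat pr x y * bichar r s (hi i) (lo i) x.
Proof.
have Gx := grouplike_omega_lat x.
rewrite /flat !(pair_omega'_latl _ Gx) acoordD acoord_alpha_max addr0.
rewrite prod_expz_delta => [|j]; last by rewrite pair_omega'_omega_lat invr_eq0 bichar_neq0.
rewrite [pr (omega' i) _]pair_omega'_omega_lat mulrAC.
by rewrite [LHS]invfM invrK.
Qed.

Lemma flat_addalphal (x y : Lam l) j :
  flat pr (x + alpha j) y = flat pr x y / bichar r s (lo j) (hi j) y.
Proof.
have Gy := grouplike_omega'_lat y.
rewrite /flat !(pair_omega_latr _ Gy) acoordD acoord_alpha_max addr0.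
rewrite prod_expz_delta => [|i]; last by rewrite pair_omega'_lat_omega bichar_neq0.
by rewrite pair_omega'_lat_omega mulrAC [LHS]invfM.
Qed.

End Flat.

(** * Sums of finitely supported families *)

Definition fin_supp (I : choiceType) (V : zmodType) (f : I -> V) :=
  exists xs : seq I, forall x, x \notin xs -> f x = 0.

Lemma sum_suppE (I : choiceType) (V : zmodType) (f : I -> V) (xs : seq I) :
    uniq xs -> (forall x, x \notin xs -> f x = 0) ->
  \sum_(x \in [set: I]) f x = \sum_(x <- xs) f x.
Proof.
move=> uxs f0; rewrite (fsbigE xs) //; first by apply: eq_bigl => x; exact: in_setT.
by move=> x _; exact: f0.
Qed.

Lemma sum_sub_uniq (I : choiceType) (V : zmodType) (xs ys : seq I) (f : I -> V) :
    uniq xs -> uniq ys -> {subset xs <= ys} -> (forall x, x \notin xs -> f x = 0) ->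
  \sum_(x <- xs) f x = \sum_(x <- ys) f x.
Proof.
move=> ux uy xy f0; rewrite -(sum_suppE ux f0) (sum_suppE uy) // => x xNy.
by apply: f0; apply: contra xNy => /xy.
Qed.

Section FiniteSupport.
Variables (I : choiceType) (V W : zmodType).
Implicit Types (f g : I -> V).

(** A sum over an infinite support is 0 by convention, so additivity requires both supports to be
    finite. *)
Lemma sum_suppD f g : fin_supp f -> fin_supp g ->
  \sum_(x \in [set: I]) (f x + g x)
  = \sum_(x \in [set: I]) f x + \sum_(x \in [set: I]) g x.
Proof.
move=> [xs fxs] [ys gys]; have uxy := undup_uniq (xs ++ ys).
have off x : x \notin undup (xs ++ ys) -> f x = 0 /\ g x = 0.
  by rewrite mem_undup mem_cat negb_or => /andP[/fxs ? /gys].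
rewrite !(sum_suppE uxy) ?big_split // => x /off[fx gx] //.
by rewrite fx gx addr0.
Qed.

Lemma sum_supp_map f (h : V -> W) : h 0 = 0 -> {morph h : x y / x + y} -> fin_supp f ->
  \sum_(x \in [set: I]) h (f x) = h (\sum_(x \in [set: I]) f x).
Proof.
move=> h0 hD [xs fxs]; have uxs := undup_uniq xs.
have off x : x \notin undup xs -> f x = 0 by rewrite mem_undup; exact: fxs.
rewrite (sum_suppE uxs off) (sum_suppE uxs) => [|x /off -> //].
by elim/big_rec2: _ => // x y z _ ->; rewrite hD.
Qed.

End FiniteSupport.

(** Translation is a bijection of the whole group, which it would not be on a cone such as
    [Qplus]. *)
Lemma sum_supp_shift (I V : zmodType) (f : I -> V) (a : I) :
  \sum_(x \in [set: I]) f (x - a) = \sum_(x \in [set: I]) f x.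
Proof.
rewrite [RHS](reindex_fsbigT (fun x => x - a)) //.
by exists (fun x => x + a) => x; rewrite ?subrK ?addrK.
Qed.

Lemma fin_supp_shift (I V : zmodType) (f : I -> V) (a : I) :
  fin_supp f -> fin_supp (fun x => f (x - a)).
Proof.
move=> [xs fxs]; exists [seq x + a | x <- xs] => x xN; apply: fxs.
by apply: contra xN => xa; apply/mapP; exists (x - a); rewrite ?subrK.
Qed.

(** * Weight decompositions of modules in the category O *)

Section WeightSpaces.
Variables (K : fieldType) (l : nat) (q : qparam K).
Local Notation r := (qr q).
Local Notation s := (qs q).
Local Notation U := (Ugl l q).
Variable M : lmodType U.
Local Notation V := (resK M).
Implicit Types (m : V) (x y : Lam l) (t : U).

Lemma ractM t t' m : ract t (ract t' m) = ract (t * t') m.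
Proof. by rewrite /ract scalerA. Qed.

Lemma ract1 m : ract (1 : U) m = m.
Proof. by rewrite /ract scale1r. Qed.

Lemma ractD t m m' : ract t (m + m') = ract t m + ract t m'.
Proof. exact: (bilinDr (ract_bilin M)). Qed.

Lemma ractDl t t' m : ract (t + t') m = ract t m + ract t' m.
Proof. exact: (bilinDl (ract_bilin M)). Qed.

Lemma ractZ t (a : K) m : ract t (a *: m) = a *: ract t m.
Proof. exact: (bilinZr (ract_bilin M)). Qed.

Lemma ractZl t (a : K) m : ract (a *: t) m = a *: ract t m.
Proof. exact: (bilinZl (ract_bilin M)). Qed.

Lemma ract0 t : ract t (0 : V) = 0.
Proof. exact: (bilin0r (ract_bilin M)). Qed.

Lemma wtspace_subspace x : subspace (@wtspace K l q M x).
Proof.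
split=> [i|a m m' wm wm' i]; first by rewrite !ract0 !scaler0.
have [am bm] := wm i; have [am' bm'] := wm' i.
by rewrite !ractD !ractZ am bm am' bm' !scalerDr ![a *: (_ *: _)]scalerAC.
Qed.

Let r0 : r != 0 := qr_neq0 q.
Let s0 : s != 0 := qs_neq0 q.

Lemma wtspace_e j x m : wtspace x m -> wtspace (x + alpha j) (ract (Ue q j) m).
Proof.
move=> wm i; have [am bm] := wm i.
rewrite !ractM Ua_e Ub_e !ractZl -!ractM am bm !ractZ !scalerA !dotDr !expfzDr //.
by split; congr (_ *: _); rewrite mulrC.
Qed.

Lemma wtspace_f j x m : wtspace x m -> wtspace (x - alpha j) (ract (Uf q j) m).
Proof.
move=> wm i; have [am bm] := wm i.
rewrite !ractM Ua_f Ub_f !ractZl -!ractM am bm !ractZ !scalerA !dotBr !expfzDr //.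
by split; congr (_ *: _); rewrite mulrC.
Qed.

Lemma wtspace_omega j x m : wtspace x m ->
  ract (omega q j) m = bichar r s (lo j) (hi j) x *: m.
Proof.
by move=> wm; rewrite -ractM (wm _).2 ractZ (wm _).1 scalerA mulrC.
Qed.

Lemma wtspace_omega' j x m : wtspace x m ->
  ract (omega' q j) m = bichar r s (hi j) (lo j) x *: m.
Proof.
by move=> wm; rewrite -ractM (wm _).2 ractZ (wm _).1 scalerA mulrC.
Qed.

Lemma wtspace_eword w x m : wtspace x m -> wtspace (x + degree w) (ract (eword q w) m).
Proof.
move=> wm; elim: w => [|j w IHw].
  by rewrite eword_nil ract1 /degree big_nil addr0.
rewrite eword_cons -ractM degree_cons [alpha j + _]addrC addrA.
exact: wtspace_e.
Qed.

Hypothesis hM : category_O M.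

(** The components form a total function vanishing off xs, so that decompositions with different
    supports can be added and compared pointwise; xs consists of weights that occur, as [O_direct]
    demands. *)
Definition weight_decomp m (xs : seq (Lam l)) (c : Lam l -> V) :=
  [/\ uniq xs, forall x, x \in xs -> wt_of M x, forall x, wtspace x (c x),
      forall x, x \notin xs -> c x = 0 & m = \sum_(x <- xs) c x].

Lemma weight_decomp_lin a m m' xs xs' c c' :
    weight_decomp m xs c -> weight_decomp m' xs' c' ->
  weight_decomp (a *: m + m') (undup (xs ++ xs')) (fun x => a *: c x + c' x).
Proof.
move=> [u1 O1 w1 z1 E1] [u2 O2 w2 z2 E2].
have sub1 : {subset xs <= undup (xs ++ xs')} by move=> x; rewrite mem_undup mem_cat => ->.
have sub2 : {subset xs' <= undup (xs ++ xs')}.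
  by move=> x; rewrite mem_undup mem_cat orbC => ->.
split.
- exact: undup_uniq.
- by move=> x; rewrite mem_undup mem_cat => /orP[/O1|/O2].
- by move=> x; apply: (proj2 (wtspace_subspace _)).
- move=> x; rewrite mem_undup mem_cat negb_or => /andP[/z1 -> /z2 ->].
  by rewrite scaler0 addr0.
- rewrite big_split -scaler_sumr E1 E2.
  by rewrite (sum_sub_uniq u1 (undup_uniq _) sub1 z1)
    (sum_sub_uniq u2 (undup_uniq _) sub2 z2).
Qed.

Lemma weight_decomp_wtspace x m : wtspace x m ->
  exists xs, weight_decomp m xs (fun y => if y == x then m else 0).
Proof.
move=> wm; have w0 y : wtspace y (0 : V) by case: (wtspace_subspace y).
(* The zero vector belongs to every weight space, even when x is not a weight of M; its support must
   then be empty. *)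
have [->|m0] := eqVneq m 0.
  exists [::]; split=> // [y|y _|]; try by case: eqP.
  by rewrite big_nil.
exists [:: x]; split=> //.
- by move=> y; rewrite inE => /eqP ->; exists m.
- by move=> y; case: eqP => // ->.
- by move=> y; rewrite inE => /negPf ->.
- by rewrite big_seq1 eqxx.
Qed.

Lemma weight_decomp_ex m : exists xs c, weight_decomp m xs c.
Proof.
have dec0 : exists xs c, weight_decomp 0 xs c.
  by exists [::], (fun=> 0); split=> // [x|]; [case: (wtspace_subspace x)|rewrite big_nil].
have [xs [c [wc ->]]] := O_span hM m; rewrite big_seq.
apply: (big_ind (fun m => exists xs c, weight_decomp m xs c)) => //.
- move=> m1 m2 [xs1 [c1 d1]] [xs2 [c2 d2]].
  by have := weight_decomp_lin 1 d1 d2; rewrite scale1r; do 2!eexists; eassumption.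
- move=> x /wc[_ wx]; have [ys d] := weight_decomp_wtspace wx.
  by do 2!eexists; exact: d.
Qed.

Lemma weight_decomp_uniq m xs c ys d :
  weight_decomp m xs c -> weight_decomp m ys d -> c =1 d.
Proof.
move=> dc dd x; have := weight_decomp_lin (-1) dc dd; rewrite scaleN1r addNr.
move=> [uz Oz wz zz /esym E0]; apply/eqP; rewrite eq_sym -subr_eq0 addrC -scaleN1r; apply/eqP.
have [xin|/zz //] := boolP (x \in undup (xs ++ ys)).
by apply: (O_direct hM uz _ E0) => // y yin; split; [exact: Oz|exact: wz].
Qed.

(** The universal property of the direct sum of weight spaces: g applies L x to the component of
    weight x, and uniqueness of the decomposition makes g linear. *)
Lemma glue_wtspaces (W : lmodType K) (L : Lam l -> V -> W) :
    (forall x, linear (L x)) ->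
  exists g : V -> W, linear g /\ forall x m, wtspace x m -> g m = L x m.
Proof.
move=> linL; have [xs /choice[c dec]] := choice weight_decomp_ex.
have L0 x : L x 0 = 0 by exact: linear_map0.
pose g m := \sum_(x <- xs m) L x (c m x).
have gE m ys d : weight_decomp m ys d -> g m = \sum_(y <- ys) L y (d y).
  move=> dm; have cd := weight_decomp_uniq (dec m) dm.
  have [u1 _ _ z1 _] := dec m; have [u2 _ _ z2 _] := dm.
  have off1 x : x \notin xs m -> L x (c m x) = 0 by move=> /z1 ->.
  have off2 x : x \notin ys -> L x (c m x) = 0 by move=> /z2; rewrite cd => ->.
  rewrite /g -(sum_suppE u1 off1) (sum_suppE u2 off2).
  by apply: eq_bigr => x _; rewrite cd.
exists g; split=> [a m m'|x m wm]; last first.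
  have [ys d] := weight_decomp_wtspace wm; rewrite (gE _ _ _ d).
  have [uy _ _ zy mE] := d; have [xin|xN] := boolP (x \in ys).
    rewrite (bigD1_seq x) //= eqxx big1 ?addr0 // => y /negPf ->; exact: L0.
  by have := zy _ xN; rewrite eqxx => ->; rewrite big1 ?L0 // => y _; case: eqP.
rewrite (gE _ _ _ (weight_decomp_lin a (dec m) (dec m'))).
have [u1 _ _ z1 _] := dec m; have [u2 _ _ z2 _] := dec m'.
under eq_bigr do rewrite linL.
rewrite big_split -scaler_sumr /g.
congr (_ *: _ + _); apply/esym/sum_sub_uniq => //; try exact: undup_uniq.
- by move=> x; rewrite mem_undup mem_cat => ->.
- by move=> x /z1 ->.
- by move=> x; rewrite mem_undup mem_cat orbC => ->.
- by move=> x /z2 ->.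
Qed.

Lemma wtspace_ind (P : V -> Prop) : P 0 -> (forall m m', P m -> P m' -> P (m + m')) ->
  (forall x m, wtspace x m -> P m) -> forall m, P m.
Proof.
move=> P0 PD Pw m; have [xs [c [_ _ wc _ ->]]] := weight_decomp_ex m.
by apply: big_ind => // x _; exact: Pw (wc x).
Qed.

End WeightSpaces.

(** * The action of U ⊗ U on M ⊗ M' and diagonal operators *)

Section TensorAction.
Variables (K : fieldType) (l : nat) (q : qparam K).
Local Notation U := (Ugl l q).
Local Notation UU := (tensor U U).
Variables (M M' : lmodType U).
Local Notation T := (tensor (resK M) (resK M')).
Implicit Types (t : UU) (z : T).

Lemma tact_bilin : bilin (@tact K U U M M').
Proof. exact: tmap2_bilin (ract_bilin M) (ract_bilin M'). Qed.

Lemma tact_pure (x y : U) (m : resK M) (n : resK M') :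
  tact (x ⊗ y) (m ⊗ n) = ract x m ⊗ ract y n.
Proof. exact: tmap2_pure (ract_bilin M) (ract_bilin M') _ _ _ _. Qed.

Lemma tactD t z z' : tact t (z + z') = tact t z + tact t z'.
Proof. exact: (bilinDr tact_bilin). Qed.

Lemma tactDl t t' z : tact (t + t') z = tact t z + tact t' z.
Proof. exact: (bilinDl tact_bilin). Qed.

Lemma tactZ t (a : K) z : tact t (a *: z) = a *: tact t z.
Proof. exact: (bilinZr tact_bilin). Qed.

Lemma tactZl t (a : K) z : tact (a *: t) z = a *: tact t z.
Proof. exact: (bilinZl tact_bilin). Qed.

Lemma tact0 t : tact t (0 : T) = 0.
Proof. exact: (bilin0r tact_bilin). Qed.

Lemma tact0l z : tact (0 : UU) z = 0.
Proof. exact: (bilin0l tact_bilin). Qed.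

Lemma tactM t t' z : tact t (tact t' z) = tact (t * t') z.
Proof.
elim/tensor_ind: t => [|x y IHx IHy|x y].
- by rewrite mul0r !tact0l.
- by rewrite mulrDl !tactDl IHx IHy.
elim/tensor_ind: t' => [|x' y' IHx IHy|x' y'].
- by rewrite mulr0 !tact0l tact0.
- by rewrite mulrDr !tactDl tactD IHx IHy.
elim/tensor_ind: z => [|z z' IHx IHy|m n].
- by rewrite !tact0.
- by rewrite !tactD IHx IHy.
by rewrite tpureM !tact_pure !ractM.
Qed.

Lemma tact1 z : tact (1 : UU) z = z.
Proof.
elim/tensor_ind: z => [|z z' IHx IHy|m n]; first exact: tact0.
  by rewrite tactD IHx IHy.
by rewrite [LHS]tact_pure !ract1.
Qed.

Hypotheses (hM : category_O M) (hM' : category_O M').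

Lemma weight_tensor_ind (P : T -> Prop) :
    P 0 -> (forall z z', P z -> P z' -> P (z + z')) ->
    (forall x y m n, wtspace x m -> wtspace y n -> P (m ⊗ n)) ->
  forall z, P z.
Proof.
move=> P0 PD Pw z; elim/tensor_ind: z => [//|//|m n].
elim/(wtspace_ind hM): m => [|m m' Pm Pm'|x m wm].
- by rewrite tpure0l.
- by rewrite tpureDl; exact: PD.
elim/(wtspace_ind hM'): n => [|n n' Pn Pn'|y n wn].
- by rewrite tpure0r.
- by rewrite tpureDr; exact: PD.
exact: Pw wm wn.
Qed.

Lemma weight_tensor_ext (W : lmodType K) (g g' : T -> W) : linear g -> linear g' ->
    (forall x y m n, wtspace x m -> wtspace y n -> g (m ⊗ n) = g' (m ⊗ n)) ->
  g =1 g'.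
Proof.
move=> lg lg' gg'; elim/weight_tensor_ind => [|z z' E E'|//]; first by rewrite !linear_map0.
by rewrite -[z]scale1r lg lg' E E'.
Qed.

(** The operator is built one factor at a time: G x scales M'_y by phi x y, H n glues the maps m |->
    m ⊗ G x n over the weights x of M, and the resulting bilinear map factors through the tensor
    product. *)
Lemma weight_scaling_ex (phi : Lam l -> Lam l -> K) : exists g : T -> T, linear g /\
  forall x y m n, wtspace x m -> wtspace y n -> g (m ⊗ n) = phi x y *: (m ⊗ n).
Proof.
have /choice[G GP] x : exists g : resK M' -> resK M', linear g /\
    forall y n, wtspace y n -> g n = phi x y *: n.
  apply: (glue_wtspaces hM' (L := fun y n => phi x y *: n)) => y a n n'.
  by rewrite scalerDr scalerAC.
have /choice[H HP] n : exists h : resK M -> T, linear h /\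
    forall x m, wtspace x m -> h m = m ⊗ G x n.
  apply: (glue_wtspaces hM (L := fun x m => m ⊗ G x n)) => x a m m'.
  by rewrite tpureDl tpureZl.
have bH : bilin (fun m n => H n m).
  split=> [n|m a n n']; first exact: (HP n).1.
  elim/(wtspace_ind hM): m => [|m m' E E'|x m wm].
  - by rewrite !(linear_map0 (HP _).1) scaler0 addr0.
  - have HD k m1 m2 : H k (m1 + m2) = H k m1 + H k m2.
      by rewrite -{1}[m1]scale1r (HP k).1 scale1r.
    by rewrite !HD E E' scalerDr addrACA.
  - have HE k : H k m = m ⊗ G x k by exact: (HP k).2.
    by rewrite !HE (GP x).1 tpureDr tpureZr.
exists (tlift (fun m n => H n m)); split=> [|x y m n wm wn]; first exact: tlift_linear.
rewrite tlift_pure // ((HP n).2 x m wm) ((GP x).2 y n wn); exact: tpureZr.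
Qed.

End TensorAction.

(** * The diagonal map f~ as an intertwiner *)

Section Ftilde.
Variables (K : fieldType) (l : nat) (q : qparam K).
Local Notation r := (qr q).
Local Notation s := (qs q).
Local Notation U := (Ugl l q).
Local Notation UU := (tensor U U).
Local Notation Ue := (@Ue K l q).
Local Notation Uf := (@Uf K l q).
Local Notation omega := (@omega K l q).
Local Notation omega' := (@omega' K l q).
Variables (pr : U -> U -> K) (hpr : hopf_pairing pr).
Variables (M M' : lmodType U) (hM : category_O M) (hM' : category_O M').
Local Notation T := (tensor (resK M) (resK M')).
Local Notation F := (ftilde pr : T -> T).
Implicit Types (t : UU) (z : T).

(** The default branch of [ftilde] is excluded, since [weight_scaling_ex] provides a map with the
    required eigenvalues. *)
Lemma ftildeP : is_ftilde pr F.
Proof.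
rewrite /ftilde; case: pselect => [g|[]]; first by case: cid.
exact: weight_scaling_ex.
Qed.

Lemma ftildeD z z' : F (z + z') = F z + F z'.
Proof. by rewrite -{1}[z]scale1r ftildeP.1 scale1r. Qed.

Lemma ftilde_bij : bijective F.
Proof.
have [g [lg gE]] := weight_scaling_ex hM hM' (fun x y => (flat pr x y)^-1).
have [lF FE] := ftildeP.
exists g => z.
  apply: (weight_tensor_ext hM hM' (g := g \o F) (g' := id)) => //=.
    by move=> a z1 z2 /=; rewrite lF lg.
  move=> x y m n wm wn /=; rewrite (FE _ _ _ _ wm wn) linear_mapZ // (gE _ _ _ _ wm wn).
  by rewrite scalerA divff ?scale1r //; exact: flat_neq0.
apply: (weight_tensor_ext hM hM' (g := F \o g) (g' := id)) => //=.
  by move=> a z1 z2 /=; rewrite lg lF.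
move=> x y m n wm wn /=; rewrite (gE _ _ _ _ wm wn) linear_mapZ // (FE _ _ _ _ wm wn).
by rewrite scalerA mulVf ?scale1r //; exact: flat_neq0.
Qed.

Lemma ftilde_tact t t' :
    (forall x y m n, wtspace x m -> wtspace y n ->
      F (tact t (m ⊗ n)) = flat pr x y *: tact t' (m ⊗ n)) ->
  forall z, F (tact t z) = tact t' (F z).
Proof.
move=> E; have [lF FE] := ftildeP.
have l1 : linear (fun z => F (tact t z)) by move=> a z z'; rewrite tactD tactZ lF.
have l2 : linear (fun z => tact t' (F z)) by move=> a z z'; rewrite lF tactD tactZ.
apply: (weight_tensor_ext hM hM' l1 l2) => x y m n wm wn /=.
by rewrite (E _ _ _ _ wm wn) (FE _ _ _ _ wm wn) tactZ.
Qed.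

Lemma ftildeZ (a : K) z : F (a *: z) = a *: F z.
Proof. exact: linear_mapZ ftildeP.1. Qed.

Let FE := ftildeP.2.

(** Raising the second weight multiplies f by the eigenvalue of omega'_i on m; raising the first
    divides it by the eigenvalue of omega_i on n, which cancels the omega_i already present. *)
Lemma ftilde_e i z :
  F (tact (1 ⊗ Ue i + Ue i ⊗ omega i) z) = tact (omega' i ⊗ Ue i + Ue i ⊗ 1) (F z).
Proof.
apply: ftilde_tact => x y m n wm wn.
rewrite !tactDl ftildeD !tact_pure !ract1 (wtspace_omega i wn) (wtspace_omega' i wm).
rewrite tpureZr ftildeZ tpureZl (FE wm (wtspace_e i wn)) (FE (wtspace_e i wm) wn).
rewrite flat_addalphar // flat_addalphal // scalerDr !scalerA; congr (_ + _ *: _).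
by rewrite mulrC divfK // bichar_neq0.
Qed.

(** Lowering is raising read backwards: the shift formulas are applied at x - alpha i and y - alpha
    i. *)
Lemma ftilde_f i z :
  F (tact (Uf i ⊗ 1 + omega' i ⊗ Uf i) z) = tact (Uf i ⊗ omega i + 1 ⊗ Uf i) (F z).
Proof.
apply: ftilde_tact => x y m n wm wn.
rewrite !tactDl ftildeD !tact_pure !ract1 (wtspace_omega i wn) (wtspace_omega' i wm).
rewrite tpureZr tpureZl ftildeZ (FE wm (wtspace_f i wn)) (FE (wtspace_f i wm) wn).
rewrite scalerDr !scalerA; congr (_ *: _ + _ *: _).
  have := flat_addalphal hpr (x - alpha i) y i; rewrite subrK => ->.
  by rewrite divfK // bichar_neq0.
by have := flat_addalphar hpr x (y - alpha i) i; rewrite subrK mulrC => ->.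
Qed.

Lemma ftilde_torus (t : U) (phi : Lam l -> K) z :
    (forall x m, @wtspace K l q M x m -> ract t m = phi x *: m) ->
    (forall x m, @wtspace K l q M' x m -> ract t m = phi x *: m) ->
  F (tact (t ⊗ t) z) = tact (t ⊗ t) (F z).
Proof.
move=> tM tM'; apply: ftilde_tact => x y m n wm wn.
rewrite !tact_pure (tM _ _ wm) (tM' _ _ wn) tpureZl tpureZr !ftildeZ (FE wm wn).
by rewrite !scalerA; congr (_ *: _); ring.
Qed.

End Ftilde.

(** Here h - 1 descends a filtration G whose bottom is 0. If h x = 0, then h x - x = -x lies one
    step lower, so x vanishes by induction. For surjectivity, take x with h x = h y - y, available
    one step lower; then h (y - x) = y. *)
Lemma unipotent_bij (V : zmodType) (G : nat -> V -> Prop) (h : V -> V) :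
    {morph h : x y / x - y} -> (forall n x, G n (- x) -> G n x) ->
    (forall x, exists n, G n x) -> (forall x, G 0%N x -> x = 0) ->
    (forall n x, G n.+1 x -> G n (h x - x)) ->
  bijective h.
Proof.
move=> hB GN Gex G0 GS.
have h0 : h 0 = 0 by have := hB 0 0; rewrite !subrr.
have inj x : h x = 0 -> x = 0.
  have [n] := Gex x; elim: n x => [|n IHn] x; first by move/G0.
  by move=> /GS + hx; rewrite hx sub0r => /GN /IHn; exact.
have surj y : exists x, h x = y.
  have [n] := Gex y; elim: n y => [|n IHn] y; first by move/G0 ->; exists 0.
  move=> /GS /IHn[x hx]; exists (y - x).
  by rewrite hB hx opprB addrC subrK.
have [g gE] := choice surj; exists g => // x.
by apply/eqP; rewrite -subr_eq0; apply/eqP/inj; rewrite hB gE subrr.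
Qed.

(** * Theta on M ⊗ M': finiteness, invertibility and intertwining relations *)

Section ThetaAction.
Variables (K : fieldType) (l : nat) (q : qparam K).
Local Notation U := (Ugl l q).
Local Notation UU := (tensor U U).
Local Notation Ue := (@Ue K l q).
Local Notation Uf := (@Uf K l q).
Local Notation omega := (@omega K l q).
Local Notation omega' := (@omega' K l q).
Variables (pr : U -> U -> K) (hpr : hopf_pairing pr).
Variables (d : Lam l -> nat) (u v : forall z, 'I_(d z) -> U).
Arguments u : clear implicits.
Arguments v : clear implicits.
Hypothesis huv : forall z, Qplus z -> dual_bases pr z (u z) (v z).
Variables (M M' : lmodType U) (hM : category_O M) (hM' : category_O M').
Local Notation T := (tensor (resK M) (resK M')).
Local Notation Theta := (Theta u v : T -> T).
Local Notation theta := (theta u v).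
Implicit Types (t : UU) (z : T).

Definition e_nilp n (m : resK M') := forall w, (n <= size w)%N -> ract (eword q w) m = 0.

Lemma e_nilp_leq n k m : (n <= k)%N -> e_nilp n m -> e_nilp k m.
Proof. by move=> nk en w kw; apply: en; exact: leq_trans kw. Qed.

(** If the word w does not kill a vector of weight x, then x + degree w lies below some y in the
    finite bounding set, and height (y - x) is the length of w plus a natural number. This bounds
    the length by the largest such height. *)
Lemma e_nilp_ex m : exists n, e_nilp n m.
Proof.
elim/(wtspace_ind hM'): m => [|m m' [n en] [n' en']|x m wm].
- by exists 0%N => w _; exact: ract0.
- exists (maxn n n') => w; rewrite geq_max ractD => /andP[nw nw'].
  by rewrite en // en' // addr0.
have [Fs FsP] := O_bounded hM'.
exists (\max_(y <- Fs) absz (height (y - x)%R)).+1 => w nw.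
apply/eqP/negPn/negP => m0.
have [y yF /height_Qplus[k yk]] : exists2 y, y \in Fs & Qplus (y - (x + degree w)).
  by apply: FsP; exists (ract (eword q w) m) => //; exact: wtspace_eword.
have : height (y - x) = (k + size w)%N.
  by rewrite PoszD -height_degree -yk -heightD opprD addrA subrK.
move=> yx; have := @leq_bigmax_seq _ Fs xpredT (fun y => absz (height (y - x))) y yF isT.
rewrite yx leqNgt => /negP; apply; apply: leq_trans nw _; exact: leq_addl.
Qed.

(** An explicit finite support for Theta on vectors whose second factor is killed by all words of
    length at least n. *)
Fixpoint short_degrees n : seq (Lam l) :=
  if n is n'.+1 then
    0 :: [seq alpha i + x | i <- enum 'I_l, x <- short_degrees n']
  else [::].

Lemma degree_short n (w : seq 'I_l) : (size w < n)%N -> degree w \in short_degrees n.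
Proof.
elim: n w => // n IHn [|i w] wn; first by rewrite /degree big_nil mem_head.
rewrite in_cons degree_cons; apply/orP; right.
by apply: allpairs_f; [exact: mem_enum|exact: IHn].
Qed.

Lemma e_nilp_Uplus n m x (t : U) :
  e_nilp n m -> x \notin short_degrees n -> Uplus x t -> ract t m = 0.
Proof.
move=> en xN; move: t; apply: Uplus_ind => [|w wx].
  split=> [|a t t' tm tm']; first exact: (bilin0l (ract_bilin M')).
  by rewrite ractDl ractZl tm tm' scaler0 addr0.
by apply: en; rewrite leqNgt; apply: contra xN => /degree_short; rewrite wx.
Qed.

(** A word of nonzero degree is nonempty, so it uses up at least one of the n + 1 letters. *)
Lemma e_nilp_act n m x (t : U) : e_nilp n.+1 m -> x != 0 -> Uplus x t ->
  e_nilp n (ract t m).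
Proof.
move=> en x0; move: t; apply: Uplus_ind => [|w wx].
  split=> [|a t t' tm tm'] w nw; first by rewrite (bilin0l (ract_bilin M')) ract0.
  by rewrite ractDl ractZl ractD ractZ tm // tm' // scaler0 addr0.
move=> w' nw'; rewrite ractM -[_ * _]big_cat; apply: en.
rewrite size_cat -addn1 leq_add // lt0n size_eq0; apply: contra x0 => /eqP w0.
by rewrite -wx w0 /degree big_nil.
Qed.

(** The filtration by nilpotency order in the second factor, where Theta acts through elements of
    U^+; Theta - 1 lowers it strictly. *)
Definition e_filt n : T -> Prop :=
  lspan [set z | exists m m', z = m ⊗ m' /\ e_nilp n m'].

Lemma e_filt_subspace n : subspace (e_filt n).
Proof. exact: lspan_subspace. Qed.

Lemma e_filt_ex z : exists n, e_filt n z.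
Proof.
elim/tensor_ind: z => [|z z' [n zn] [n' zn']|m m'].
- by exists 0%N; case: (e_filt_subspace 0).
- exists (maxn n n'); apply: subspaceD; first exact: e_filt_subspace.
    apply: lspan_sub zn => [|_ [m [m' [-> en]]]]; first exact: e_filt_subspace.
    by apply: lspan_gen; exists m, m'; split=> //; apply: e_nilp_leq en; exact: leq_maxl.
  apply: lspan_sub zn' => [|_ [m [m' [-> en]]]]; first exact: e_filt_subspace.
  by apply: lspan_gen; exists m, m'; split=> //; apply: e_nilp_leq en; exact: leq_maxr.
- by have [n en] := e_nilp_ex m'; exists n; apply: lspan_gen; exists m, m'.
Qed.

Lemma e_filt0 z : e_filt 0 z -> z = 0.
Proof.
move: z; apply: lspan_sub => [|_ [m [m' [-> en]]]].
  by split=> // a z z' -> ->; rewrite scaler0 addr0.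
by have := en [::] isT; rewrite eword_nil ract1 => ->; rewrite tpure0r.
Qed.

Let Uplus_u x k : Qplus x -> Uplus x (u x k).
Proof. by move=> /huv[bu _ _]; exact: is_basis_mem bu. Qed.

Lemma theta_filt_off n z x : e_filt n z -> x \notin short_degrees n -> tact (theta x) z = 0.
Proof.
move=> zn xN; have [Qx|nQx] := pselect (Qplus x); last by rewrite theta_notin // tact0l.
move: z zn; apply: lspan_sub => [|_ [m [m' [-> en]]]].
  split=> [|a z z' E E']; first exact: tact0.
  by rewrite tactD tactZ E E' scaler0 addr0.
rewrite thetaE //; elim/big_rec: _ => [|k t _ E]; first exact: tact0l.
by rewrite tactDl E tact_pure (e_nilp_Uplus en xN) ?tpure0r ?addr0 //; exact: Uplus_u.
Qed.

Lemma theta_filt n z x : e_filt n.+1 z -> x != 0 -> e_filt n (tact (theta x) z).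
Proof.
move=> zn x0; have sn := e_filt_subspace n.
have [Qx|nQx] := pselect (Qplus x); last by rewrite theta_notin // tact0l; case: sn.
move: z zn; apply: lspan_sub => [|_ [m [m' [-> en]]]].
  split=> [|a z z' E E']; first by rewrite tact0; case: sn.
  by rewrite tactD tactZ; apply: (proj2 sn).
rewrite thetaE //; elim/big_rec: _ => [|k t _ E]; first by rewrite tact0l; case: sn.
rewrite tactDl; apply: subspaceD => //; rewrite tact_pure; apply: lspan_gen.
by do 2!eexists; split; [reflexivity|apply: e_nilp_act en x0 _; exact: Uplus_u].
Qed.

Lemma theta_fin_supp z : fin_supp (fun x => tact (theta x) z).
Proof.
by have [n zn] := e_filt_ex z; exists (short_degrees n) => x; exact: theta_filt_off zn.
Qed.

Lemma ThetaE z : Theta z = \sum_(x \in [set: Lam l]) tact (theta x) z.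
Proof.
rewrite /Defs.Theta fsbig_mkcond; apply: eq_fsbigr => x _; rewrite /patch.
case: ifPn => [/set_mem Qx|/negP nQx]; first by rewrite thetaE.
by rewrite theta_notin ?tact0l // => Qx; apply: nQx; exact: mem_set.
Qed.

Lemma ThetaD z z' : Theta (z + z') = Theta z + Theta z'.
Proof.
rewrite !ThetaE -sum_suppD; try exact: theta_fin_supp.
by apply: eq_fsbigr => x _; rewrite tactD.
Qed.

Lemma ThetaZ (a : K) z : Theta (a *: z) = a *: Theta z.
Proof.
rewrite !ThetaE -(sum_supp_map (h := *:%R a)) ?scaler0 //.
- by apply: eq_fsbigr => x _; rewrite tactZ.
- by move=> x y; rewrite scalerDr.
- exact: theta_fin_supp.
Qed.

(** The term of degree 0 acts as the identity and cancels z; every other term lowers the filtration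
    by one step. *)
Lemma Theta_filt n z : e_filt n.+1 z -> e_filt n (Theta z - z).
Proof.
move=> zn; have xs_uniq := undup_uniq (0 :: short_degrees n.+1).
rewrite ThetaE (sum_suppE xs_uniq); last first.
  move=> x; rewrite mem_undup in_cons negb_or => /andP[_]; exact: theta_filt_off zn.
have in0 : 0 \in undup (0 :: short_degrees n.+1) by rewrite mem_undup mem_head.
rewrite (bigD1_seq 0 in0 xs_uniq).
rewrite (theta0 hpr huv) tact1 addrC addKr.
apply: big_ind => [|x y|x x0].
- by case: (e_filt_subspace n).
- by apply: subspaceD; exact: e_filt_subspace.
- exact: theta_filt.
Qed.

Lemma Theta_bij : bijective Theta.
Proof.
have ThetaN z : Theta (- z) = - Theta z by rewrite -scaleN1r ThetaZ scaleN1r.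
apply: (unipotent_bij (G := e_filt)) => [z z'|n z zn|||].
- by rewrite ThetaD ThetaN.
- by rewrite -[z]opprK -scaleN1r; apply: subspaceZ => //; exact: e_filt_subspace.
- exact: e_filt_ex.
- exact: e_filt0.
- exact: Theta_filt.
Qed.

(** Summing the graded relations over all x: each relates degree x to degree x - alpha i, and after
    a translation the two degrees contribute to one and the same sum. *)
Lemma Theta_tact t t' t1 t2 i :
    (forall x, t * theta x - theta x * t'
       = theta (x - alpha i) * t2 - t1 * theta (x - alpha i)) ->
  forall z, tact (t + t1) (Theta z) = Theta (tact (t' + t2) z).
Proof.
move=> E z; rewrite tactDl [in RHS]tactDl ThetaD !ThetaE.
have tact_sum t0 z0 : tact t0 (\sum_(x \in [set: Lam l]) tact (theta x) z0)
    = \sum_(x \in [set: Lam l]) tact (t0 * theta x) z0.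
  rewrite -(sum_supp_map (h := tact t0)); first by apply: eq_fsbigr => x _; rewrite tactM.
  - exact: tact0.
  - exact: tactD.
  - exact: theta_fin_supp.
have supp_l t0 z0 : fin_supp (fun x => tact (t0 * theta x) z0).
  have [xs xsP] := theta_fin_supp z0; exists xs => x /xsP xz.
  by rewrite -tactM xz tact0.
have supp_r t0 z0 : fin_supp (fun x => tact (theta x * t0) z0).
  by have [xs xsP] := theta_fin_supp (tact t0 z0); exists xs => x /xsP; rewrite tactM.
have sum_r t0 z0 : \sum_(x \in [set: Lam l]) tact (theta x) (tact t0 z0)
    = \sum_(x \in [set: Lam l]) tact (theta x * t0) z0.
  by apply: eq_fsbigr => x _; rewrite tactM.
(* Only the terms with t1 and t2 are translated, so that the summands at x are exactly the four
   terms of the hypothesis. *)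
rewrite !tact_sum !sum_r -(sum_supp_shift (fun x => tact (t1 * theta x) z) (alpha i)).
rewrite -(sum_supp_shift (fun x => tact (theta x * t2) z) (alpha i)).
rewrite -sum_suppD; [|exact: supp_l|exact: fin_supp_shift (supp_l t1 z)].
rewrite -sum_suppD; [|exact: supp_r|exact: fin_supp_shift (supp_r t2 z)].
apply: eq_fsbigr => x _; rewrite -!tactDl; congr (tact _ z).
by have /eqP := E x; rewrite subr_eq => /eqP ->; rewrite addrAC subrK addrC.
Qed.

Lemma Theta_e i z :
  tact (Ue i ⊗ 1 + omega i ⊗ Ue i) (Theta z) = Theta (tact (Ue i ⊗ 1 + omega' i ⊗ Ue i) z).
Proof. by apply: Theta_tact => x; exact: (theta_e hpr huv). Qed.

Lemma Theta_f i z :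
  tact (1 ⊗ Uf i + Uf i ⊗ omega' i) (Theta z) = Theta (tact (1 ⊗ Uf i + Uf i ⊗ omega i) z).
Proof. by apply: Theta_tact => x; exact: (theta_f hpr huv). Qed.

Lemma Theta_torus (t : U) (p : K) i z : p != 0 ->
    (forall j, t * Ue j = p ^ dot (eps i) (alpha j) *: (Ue j * t)) ->
    (forall j, t * Uf j = p ^ (- dot (eps i) (alpha j)) *: (Uf j * t)) ->
  tact (t ⊗ t) (Theta z) = Theta (tact (t ⊗ t) z).
Proof.
move=> p0 te tf; rewrite !ThetaE -(sum_supp_map (h := tact (t ⊗ t))).
- by apply: eq_fsbigr => x _; rewrite !tactM (theta_torus huv x p0 te tf).
- exact: tact0.
- exact: tactD.
- exact: theta_fin_supp.
Qed.

End ThetaAction.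

(** * The flip *)

Section Flip.
Variables (K : fieldType) (V W : lmodType K).

Let flip_bilin : bilin (fun (v : V) (w : W) => w ⊗ v).
Proof.
by split=> [w a v v'|v a w w']; [rewrite tpureDr tpureZr|rewrite tpureDl tpureZl].
Qed.

Lemma tflip_pure (v : V) (w : W) : tflip (v ⊗ w) = w ⊗ v.
Proof. exact: tlift_pure. Qed.

Lemma tflip_linear : linear (@tflip K V W).
Proof. exact: tlift_linear. Qed.

Lemma tflipD : {morph @tflip K V W : x y / x + y}.
Proof. by move=> x y; rewrite -[x]scale1r tflip_linear !scale1r. Qed.

Lemma tflip0 : tflip (0 : tensor V W) = 0.
Proof. exact: linear_map0 tflip_linear. Qed.

End Flip.

Lemma tflipK (K : fieldType) (V W : lmodType K) : cancel (@tflip K V W) (@tflip K W V).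
Proof.
elim/tensor_ind => [|x y IHx IHy|v w]; first by rewrite !tflip0.
  by rewrite !tflipD IHx IHy.
by rewrite !tflip_pure.
Qed.

Lemma tflip_bij (K : fieldType) (V W : lmodType K) : bijective (@tflip K V W).
Proof. by exists (@tflip K W V); exact: tflipK. Qed.

Lemma tflip_tact (K : fieldType) (l : nat) (q : qparam K) (M M' : lmodType (Ugl l q))
    (t : tensor (Ugl l q) (Ugl l q)) (z : tensor (resK M') (resK M)) :
  tflip (tact t z) = tact (tflip t) (tflip z).
Proof.
elim/tensor_ind: t => [|x y IHx IHy|x y].
- by rewrite tact0l !tflip0 tact0l.
- by rewrite tactDl !tflipD tactDl IHx IHy.
elim/tensor_ind: z => [|z z' IHx IHy|m n].
- by rewrite tact0 tflip0 tact0.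
- by rewrite tactD !tflipD tactD IHx IHy.
by rewrite tact_pure !tflip_pure tact_pure.
Qed.

(** * The composite map and its equivariance *)

Section Braiding.
Variables (K : fieldType) (l : nat) (q : qparam K).
Local Notation U := (Ugl l q).
Local Notation Ue := (@Ue K l q).
Local Notation Uf := (@Uf K l q).
Variables (pr : U -> U -> K) (hpr : hopf_pairing pr).
Variables (d : Lam l -> nat) (u v : forall z, 'I_(d z) -> U).
Arguments u : clear implicits.
Arguments v : clear implicits.
Hypothesis huv : forall z, Qplus z -> dual_bases pr z (u z) (v z).
Variables (M M' : lmodType U) (hM : category_O M) (hM' : category_O M').
Local Notation T' := (tensor (resK M') (resK M)).
Local Notation T := (tensor (resK M) (resK M')).

Definition braiding (z : T') : T := Theta u v (ftilde pr (tflip z : tensU M M')).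

Lemma braiding_bij : bijective braiding.
Proof.
apply: (bij_comp (f := Theta u v : T -> T)); first exact: (Theta_bij hpr huv).
apply: (bij_comp (f := ftilde pr : T -> T) (h := @tflip K _ _)); last exact: tflip_bij.
exact: (ftilde_bij hpr hM hM').
Qed.

Lemma braidingD : {morph braiding : z z' / z + z'}.
Proof. by move=> z z'; rewrite /braiding tflipD (ftildeD pr hM hM') (ThetaD huv hM'). Qed.

Lemma braidingZ (a : K) z : braiding (a *: z) = a *: braiding z.
Proof.
rewrite /braiding -(ThetaZ huv hM') -(ftildeZ pr hM hM'); congr (Theta _ _ (ftilde _ _)).
exact: linear_mapZ (@tflip_linear _ _ _).
Qed.

(** The flip turns the coproduct of e_i into 1 ⊗ e_i + e_i ⊗ omega_i, f~ turns this into omega'_i ⊗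
    e_i + e_i ⊗ 1, and Theta restores e_i ⊗ 1 + omega_i ⊗ e_i. *)
Lemma braiding_e i z : braiding (tact (comul (Ue i)) z) = tact (comul (Ue i)) (braiding z).
Proof.
rewrite /braiding tflip_tact comul_e tflipD !tflip_pure (ftilde_e hpr hM hM').
by rewrite (Theta_e hpr huv hM') [_ ⊗ _ + _ ⊗ _ in RHS]addrC.
Qed.

Lemma braiding_f i z : braiding (tact (comul (Uf i)) z) = tact (comul (Uf i)) (braiding z).
Proof.
rewrite /braiding tflip_tact comul_f tflipD !tflip_pure (ftilde_f hpr hM hM').
by rewrite (Theta_f hpr huv hM') addrC.
Qed.

Let commutes (t : U) := forall z, braiding (tact (comul t) z) = tact (comul t) (braiding z).

Lemma braiding_a i : commutes (Ua q i).
Proof.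
move=> z; have D : comul (Ua q i) = Ua q i ⊗ Ua q i by exact: comul_torus.
rewrite /braiding D tflip_tact tflip_pure.
rewrite (ftilde_torus (phi := fun x => qr q ^ dot (eps i) x) pr hM hM').
- by rewrite (Theta_torus huv hM' (i := i) (p := qr q)) ?qr_neq0 // => j;
    [exact: Ua_e|exact: Ua_f].
- by move=> x m wm; case: (wm i).
- by move=> x m wm; case: (wm i).
Qed.

Lemma braiding_b i : commutes (Ub q i).
Proof.
move=> z; have D : comul (Ub q i) = Ub q i ⊗ Ub q i by exact: comul_torus.
rewrite /braiding D tflip_tact tflip_pure.
rewrite (ftilde_torus (phi := fun x => qs q ^ dot (eps i) x) pr hM hM').
- by rewrite (Theta_torus huv hM' (i := i) (p := qs q)) ?qs_neq0 // => j;
    [exact: Ub_e|exact: Ub_f].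
- by move=> x m wm; case: (wm i).
- by move=> x m wm; case: (wm i).
Qed.

(** Insert t' t = 1 after the braiding and move t inside, where it cancels t'. *)
Lemma braiding_inv (t t' : U) : t * t' = 1 -> t' * t = 1 -> commutes t -> commutes t'.
Proof.
move=> tt' t't ct z.
rewrite -[LHS]tact1 -comul1 -t't comulM -tactM -ct; congr (tact _ _).
by rewrite tactM -comulM tt' comul1 tact1.
Qed.

Lemma braiding_commutes (t : U) : commutes t.
Proof.
elim/presented_ind: t => [[j|j|i|i|i|i]|a|t t' ct ct'|t t' ct ct'] z.
- exact: braiding_e.
- exact: braiding_f.
- exact: braiding_a.
- apply: (braiding_inv (t := Ua q i)); [exact: UaK| |exact: braiding_a].
  by rewrite [LHS]UtorusC //; exact: UaK.
- exact: braiding_b.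
- apply: (braiding_inv (t := Ub q i)); [exact: UbK| |exact: braiding_b].
  by rewrite [LHS]UtorusC //; exact: UbK.
- have -> : pscal _ a = a *: 1 :> U by rewrite [RHS]mulr1.
  by rewrite comulZ comul1 !tactZl !tact1 braidingZ.
- by rewrite comulD !tactDl braidingD ct ct'.
- by rewrite comulM -!tactM ct ct'.
Qed.

End Braiding.

Theorem theorem4p11 (K : closedFieldType) (l : nat) (hl : (0 < l)%N)
  (r s : K) (hr : r != 0) (hs : s != 0) (hrs : r != s)
  (pr : Ugl l (QParam hr hs hrs) -> Ugl l (QParam hr hs hrs) -> K)
  (hpr : hopf_pairing pr)
  (d : Lam l -> nat) (u v : forall z, 'I_(d z) -> Ugl l (QParam hr hs hrs))
  (huv : forall z, Qplus z -> dual_bases pr z (u z) (v z))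
  (M M' : lmodType (Ugl l (QParam hr hs hrs)))
  (hM : category_O M) (hM' : category_O M') :
  is_iso (fun z : tensU M' M =>
    Theta u v (ftilde pr (tflip z : tensU M M'))).
Proof.
split; last exact: (braiding_bij hpr huv hM hM').
(* The scalar action of t on a tensor product module is by definition [tact (comul t)], so
   U-linearity is additivity together with [braiding_commutes]. *)
move=> t z z'; rewrite -[LHS]/(braiding pr u v (tact (comul t) z + z')).
by rewrite (braidingD huv hM hM') (braiding_commutes hpr huv hM hM').
Qed.
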